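(* Let $f=f_h\in\mathcal{L}^0(\mathcal{T}_h)$, and let $\psi(x,t)=\psi_h(x,t)=-f_h(x)t$. Let $u_h^{cr}\in \mathcal{S}^{1,cr}_D(\mathcal{T}_h)$ and $z_h^{rt}\in \mathcal{R}T^0_N(\mathcal{T}_h)$ be such that $$I_h^{cr}(u_h^{cr})=D_h^{rt}(z_h^{rt}),$$ $$\int_{\Omega}\phi(\nabla_h u_h^{cr})\,dx=\sup_{y_h\in \mathcal{R}T^0_N(\mathcal{T}_h)}\Big\{\int_{\Omega}\nabla_h u_h^{cr}\cdot\Pi_h y_h\,dx-\int_{\Omega}\phi^*(\Pi_h y_h)\,dx\Big\},$$ $$\int_{\Omega}\psi_h^*(\cdot,\mathrm{div}(z_h^{rt}))\,dx=\sup_{v_h\in \mathcal{S}^{1,cr}_D(\mathcal{T}_h)}\Big\{\int_{\Omega}\mathrm{div}(z_h^{rt})\,\Pi_h v_h\,dx-\int_{\Omega}\psi_h(\cdot,\Pi_h v_h)\,dx\Big\}.$$ Then, for every $\tilde u_h\in\mathcal{S}^1_D(\mathcal{T}_h)$, $$\rho_I^2(\tilde u_h,u)\le\eta_h^2(\tilde u_h,z_h^{rt})=\int_\Omega\phi(\nabla\tilde u_h)-\Pi_h z_h^{rt}\cdot(\nabla\tilde u_h-\nabla_h u_h^{cr})-\phi(\nabla_h u_h^{cr})\,dx+\int_\Omega\phi^*(z_h^{rt})-\phi^*(\Pi_h z_h^{rt})\,dx.$$ Here $\rho_I^2:W^{1,p}_D(\Omega)\times W^{1,p}_D(\Omega)\to\mathbb{R}_{\ge0}$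 is a measure for the co-coercivity of $I$ at a minimizer $u\in W^{1,p}_D(\Omega)$ of $I$, i.e., any functional with $\rho_I^2(v,u)\le I(v)-I(u)$ for all $v\in W^{1,p}_D(\Omega)$.
   Context: Domain and mesh: $\Omega\subseteq\mathbb{R}^d$, $d\in\mathbb{N}$, is a bounded polyhedral Lipschitz domain; $\partial\Omega=\Gamma_D\cup\Gamma_N$ is a disjoint union with $\Gamma_D$ closed. $\mathcal{T}_h$ is a shape-regular conforming triangulation of $\Omega$ into simplices with set of sides $\mathcal{S}_h$; each boundary side is contained in $\Gamma_D$ or in the closure of $\Gamma_N$. $x_S$ is the barycenter of a side $S$, $n_T$ the outward unit normal of $T$, $n$ the outward unit normal of $\Omega$, and $[\![\cdot]\!]_S$ the jump across an interior side $S$ (for vector fields $[\![y_h\cdot n]\!]_S=y_h|_{T_+}\cdot n_{T_+}+y_h|_{T_-}\cdot n_{T_-}$, with $T_\pm$ the two elements sharing $S$). Spaces and operators: $p\in(1,\infty)$; $W^{1,p}_D(\Omega)$ is the space of $v\in W^{1,p}(\Omega)$ with zero trace on $\Gamma_D$. $\mathcal{L}^k(\mathcal{T}_h)$ denotes functions that are polynomials of degree at most $k$ on each element. $\mathcal{S}^1_D(\mathcal{T}_h)$ is the space of continuous, element-wise affine functions vanishing on $\Gamma_D$. $\Pi_h$ is the $L^2$-projection onto element-wise constant functions (or vector fields). $\nabla_h$ is the element-wise gradient. $\mathcal{S}^{1,cr}_D(\mathcal{T}_h)$ (Crouzeix--Raviart space) is the set of $v_h\in\mathcal{L}^1(\mathcal{T}_h)$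 with $\int_S[\![v_h]\!]_S\,ds=0$ for every interior side $S$ and $v_h(x_S)=0$ for every side $S\subseteq\Gamma_D$. $\mathcal{R}T^0_N(\mathcal{T}_h)$ (lowest order Raviart--Thomas space) is the set of $y_h\in\mathcal{L}^1(\mathcal{T}_h)^d$ such that $y_h|_T\cdot n_T$ is constant on each side of $T$ for all $T\in\mathcal{T}_h$, $[\![y_h\cdot n]\!]_S=0$ on every interior side $S$, and $y_h\cdot n=0$ on $\Gamma_N$. Functionals: $\phi:\mathbb{R}^d\to\mathbb{R}\cup\{+\infty\}$ is proper, convex and lower semi-continuous, with Fenchel conjugate $\phi^*$. The primal functional is $$I(v)=\int_\Omega\phi(\nabla v)\,dx-\int_\Omega f\,v\,dx,\qquad v\in W^{1,p}_D(\Omega),$$ which is assumed (standing assumption) to be proper, convex, weakly coercive and lower semi-continuous, so that a (possibly non-unique) minimizer $u\in W^{1,p}_D(\Omega)$ exists. $\psi_h^*$ is the Fenchel conjugate of $\psi_h(x,t)=-f_h(x)t$ in the second argument, i.e. $\psi_h^*(x,s)=0$ if $s=-f_h(x)$ and $+\infty$ otherwise. The discrete functionals are $$I_h^{cr}(v_h)=\int_\Omega\phi(\nabla_h v_h)\,dx-\int_\Omega f_h\,\Pi_h v_h\,dx,\qquad v_h\in\mathcal{S}^{1,cr}_D(\mathcal{T}_h),$$ $$D_h^{rt}(y_h)=-\int_\Omega\phi^*(\Pi_h y_h)\,dx-\int_\Omega\psi_h^*(\cdot,\mathrm{div}(y_h))\,dx,\qquad y_h\in\mathcal{R}T^0_N(\mathcal{T}_h);$$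 $I_h^{cr}$ is assumed to admit a minimizer. The primal-dual error estimator is, for $\tilde u_h\in\mathcal{S}^1_D(\mathcal{T}_h)$ and $\tilde z_h\in\mathcal{R}T^0_N(\mathcal{T}_h)$, $$\eta_h^2(\tilde u_h,\tilde z_h)=\int_\Omega\phi(\nabla\tilde u_h)-\tilde z_h\cdot\nabla\tilde u_h+\phi^*(\tilde z_h)\,dx+\int_\Omega\psi_h(\cdot,\tilde u_h)-\mathrm{div}(\tilde z_h)\,\tilde u_h+\psi_h^*(\cdot,\mathrm{div}(\tilde z_h))\,dx.$$ *)

(* Defs.v *)
From HB Require Import structures.
From mathcomp Require Import all_boot all_order all_algebra.
From mathcomp Require Import all_classical all_reals all_analysis.
Set Implicit Arguments. Unset Strict Implicit. Unset Printing Implicit Defensive.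
Import Order.TTheory GRing.Theory Num.Theory.
Import numFieldNormedType.Exports.
Local Open Scope classical_set_scope.
Local Open Scope ring_scope.

Definition rV_display : measure_display. Proof. exact: default_measure_display. Qed.

(* 'rV[R]_n carries the sigma-algebra generated by the coordinates, that is the
   Borel sigma-algebra of R^n. *)
Section measurable_rV.
Context (R : realType) (n : nat).

Let coord (i : 'I_n) (x : 'rV[R]_n) : R := x 0 i.

Let rV_set0 : g_sigma_preimage coord set0.
Proof. exact: sigma_algebra0. Qed.

Let rV_setC A : g_sigma_preimage coord A -> g_sigma_preimage coord (~` A).
Proof. exact: sigma_algebraC. Qed.

Let rV_bigcup (F : _^nat) : (forall i, g_sigma_preimage coord (F i)) ->
  g_sigma_preimage coord (\bigcup_i (F i)).
Proof. exact: sigma_algebra_bigcup. Qed.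

HB.instance Definition _ := @isMeasurable.Build rV_display
  'rV[R]_n (g_sigma_preimage coord) rV_set0 rV_setC rV_bigcup.

Lemma measurable_fun_rV d (T : measurableType d) (f : T -> 'rV[R]_n) :
  (forall i, measurable_fun setT (fun x => f x 0 i)) -> measurable_fun setT f.
Proof.
move=> mf _ A /= mA; rewrite setTI.
suff : preimage_set_system setT f (g_sigma_preimage coord) `<=` measurable.
  by apply; exists A => //; rewrite setTI.
rewrite -g_sigma_preimage_comp; apply: smallest_sub.
  exact: sigma_algebra_measurable.
rewrite -bigcup_seq => B [i _ [C mC <-]]; exact: mf.
Qed.

End measurable_rV.

Section lebesgue_rV.
Context (R : realType).
Local Open Scope ereal_scope.

Definition consV n (p : measurableTypeR R * 'rV[R]_n) : 'rV[R]_n.+1 :=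
  \row_j oapp (p.2 0%R) p.1 (unlift ord0 j).

Definition unconsV n (x : 'rV[R]_n.+1) : measurableTypeR R * 'rV[R]_n :=
  (x 0%R ord0, \row_j x 0%R (lift ord0 j)).

Lemma consVK n : cancel (@consV n) (@unconsV n).
Proof.
case=> a x; rewrite /consV /unconsV; congr pair.
  by rewrite mxE unlift_none.
by apply/rowP => j; rewrite !mxE liftK.
Qed.

Lemma measurable_coord n (i : 'I_n) :
  measurable_fun setT (fun x : 'rV[R]_n => x 0%R i).
Proof.
move=> _ Y mY; rewrite setTI; apply: sub_sigma_algebra => /=.
rewrite -bigcup_seq/=; exists i => /=; first by rewrite mem_index_enum.
by exists Y => //; rewrite setTI.
Qed.

Lemma measurable_consV n : measurable_fun setT (@consV n).
Proof.
apply: measurable_fun_rV => i; under eq_fun do rewrite mxE.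
case: unliftP => [j _|_] /=; last exact: measurable_fst.
by apply: (measurableT_comp (measurable_coord j)); exact: measurable_snd.
Qed.

Lemma measurable_unconsV n : measurable_fun setT (@unconsV n).
Proof.
apply: measurable_fun_pair; first exact: measurable_coord.
apply: measurable_fun_rV => i; under eq_fun do rewrite mxE.
exact: measurable_coord.
Qed.


Section lebesgueS.
Context n (mu : {sigma_finite_measure set 'rV[R]_n -> \bar R}).

Definition lebesgueS (A : set 'rV[R]_n.+1) : \bar R :=
  (@lebesgue_measure R \x mu) (@consV n @^-1` A).

Let mcons A : measurable A -> measurable (@consV n @^-1` A).
Proof.
by move=> mA; rewrite -[X in measurable X]setTI; exact: measurable_consV.
Qed.

Let lebesgueS0 : lebesgueS set0 = 0.
Proof. by rewrite /lebesgueS preimage_set0 measure0. Qed.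

Let lebesgueS_ge0 A : 0 <= lebesgueS A.
Proof. exact: measure_ge0. Qed.

Let lebesgueS_sigma_additive : semi_sigma_additive lebesgueS.
Proof.
move=> F mF tF mUF; rewrite /lebesgueS preimage_bigcup.
apply: measure_semi_sigma_additive.
- by move=> k; exact: mcons.
- apply/trivIsetP => /= i j _ _ ij; rewrite -preimage_setI.
  by move/trivIsetP : tF => /(_ _ _ _ _ ij) ->//; rewrite preimage_set0.
- by rewrite -preimage_bigcup; exact: mcons.
Qed.

HB.instance Definition _ := isMeasure.Build _ _ _ lebesgueS
  lebesgueS0 lebesgueS_ge0 lebesgueS_sigma_additive.

Let lebesgueS_sigma_finite : sigma_finite setT lebesgueS.
Proof.
have /sigma_finiteP[F [TF ndF Foo]] := sigma_finiteT (@lebesgue_measure R).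
have /sigma_finiteP[G [TG ndG Goo]] := sigma_finiteT mu.
exists (fun k => @unconsV n @^-1` (F k `*` G k)).
  rewrite -preimage_bigcup (_ : \bigcup_i _ = setT) ?preimage_setT//.
  rewrite -setXTT TF TG predeqE => -[x y]; split => [[k _ []/= ? ?]|].
    by split; exists k.
  move=> [/= [i _ Fnx] [k _ Gky]]; exists (maxn i k) => //; split.
  - by move: x Fnx; exact/subsetPset/ndF/leq_maxl.
  - by move: y Gky; exact/subsetPset/ndG/leq_maxr.
move=> k; have [? ?] := Foo k; have [? ?] := Goo k; split.
  rewrite -[X in measurable X]setTI; apply: measurable_unconsV => //.
  exact: measurableX.
rewrite /lebesgueS -comp_preimage (_ : _ \o _ = id) ?preimage_id.
  by rewrite product_measure1E// lte_mul_pinfty// ge0_fin_numE.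
by apply/funext => x /=; rewrite consVK.
Qed.

HB.instance Definition _ := Measure_isSigmaFinite.Build _ _ _ lebesgueS
  lebesgueS_sigma_finite.
End lebesgueS.

(* Lebesgue measure on R^n, as the iterated product of the one on R. *)
Fixpoint lebesgueV n : {sigma_finite_measure set 'rV[R]_n -> \bar R} :=
  if n is m.+1 then lebesgueS (lebesgueV m) else dirac (0%R : 'rV[R]_0).
End lebesgue_rV.

Arguments lebesgueV R n : clear implicits.

Section geometry.
Context (R : realType) (n : nat).
Implicit Types (x y z : 'rV[R]_n) (A : set 'rV[R]_n).

Definition dotv x y : R := \sum_i x 0 i * y 0 i.

(* The library's norm on 'rV is the sup norm. *)
Definition enorm x : R := Num.sqrt (dotv x x).

(* Convex hull of the a i such that P i. *)
Definition face m (a : 'I_m -> 'rV[R]_n) (P : set 'I_m) : set 'rV[R]_n :=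
  [set x | exists t : 'I_m -> R,
    [/\ forall i, 0 <= t i, forall i, ~ P i -> t i = 0,
        \sum_i t i = 1 & x = \sum_i t i *: a i]].

Definition simplex m (a : 'I_m -> 'rV[R]_n) : set 'rV[R]_n := face a setT.

Definition edges m (a : 'I_m.+1 -> 'rV[R]_n) : 'M[R]_(m, n) :=
  \matrix_(i < m) (a (lift ord0 i) - a ord0).

Definition affinely_independent m (a : 'I_m.+1 -> 'rV[R]_n) := row_free (edges a).

Definition barycenter m (a : 'I_m -> 'rV[R]_n) : 'rV[R]_n :=
  m%:R^-1 *: \sum_i a i.

Definition ref_simplex m : set 'rV[R]_m :=
  [set xi | (forall i, 0 <= xi 0 i) /\ \sum_i xi 0 i <= 1].
Arguments ref_simplex m _ : clear implicits.

(* Integral of g over the m-simplex with vertices a for the m-dimensional surface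
   measure, through the affine parametrization and its Gram determinant. For
   m = 0 it is the value of g at the vertex. *)
Definition surface_integral m (a : 'I_m.+1 -> 'rV[R]_n)
    (g : 'rV[R]_n -> \bar R) : \bar R :=
  ((Num.sqrt (\det (edges a *m (edges a)^T)))%:E *
   \int[lebesgueV R m]_(xi in ref_simplex m) g (a ord0 + xi *m edges a)%R)%E.

Definition boundary A := closure A `\` interior A.

(* Locally, A is the strict epigraph in the direction nu of a Lipschitz function
   gam of the coordinates orthogonal to nu. *)
Definition lipschitz_boundary A := forall x, boundary A x ->
  exists (nu : 'rV[R]_n) (gam : 'rV[R]_n -> R) (L : R),
  [/\ enorm nu = 1,
      forall y t, gam (y + t *: nu) = gam y,
      forall y z, `|gam y - gam z| <= L * enorm (y - z) &
      \forall y \near x, A y <-> gam y < dotv y nu].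

Definition polyhedral A := exists (m : nat) (a : 'I_m -> 'I_n.+1 -> 'rV[R]_n),
  (forall k, affinely_independent (a k)) /\
  closure A = \bigcup_(k in [set: 'I_m]) simplex (a k).

Definition polyhedral_lipschitz_domain A :=
  [/\ open A, A !=set0, connected A, bounded_set A &
      lipschitz_boundary A /\ polyhedral A].

End geometry.

Arguments ref_simplex {R} m _.


Section convex_analysis.
Context (R : realType) (n : nat).
Local Open Scope ereal_scope.
Implicit Type phi : 'rV[R]_n -> \bar R.

Definition proper_fun phi :=
  (forall x, phi x != -oo) /\ (exists x, phi x < +oo).

Definition convex_efun phi := forall x y (t : R), (0 <= t <= 1)%R ->
  phi (t *: x + (1 - t) *: y)%R <= t%:E * phi x + (1 - t)%:E * phi y.

Definition fenchel phi (s : 'rV[R]_n) : \bar R :=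
  ereal_sup [set (dotv s x)%:E - phi x | x in [set: 'rV[R]_n]].

End convex_analysis.

Section sobolev.
Context (R : realType) (n : nat) (p : R) (Omega : set 'rV[R]_n).
Implicit Types (v w g : 'rV[R]_n -> R) (G : 'rV[R]_n -> 'rV[R]_n).
Local Notation leb := (lebesgueV R n).

Definition unit_vec (i : 'I_n) : 'rV[R]_n := delta_mx 0 i.

Definition partials (s : seq 'I_n) (v : 'rV[R]_n -> R) : 'rV[R]_n -> R :=
  foldr (fun i w x => 'D_(unit_vec i) w x) v s.

Definition smooth v := forall s, continuous (partials s v) /\
  forall x i, derivable (partials s v) x (unit_vec i).

Definition test_function v := smooth v /\
  exists K : set 'rV[R]_n, [/\ compact K, K `<=` Omega & forall x, ~ K x -> v x = 0].

Definition in_Lp v := measurable_fun Omega v /\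
  (\int[leb]_(x in Omega) (`|v x| `^ p)%:E < +oo)%E.

Definition weak_gradient v G := (forall i, in_Lp (fun x => G x 0 i)) /\
  forall w, test_function w -> forall i,
    (\int[leb]_(x in Omega) (v x * 'D_(unit_vec i) w x)%:E =
     - (\int[leb]_(x in Omega) (G x 0 i * w x)%:E))%E.

(* W^{1,p}(Omega); its elements are represented by functions on R^n, of which
   only the values in Omega matter. *)
Definition W1p : set ('rV[R]_n -> R) :=
  [set v | in_Lp v /\ exists G, weak_gradient v G].

Definition wgrad v : 'rV[R]_n -> 'rV[R]_n := xget (cst 0) (weak_gradient v).

Definition W1p_norm v : \bar R :=
  ((\int[leb]_(x in Omega) (`|v x| `^ p)%:E +
    \int[leb]_(x in Omega) (enorm (wgrad v x) `^ p)%:E) `^ p^-1)%E.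

Definition W1p_cvg (vs : nat -> 'rV[R]_n -> R) v :=
  (fun j => W1p_norm (fun x => vs j x - v x)) @ \oo --> 0%E.

End sobolev.

Section trace.
Context (R : realType) (d : nat) (p : R) (Omega : set 'rV[R]_d.+1).
Implicit Types v g : 'rV[R]_d.+1 -> R.

(* The trace operator is the continuous extension to W^{1,p}(Omega), with values
   in L^p(boundary), of the restriction of functions continuous up to the
   boundary. Omega being polyhedral, its boundary is a finite union of
   (n-1)-simplices, so that convergence in L^p of the boundary is convergence in
   L^p of each (n-1)-simplex contained in it. *)
Definition is_trace v g := measurable_fun setT g /\
  exists vs : nat -> 'rV[R]_d.+1 -> R,
  [/\ forall j, W1p p Omega (vs j) /\ {within closure Omega, continuous (vs j)},
      W1p_cvg p Omega vs v &
      forall a : 'I_d.+1 -> 'rV[R]_d.+1, simplex a `<=` boundary Omega ->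
        (fun j => surface_integral a (fun x => (`|vs j x - g x| `^ p)%:E))
          @ \oo --> 0%E].

Definition W1pD (GammaD : set 'rV[R]_d.+1) : set ('rV[R]_d.+1 -> R) :=
  [set v | W1p p Omega v /\
           exists g, is_trace v g /\ forall x, GammaD x -> g x = 0].

End trace.

Section functionals.
Context (R : realType) (n : nat) (W : set ('rV[R]_n -> R))
  (norm : ('rV[R]_n -> R) -> \bar R) (J : ('rV[R]_n -> R) -> \bar R).
Local Open Scope ereal_scope.

Definition proper_on := (forall v, W v -> J v != -oo) /\
  (exists2 v, W v & J v < +oo).

Definition convex_on := forall v w (t : R), W v -> W w -> (0 <= t <= 1)%R ->
  J (fun x => t * v x + (1 - t) * w x)%R <= t%:E * J v + (1 - t)%:E * J w.

Definition weakly_coercive_on := forall vs : nat -> 'rV[R]_n -> R,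
  (forall j, W (vs j)) ->
  (fun j => norm (vs j)) @ \oo --> +oo -> (fun j => J (vs j)) @ \oo --> +oo.

Definition lsc_on := forall (vs : nat -> 'rV[R]_n -> R) v,
  (forall j, W (vs j)) -> W v ->
  (fun j => norm (fun x => vs j x - v x)%R) @ \oo --> 0 ->
  J v <= limn_einf (fun j => J (vs j)).

Definition minimizer (T : Type) (X : set T) (F : T -> \bar R) (v : T) :=
  X v /\ forall w, X w -> F v <= F w.

End functionals.

(* The n-simplices of the mesh, given by their vertices. *)
Record mesh (R : realType) (n : nat) := Mesh {
  ne : nat;
  elt : 'I_ne -> 'I_n.+1 -> 'rV[R]_n }.

Section triangulation.
Context (R : realType) (d : nat).
Local Notation n := d.+1.
Implicit Types (M : mesh R n) (Omega Gamma : set 'rV[R]_n).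

Definition tri M (k : 'I_(ne M)) : set 'rV[R]_n := simplex (elt k).

(* Vertices of the side of element k opposite to its i-th vertex. A side S of the
   mesh is a set simplex (side k i); it is interior when it is shared by two
   distinct elements. *)
Definition side M (k : 'I_(ne M)) (i : 'I_n.+1) : 'I_n -> 'rV[R]_n :=
  fun j => elt k (lift i j).

Definition conforming M := forall k l : 'I_(ne M), k != l ->
  range (elt k) <> range (elt l) /\
  tri k `&` tri l = face (elt k) [set i | range (elt l) (elt k i)].

(* kappa bounds the ratio diameter / inradius of all elements. *)
Definition shape_regular (kappa : R) M := forall k : 'I_(ne M),
  exists (c : 'rV[R]_n) (r : R),
  [/\ 0 < r, forall x, enorm (x - c) <= r -> tri k x &
      forall x y, tri k x -> tri k y -> enorm (x - y) <= kappa * r].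

Definition triangulation (kappa : R) Omega M :=
  [/\ forall k : 'I_(ne M), affinely_independent (elt k),
      closure Omega = \bigcup_(k in [set: 'I_(ne M)]) tri k,
      conforming M & shape_regular kappa M].

Definition boundary_partition Omega (GammaD GammaN : set 'rV[R]_n) :=
  [/\ boundary Omega = GammaD `|` GammaN, GammaD `&` GammaN = set0 &
      closed GammaD].

Definition sides_compatible Omega (GammaD GammaN : set 'rV[R]_n) M :=
  forall (k : 'I_(ne M)) i, simplex (side k i) `<=` boundary Omega ->
    simplex (side k i) `<=` GammaD \/ simplex (side k i) `<=` closure GammaN.

(* Outward unit normal of element k on its side i; on a boundary side this is
   also the outward unit normal of Omega. *)
Definition outer_normal M (k : 'I_(ne M)) (i : 'I_n.+1) : 'rV[R]_n :=
  xget 0 [set nu | [/\ enorm nu = 1,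
    forall j l, dotv nu (side k i j - side k i l) = 0 &
    dotv nu (elt k i - side k i ord0) < 0]].

End triangulation.

Section discrete_spaces.
Context (R : realType) (d : nat).
Local Notation n := d.+1.
Local Notation leb := (lebesgueV R n).
Context (Omega GammaD GammaN : set 'rV[R]_n) (M : mesh R n).
Local Notation E := 'I_(ne M).

(* Function on Omega with the given restrictions to the elements; the choice made
   where elements meet concerns a null set only. *)
Definition piecewise (A : Type) (a0 : A) (F : E -> 'rV[R]_n -> A) (x : 'rV[R]_n) : A :=
  if [pick k | `[< tri k x >]] is Some k then F k x else a0.

(* L^0(T_h), L^1(T_h) and L^1(T_h)^d, by the coefficients on each element:
   (b, c) stands for x |-> b . x + c, and (B, c) for x |-> x *m B + c. *)
Definition L0 := E -> R.
Definition L0V := E -> 'rV[R]_n.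
Definition L1 := E -> 'rV[R]_n * R.
Definition L1V := E -> 'M[R]_n * 'rV[R]_n.

Definition restr (v : L1) k x : R := dotv (v k).1 x + (v k).2.
Definition restrV (y : L1V) k x : 'rV[R]_n := x *m (y k).1 + (y k).2.

Definition pw0 (c : L0) : 'rV[R]_n -> R := piecewise 0 (fun k _ => c k).
Definition pw0V (c : L0V) : 'rV[R]_n -> 'rV[R]_n := piecewise 0 (fun k _ => c k).
Definition pw1 (v : L1) : 'rV[R]_n -> R := piecewise 0 (restr v).
Definition pw1V (y : L1V) : 'rV[R]_n -> 'rV[R]_n := piecewise 0 (restrV y).

Definition gradh (v : L1) : L0V := fun k => (v k).1.
Definition divh (y : L1V) : L0 := fun k => \tr (y k).1.

(* The L^2-projection onto L0. *)
Definition Pi0 (w : 'rV[R]_n -> R) : L0 :=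
  xget (fun=> 0) [set c : L0 | forall q : L0,
    (\int[leb]_(x in Omega) ((w x - pw0 c x) * pw0 q x)%:E = 0)%E].

Definition Pih (v : L1) : L0 := Pi0 (pw1 v).
Definition PihV (y : L1V) : L0V :=
  fun k => \row_i Pi0 (fun x => pw1V y x 0 i) k.

Definition S1D : set L1 :=
  [set v | {within closure Omega, continuous (pw1 v)} /\
           forall x, GammaD x -> pw1 v x = 0].

Definition CR : set L1 :=
  [set v | (forall (k l : E) i j, k != l ->
              simplex (side k i) = simplex (side l j) ->
              surface_integral (side k i)
                (fun x => (restr v k x - restr v l x)%:E) = 0%E) /\
           (forall (k : E) i, simplex (side k i) `<=` GammaD ->
              restr v k (barycenter (side k i)) = 0)].

Definition RT : set L1V :=
  [set y | [/\ forall (k : E) i x x',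
                 simplex (side k i) x -> simplex (side k i) x' ->
                 dotv (restrV y k x) (outer_normal k i) =
                 dotv (restrV y k x') (outer_normal k i),
               forall (k l : E) i j, k != l ->
                 simplex (side k i) = simplex (side l j) ->
                 forall x, simplex (side k i) x ->
                 dotv (restrV y k x) (outer_normal k i) +
                 dotv (restrV y l x) (outer_normal l j) = 0 &
               forall (k : E) i, simplex (side k i) `<=` boundary Omega ->
                 forall x, simplex (side k i) x -> GammaN x ->
                 dotv (restrV y k x) (outer_normal k i) = 0]].

End discrete_spaces.

Arguments S1D {R d} Omega GammaD M _.
Arguments CR {R d} GammaD M _.
Arguments RT {R d} Omega GammaN M _.

Section functionals_of_the_problem.
Context (R : realType) (d : nat).
Local Notation n := d.+1.
Local Notation leb := (lebesgueV R n).
Context (Omega : set 'rV[R]_n) (M : mesh R n).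
Context (phi : 'rV[R]_n -> \bar R) (f : L0 M).
Local Open Scope ereal_scope.

Definition primal (p : R) (v : 'rV[R]_n -> R) : \bar R :=
  \int[leb]_(x in Omega) phi (wgrad p Omega v x) -
  \int[leb]_(x in Omega) (pw0 f x * v x)%:E.

Definition psi (x : 'rV[R]_n) (t : R) : \bar R := (- pw0 f x * t)%:E.

Definition psi_conj (x : 'rV[R]_n) (s : R) : \bar R :=
  ereal_sup [set (s * t)%:E - psi x t | t in [set: R]].

Definition primal_cr (v : L1 M) : \bar R :=
  \int[leb]_(x in Omega) phi (pw0V (gradh v) x) -
  \int[leb]_(x in Omega) (pw0 f x * pw0 (Pih Omega v) x)%:E.

Definition dual_rt (y : L1V M) : \bar R :=
  - (\int[leb]_(x in Omega) fenchel phi (pw0V (PihV Omega y) x)) -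
  \int[leb]_(x in Omega) psi_conj x (pw0 (divh y) x).

(* eta_h^2(v, z) *)
Definition estimator (v : L1 M) (z : L1V M) : \bar R :=
  \int[leb]_(x in Omega)
    (phi (pw0V (gradh v) x) - (dotv (pw1V z x) (pw0V (gradh v) x))%:E +
     fenchel phi (pw1V z x)) +
  \int[leb]_(x in Omega)
    (psi x (pw1 v x) - (pw0 (divh z) x * pw1 v x)%:E +
     psi_conj x (pw0 (divh z) x)).

End functionals_of_the_problem.

(* Main.v *)
(* Fenchel's inequality gives
     I(u) >= - int phi^*(z)   for every z in RT^0_N with div z = - f_h,
   once int z . grad v + div z v = 0 is known for v in W^{1,p}_D; and z = z_h^rt
   satisfies this equilibrium because strong duality makes both discrete energies
   finite. As eta^2(v, z) = I(v) + int phi^*(z) for v in S^1_D, the estimate follows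
   from the co-coercivity of I. The second formula for eta^2 comes from the same
   integration by parts on S^{1,cr}_D x RT^0_N, which turns strong duality into
   int phi(grad_h u) + phi^*(Pi_h z) - Pi_h z . grad_h u = 0.

   The integration by parts for rough functions tests weak gradients against
   products chi_m of smoothed indicators of {bary_i > 1/m}: as m -> oo the integrals
   against grad chi_m tend to the surface integrals over the sides of the element.
   Over interior sides they cancel pairwise, since the normal components of z are
   opposite there, and on the rest of the boundary either z . n or the trace
   vanishes. *)
Require Import Defs.
From HB Require Import structures.
From mathcomp Require Import all_boot all_order all_algebra.
From mathcomp Require Import all_classical all_reals all_analysis.
From mathcomp Require Import measurable_realfun.
From mathcomp Require Import ring lra.
Set Implicit Arguments. Unset Strict Implicit. Unset Printing Implicit Defensive.
Import Order.TTheory GRing.Theory Num.Theory.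
Import numFieldNormedType.Exports.
Local Open Scope classical_set_scope.
Local Open Scope ring_scope.

(** * Lebesgue measure on R^n *)

Local Open Scope ereal_scope.

(** A weak gradient is accessible only through test functions, so an explicit family of them has to
    live inside each element. As [flat 0] rises from 0 to 1 and has derivative [flat 2], the
    gradient of a product of rescaled copies splits into one layer per side, with a profile of mass
    one across it. The limit needs functions continuous up to the sides, so a Sobolev function is
    replaced by the approximants that define its trace. They come last to the limit, where L^1
    convergence suffices because z and div z are bounded.

    The second obstacle is infinite values. Strong duality controls the conjugate on Pi_h z, while
    its integral along z itself may be +oo. Integrals are therefore added under integrable
    minorants, and the final comparison is made by cases in the extended reals. Along a Sobolev
    gradient, the minorant of [phi] is the affine function whose slope is a value of Pi_h z.

    The third is geometric: the open elements must lie in Omega and adjacent ones must have opposite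
    normals. Both follow from the Lipschitz boundary and from conformity, by moving points
    slightly. *)

Lemma lebesgue_measure_affine (R : realType) (a b : R) (A : set (measurableTypeR R)) :
  a != 0%R -> measurable A ->
  (`|a|)%:E * lebesgue_measure ((fun t : R => a * t + b)%R @^-1` A) = lebesgue_measure A.
Proof.
move=> a0 mA.
have mphi : measurable_fun setT ((fun t => a * t + b)%R : measurableTypeR R -> measurableTypeR R).
  by apply: measurable_funD => //; apply: measurable_funM.
have H : mscale (NngNum (normr_ge0 a)) (pushforward lebesgue_measure ((fun t => a * t + b)%R : measurableTypeR R -> measurableTypeR R)) A = lebesgue_measure A.
  (* Both sides are measures, so half-open intervals suffice. For a < 0 the preimage of []x, y]] is
     half-open at the other end, which does not change its length. *)
  move=> mphi0; apply/esym/lebesgue_measure_unique => //= _ [[x y]] _ <-.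
  transitivity ((`|a|)%:E * lebesgue_measure ((fun t : measurableTypeR R => a * t + b)%R @^-1` `]x, y])); last by [].
  have [a_gt0|a_lt0|a_eq0] := ltgtP a 0%R; last by rewrite a_eq0 eqxx in a0.
    have -> : (fun t : measurableTypeR R => (a * t + b)%R) @^-1` `]x, y] = `[((y - b) / a)%R, ((x - b) / a)%R[%classic.
      apply/seteqP; split => t /=; rewrite !in_itv/= ler_ndivrMr // ltr_ndivlMr // => /andP[h1 h2]; apply/andP; split; lra.
    rewrite !lebesgue_measure_itv/= !lte_fin ltr_nM2r ?invr_lt0// ltrD2r ltr0_norm//.
    case: ifPn => _; rewrite ?mule0// -!EFinB -EFinM; congr EFin; field; lra.
  have -> : (fun t : measurableTypeR R => (a * t + b)%R) @^-1` `]x, y] = `]((x - b) / a)%R, ((y - b) / a)%R]%classic.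
    apply/seteqP; split => t /=; rewrite !in_itv/= ltr_pdivrMr // ler_pdivlMr // => /andP[h1 h2]; apply/andP; split; lra.
  rewrite !lebesgue_measure_itv/= !lte_fin ltr_pM2r ?invr_gt0// ltrD2r gtr0_norm//.
  case: ifPn => _; rewrite ?mule0// -!EFinB -EFinM; congr EFin; field; lra.
exact: H.
Qed.

(** The factor c plays the part of a Jacobian. The instances are affine maps of the line, with c =
    |a|, and the identification of R x R^n with R^(n+1), with c = 1. *)
Lemma ge0_integral_image d1 d2 (T1 : measurableType d1) (T2 : measurableType d2)
  (R : realType) (m1 : {measure set T1 -> \bar R}) (m2 : {measure set T2 -> \bar R})
  (phi : T1 -> T2) (c : R) (f : T2 -> \bar R) :
  (0 <= c)%R -> measurable_fun setT phi ->
  (forall A, measurable A -> c%:E * m1 (phi @^-1` A) = m2 A) ->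
  measurable_fun setT f -> (forall x, 0 <= f x) ->
  c%:E * \int[m1]_x f (phi x) = \int[m2]_x f x.
Proof.
move=> c0 mphi m12 mf f0.
have -> : \int[m2]_x f x = \int[mscale (NngNum c0) (pushforward m1 phi)]_x f x.
by move=> mphi0; apply: eq_measure_integral => //= A mA _; rewrite -m12.
rewrite ge0_integral_mscale//; congr (_ * _).
by rewrite (ge0_integral_pushforward mphi).
Qed.
Lemma ge0_integral_affine (R : realType) (a b : R) (f : measurableTypeR R -> \bar R) :
  a != 0%R -> measurable_fun setT f -> (forall x, 0 <= f x) ->
  (`|a|)%:E * \int[lebesgue_measure]_t f (a * t + b)%R = \int[lebesgue_measure]_t f t.
Proof.
move=> a0 mf f0; apply: (ge0_integral_image (phi := fun t : measurableTypeR R => (a * t + b)%R : measurableTypeR R)) => //.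
by apply: measurable_funD => //; apply: measurable_funM.
by move=> A mA; exact: lebesgue_measure_affine.
Qed.
(** The case x = y = +oo is included: for c > 0 both sides are then -oo. Positive and negative parts
    can thus be recombined without integrability. *)
Lemma muleBr_ge0 (R : realDomainType) (c : R) (x y : \bar R) :
  (0 <= c)%R -> 0 <= x -> 0 <= y -> c%:E * (x - y) = c%:E * x - c%:E * y.
Proof.
rewrite le_eqVlt => /predU1P[<- _ _|c0]; first by rewrite !mul0e subee.
case: x => [x| |]//; case: y => [y| |]// _ _.
- by rewrite -EFinB -!EFinM -EFinB mulrBr.
- by rewrite /= !gt0_muleNy ?gt0_muley// lte_fin.
- by rewrite /= !gt0_muley// lte_fin.
- by rewrite /= !gt0_muley// ?gt0_muleNy// lte_fin.
Qed.

Lemma integral_image d1 d2 (T1 : measurableType d1) (T2 : measurableType d2)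
  (R : realType) (m1 : {measure set T1 -> \bar R}) (m2 : {measure set T2 -> \bar R})
  (phi : T1 -> T2) (c : R) (f : T2 -> \bar R) :
  (0 <= c)%R ->
  (forall g, measurable_fun setT g -> (forall x, 0 <= g x) ->
    c%:E * \int[m1]_x g (phi x) = \int[m2]_x g x) ->
  measurable_fun setT f ->
  c%:E * \int[m1]_x f (phi x) = \int[m2]_x f x.
Proof.
move=> c0 cov mf.
rewrite [in LHS]integralE [in RHS]integralE muleBr_ge0//; last 2 first.
- by apply: integral_ge0 => x _.
- by apply: integral_ge0 => x _.
rewrite -(cov f^\+)//; last exact: measurable_funepos.
rewrite -(cov f^\-)//; last exact: measurable_funeneg.
by congr (_ * _ - _ * _); apply: eq_integral => x _; rewrite ?funeposE ?funenegE.
Qed.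

(** * Affine changes of variables, measurability and null sets in R^n *)

Section lebesgueV_theory.
Context (R : realType).
Local Notation leb := (lebesgueV R).

Lemma measurable_mulmx n m (E : 'M[R]_(n, m)) :
  measurable_fun setT (fun x : 'rV[R]_n => x *m E)%R.
Proof.
apply: measurable_fun_rV => i.
under eq_fun do rewrite mxE.
apply: measurable_sum => j.
by apply: measurable_funM => //; exact: measurable_coord.
Qed.

Lemma measurable_addV n d (T : measurableType d) (f g : T -> 'rV[R]_n) :
  measurable_fun setT f -> measurable_fun setT g ->
  measurable_fun setT (fun x => f x + g x)%R.
Proof.
move=> mf mg; apply: measurable_fun_rV => i.
under eq_fun do rewrite mxE.
by apply: measurable_funD; apply: (measurableT_comp (measurable_coord i)).
Qed.

Lemma measurable_affineV n m (s : 'rV[R]_m) (E : 'M[R]_(n, m)) :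
  measurable_fun setT (fun x : 'rV[R]_n => s + x *m E)%R.
Proof. by apply: measurable_addV => //; exact: measurable_mulmx. Qed.

Lemma consVE n (p : measurableTypeR R * 'rV[R]_n) :
  consV p = row_mx (p.1%:M)%R p.2 :> 'rV_(1 + n)%N.
Proof.
apply/rowP => j; rewrite !mxE /=.
case: (unliftP ord0 j) => [k ->|->] /=; case: splitP => i ij.
- by case: i ij => -[].
- congr (p.2 _ _); apply/val_inj => /=.
  by move: ij => /= [].
- by rewrite !mxE !ord1 eqxx mulr1n.
- by move: ij => /=.
Qed.

Lemma integral_consV n (f : 'rV[R]_n.+1 -> \bar R) : measurable_fun setT f ->
  \int[leb n.+1]_x f x = \int[lebesgue_measure \x leb n]_p f (consV p).
Proof.
move=> mf; rewrite -[RHS]mul1e; apply/esym/integral_image => // g mg g0.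
apply: ge0_integral_image => //; first exact: measurable_consV.
by move=> A mA; rewrite mul1e.
Qed.

Lemma ge0_integral_consV n (f : 'rV[R]_n.+1 -> \bar R) :
  measurable_fun setT f -> (forall x, 0 <= f x) ->
  \int[leb n.+1]_x f x = \int[lebesgue_measure]_t \int[leb n]_x f (consV (t, x)).
Proof.
move=> mf f0; rewrite integral_consV// fubini_tonelli1//.
by apply: measurableT_comp => //; exact: measurable_consV.
Qed.

(** The translation s belongs to the property because slicing a linear map produces maps with a
    translation that varies with the slice. *)
Definition linear_cov n (E : 'M[R]_n) := forall s (f : 'rV[R]_n -> \bar R),
  measurable_fun setT f -> (forall x, 0 <= f x) ->
  (`|\det E|)%:E * \int[leb n]_x f (s + x *m E)%R = \int[leb n]_x f x.

Lemma linear_covM n (E F : 'M[R]_n) :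
  linear_cov E -> linear_cov F -> linear_cov (E *m F).
Proof.
move=> covE covF s f mf f0; rewrite -(covF s f mf f0) det_mulmx normrM.
rewrite EFinM [X in X * _]muleC -muleA; congr (_ * _).
rewrite -(covE 0%R (fun x => f (s + x *m F)%R))//.
  by congr (_ * _); apply: eq_integral => x _; rewrite add0r mulmxA.
by apply: measurableT_comp => //; exact: measurable_affineV.
Qed.

Lemma unconsVK n : cancel (@unconsV R n) (@consV R n).
Proof.
by move=> s; apply/rowP => j; rewrite mxE; case: unliftP => [i ->|->]//=; rewrite mxE.
Qed.

Lemma consVD n (p q : measurableTypeR R * 'rV[R]_n) :
  (consV p + consV q = consV ((p.1 + q.1, p.2 + q.2) : measurableTypeR R * 'rV[R]_n))%R.
Proof.
by apply/rowP => j; rewrite /consV !mxE; case: (unlift ord0 j) => //= i; rewrite mxE.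
Qed.

Lemma consV_mul_block n (t : R) (x : 'rV[R]_n) (a : R) (b : 'rV[R]_n)
    (c : 'cV[R]_n) (D : 'M[R]_n) :
  (consV ((t, x) : measurableTypeR R * 'rV[R]_n) *m (block_mx a%:M b c D : 'M[R]_n.+1) =
  consV ((a * t + (x *m c) 0 0, t *: b + x *m D) : measurableTypeR R * 'rV[R]_n) :> 'rV[R]_n.+1)%R.
Proof.
rewrite !consVE/= (@mul_row_block R 1 1 n 1 n) -scalar_mxM mul_scalar_mx raddfD/=.
by rewrite -mx11_scalar mulrC.
Qed.

(** For a fixed first coordinate t, the inner integral is a change of variables by D with a
    translation depending on t; the outer one is then a scaling of the line by a. *)
Lemma linear_cov_upper n (a : R) (b : 'rV[R]_n) (D : 'M[R]_n) :
  a != 0%R -> linear_cov D ->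
  linear_cov (block_mx a%:M b 0 D : 'M[R]_n.+1)%R.
Proof.
move=> a0 covD s f mf f0.
have mfc : measurable_fun setT (f \o @consV R n).
  by apply: measurableT_comp => //; exact: measurable_consV.
have -> : (\det (block_mx a%:M b 0 D : 'M[R]_n.+1) = a * \det D)%R.
  by rewrite (@det_ublock R 1 n) det_scalar1.
rewrite normrM ge0_integral_consV//; last first.
  by apply: measurableT_comp => //; exact: measurable_affineV.
rewrite (ge0_integral_consV mf f0).
have eqf t x : f (s + consV (t, x) *m (block_mx a%:M b 0 D : 'M[R]_n.+1))%R =
   f (consV (a * t + (unconsV s).1, ((unconsV s).2 + t *: b) + x *m D))%R.
  rewrite consV_mul_block mulmx0 mxE addr0 -{1}(unconsVK s) consVD/= addrA.
  by rewrite [X in consV (X, _)]addrC.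
have mF t : measurable_fun setT (fun x => f (consV (t, x))).
  by apply: (measurableT_comp mfc); exact: measurable_pair1.
pose F t := \int[leb n]_x f (consV (t, x)).
have mFF : measurable_fun setT F.
  apply: (@measurable_fun_fubini_tonelli_F _ _ _ _ _ (leb n) (f \o @consV R n)) => // p.
  exact: f0.
have F0 t : 0 <= F t by exact: integral_ge0.
rewrite EFinM -muleA.
rewrite -ge0_integralZl//; last 2 first.
- apply: (@measurable_fun_fubini_tonelli_F _ _ _ _ _ (leb n)
    ((fun x => f (s + x *m (block_mx a%:M b 0 D : 'M[R]_n.+1))%R) \o @consV R n)) => [|p].
    apply: measurableT_comp; last exact: measurable_consV.
    by apply: measurableT_comp => //; exact: measurable_affineV.
  exact: f0.
- by move=> t _; exact: integral_ge0.
under eq_integral => t _ do under eq_integral => x _ do rewrite eqf.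
under eq_integral => t _ do rewrite (covD _ (fun x => f (consV (a * t + (unconsV s).1, x))%R)) //.
exact: (ge0_integral_affine (unconsV s).1 a0 mFF F0).
Qed.

Lemma lebesgueV_translation n : linear_cov (1%:M : 'M[R]_n).
Proof.
elim: n => [|n IHn].
  move=> s f mf f0; rewrite det1 normr1 mul1e; apply: eq_integral => x _.
  by congr f; apply/rowP => -[].
by have := linear_cov_upper 0 (oner_neq0 R) IHn; rewrite -scalar_mx_block.
Qed.

(** A shear: once the order of integration is exchanged, the first coordinate is only translated, by
    an amount depending on the other ones. *)
Lemma linear_cov_lower n (c : 'cV[R]_n) :
  linear_cov (block_mx 1%:M 0 c 1%:M : 'M[R]_n.+1)%R.
Proof.
move=> s f mf f0.
have mfc : measurable_fun setT (f \o @consV R n).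
  by apply: measurableT_comp => //; exact: measurable_consV.
have -> : (\det (block_mx 1%:M 0 c 1%:M : 'M[R]_n.+1) = 1)%R.
  by rewrite (@det_lblock R 1 n) !det1 mulr1.
rewrite normr1 mul1e.
have eqf t x : f (s + consV (t, x) *m (block_mx 1%:M 0 c 1%:M : 'M[R]_n.+1))%R =
   f (consV (1 * t + ((unconsV s).1 + (x *m c) 0 0), (unconsV s).2 + x *m 1%:M))%R.
  rewrite consV_mul_block scaler0 add0r -{1}(unconsVK s) consVD/=.
  by rewrite addrCA.
pose g p := f (s + consV p *m (block_mx 1%:M 0 c 1%:M : 'M[R]_n.+1))%R.
have mg : measurable_fun setT g.
  apply: (@measurableT_comp _ _ _ _ _ _ (fun x => f (s + x *m (block_mx 1%:M 0 c 1%:M : 'M[R]_n.+1))%R)); last exact: measurable_consV.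
  by apply: measurableT_comp => //; exact: measurable_affineV.
rewrite ge0_integral_consV//; last first.
  by apply: measurableT_comp => //; exact: measurable_affineV.
rewrite (fubini_tonelli g)//; last by move=> x; exact: f0.
under eq_integral => x _ do under eq_integral => t _ do rewrite /g eqf.
under eq_integral => x _.
  have := @ge0_integral_affine R 1 ((unconsV s).1 + (x *m c) 0%R 0%R)%R
    (fun t => f (consV (t, (unconsV s).2 + x *m 1%:M)%R)) (oner_neq0 _).
  rewrite normr1 mul1e => ->//; last first.
    by apply: (measurableT_comp mfc); exact: measurable_pair2.
  over.
rewrite -(fubini_tonelli (fun p => f (consV (p.1, (unconsV s).2 + p.2 *m 1%:M)%R)))//; last first.
  apply: (measurableT_comp mfc); apply: measurable_fun_pair => //.
  by apply: (measurableT_comp (measurable_affineV _ _)).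
rewrite (ge0_integral_consV mf f0); apply: eq_integral => t _.
have := @lebesgueV_translation n (unconsV s).2 (fun x => f (consV (t, x))).
rewrite det1 normr1 mul1e; apply => //.
by apply: (measurableT_comp mfc); exact: measurable_pair1.
Qed.

(** Gaussian elimination by induction on the dimension: a nonzero pivot gives a factorization into a
    shear and a block triangular matrix, and a zero pivot is first repaired by adding another
    row. *)
Lemma linear_cov_unitmx n (E : 'M[R]_n) : E \in unitmx -> linear_cov E.
Proof.
elim: n E => [|n IHn] E uE.
  have -> : E = 1%:M by apply/matrixP => -[].
  exact: lebesgueV_translation.
have pivot (F : 'M[R]_(1 + n)) : F \in unitmx -> ulsubmx F 0%R 0%R != 0%R ->
    linear_cov (F : 'M[R]_n.+1).
  move=> uF a0; set a := ulsubmx F 0%R 0%R in a0.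
  (* Schur complement of the pivot; it inherits invertibility from F. *)
  pose S := (drsubmx F - a^-1 *: (dlsubmx F *m ursubmx F))%R.
  have eF : F = (block_mx 1%:M 0 (a^-1 *: dlsubmx F) 1%:M *m
      block_mx a%:M (ursubmx F) 0 S)%R.
    rewrite mulmx_block !mul1mx !mul0mx !addr0 -{1}(submxK F).
    rewrite mul_mx_scalar scalerA divff// scale1r -scalemxAl addrC subrK.
    by rewrite -mx11_scalar.
  have uS : S \in unitmx.
    move: uF; rewrite {1}eF unitmxE det_mulmx det_lblock det_ublock !det1 !mul1r.
    by rewrite unitrM => /andP[].
  rewrite eF; apply: (@linear_covM n.+1); first exact: linear_cov_lower.
  by apply: linear_cov_upper => //; exact: IHn.
have [E00|E00] := eqVneq (E 0%R 0%R) 0%R; last first.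
  apply: pivot => //; rewrite !mxE.
  by congr (E _ _ != _): E00; apply/val_inj.
have [i Ei] : exists i, E (lift 0%R i) 0%R != 0%R.
  apply/existsP; apply/contraT; rewrite negb_exists => /forallP E0.
  have : (E *m (delta_mx 0 0 : 'cV_n.+1) = 0)%R.
    apply/colP => k; rewrite -colE !mxE.
    by case: (unliftP 0%R k) => [j ->|->//]; apply/eqP; have := E0 j; rewrite negbK.
  move/(congr1 (mulmx (invmx E))); rewrite mulKmx// mulmx0 => /matrixP/(_ 0%R 0%R).
  by rewrite !mxE eqxx => /eqP; rewrite oner_eq0.
(* Left multiplication by [V c] adds c times the row of the nonzero entry to the first row. *)
pose V (c : R) : 'M[R]_(1 + n) := block_mx 1%:M (c *: delta_mx 0 i)%R 0%R 1%:M.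
have VV : (V (-1) *m V 1 = 1%:M)%R.
  rewrite /V mulmx_block !mul1mx !mulmx0 !mulmx1 !mul0mx !addr0 add0r.
  by rewrite -scalerDl subrr scale0r -scalar_mx_block.
have uV c : V c \in unitmx by rewrite unitmxE (@det_ublock R 1 n) !det1 mulr1 unitr1.
have -> : E = V (-1)%R *m (V 1%R *m E) by rewrite mulmxA VV mul1mx.
apply: (@linear_covM n.+1).
  by apply: linear_cov_upper; [exact: oner_neq0|exact: lebesgueV_translation].
apply: pivot; first by rewrite unitmx_mul uV.
rewrite -[in V _ *m _](@submxK _ 1 n 1 n E) /V (@mulmx_block _ 1 n 1 n 1 n) block_mxKul !mul1mx scale1r -rowE !mxE.
set x := E _ _; set y := E _ _.
have -> : x = 0%R by rewrite -E00 /x; congr (E _ _); apply/val_inj.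
have -> : y = E (lift 0%R i) 0%R by rewrite /y; congr (E _ _); apply/val_inj.
by rewrite add0r.
Qed.

Lemma integral_affineV n (E : 'M[R]_n) s (f : 'rV[R]_n -> \bar R) :
  E \in unitmx -> measurable_fun setT f ->
  (`|\det E|)%:E * \int[leb n]_x f (s + x *m E)%R = \int[leb n]_x f x.
Proof.
by move=> uE mf; apply: integral_image => // g mg g0; exact: linear_cov_unitmx.
Qed.

Definition box n (a b : 'rV[R]_n) : set 'rV[R]_n :=
  [set x | forall i, (a 0 i < x 0 i < b 0 i)%R].

Local Close Scope ereal_scope.
Local Open Scope ring_scope.

Lemma preimage_consV_box n (a b : 'rV[R]_n.+1) :
  @consV R n @^-1` box a b = `]a 0 0, b 0 0[ `*` box (unconsV a).2 (unconsV b).2.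
Proof.
apply/seteqP; split => [[t x] /= abx|[t x] [/=]].
  split; first by have := abx 0; rewrite mxE unlift_none in_itv.
  by move=> i; have := abx (lift 0 i); rewrite !mxE liftK.
rewrite in_itv/= => tab xab i; rewrite mxE; case: unliftP => [j ->|->]//=.
by have := xab j; rewrite !mxE.
Qed.

Lemma measurable_box n (a b : 'rV[R]_n) : measurable (box a b).
Proof.
have -> : box a b = \big[setI/setT]_(i < n) [set x : 'rV[R]_n | a 0 i < x 0 i < b 0 i].
  rewrite -bigcap_seq; apply/seteqP; split => [x abx i _|x abx i]; first exact: abx.
  by apply: abx; rewrite /= mem_index_enum.
apply: bigsetI_measurable => i _.
have -> : [set x : 'rV[R]_n | a 0 i < x 0 i < b 0 i] =
    (fun x : 'rV[R]_n => x 0 i) @^-1` `]a 0 i, b 0 i[.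
  by apply/seteqP; split => x /=; rewrite in_itv.
by rewrite -[X in measurable X]setTI; exact: measurable_coord.
Qed.

Lemma lebesgueV_box n (a b : 'rV[R]_n) : (forall i, a 0 i < b 0 i) ->
  leb n (box a b) = (\prod_i (b 0 i - a 0 i))%:E.
Proof.
elim: n a b => [|n IHn] a b ab.
  by rewrite big_ord0 /= diracE mem_set//= => -[].
have -> : leb n.+1 (box a b) = (lebesgue_measure \x leb n)%E (@consV R n @^-1` box a b) by [].
rewrite preimage_consV_box product_measure1E//; last exact: measurable_box.
rewrite -[X in (X * _)%E]/(@lebesgue_measure R (`]a 0 0, b 0 0[%classic : set R)).
rewrite lebesgue_measure_itv/= lte_fin ab IHn => [|i]; last by rewrite !mxE.
by rewrite big_ord_recl EFinM; congr (_ * _)%E; congr EFin; apply: eq_bigr => i _; rewrite !mxE.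
Qed.

Lemma ball_box n (x : 'rV[R]_n) (e : R) : 0 < e ->
  ball x e = box (x - const_mx e) (x + const_mx e).
Proof.
move=> e0; apply/seteqP; split => y /=.
  move=> [_ xy] i; rewrite !mxE -ltr_distlC; exact: xy.
by move=> xy; split => // i j; rewrite ord1; have := xy j; rewrite !mxE -ltr_distlC.
Qed.

(** Balls of the sup norm are boxes, so those with rational centre and radius 1/(m+1) that lie in U
    form a countable cover. All other codes contribute the empty set. *)
Lemma open_bigcup_box n (U : set 'rV[R]_n) : open U ->
  exists2 F : nat -> set 'rV[R]_n, U = \bigcup_k F k &
    forall k, F k = set0 \/ exists a b, F k = box a b.
Proof.
move=> oU.
pose B (q : 'rV[rat]_n) (m : nat) := ball (map_mx (ratr : rat -> R) q) m.+1%:R^-1.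
pose F k := if @unpickle ('rV[rat]_n * nat)%type k is Some (q, m)
  then [set x | B q m `<=` U /\ B q m x] else set0.
exists F.
  apply/seteqP; split => [x Ux|x [k _]]; last first.
    by rewrite /F; case: unpickle => // -[q m] [BU Bx]; exact: BU.
  have /nbhs_ballP[e /= e0 xeU] := open_nbhs_nbhs (conj oU Ux).
  have [m me] : exists m : nat, m.+1%:R^-1 < e / 2.
    have [m _ /(_ m (leqnn m))] := near_infty_natSinv_lt (PosNum (divr_gt0 e0 (ltr0Sn _ 1))).
    by move=> mh; exists m.
  have qx i : exists q : rat, `|x 0 i - ratr q| < m.+1%:R^-1.
    have m0 : 0 < m.+1%:R^-1 :> R by rewrite invr_gt0.
    move: m0; move: (m.+1%:R^-1) => c c0.
    have [|q] := @rat_in_itvoo R (x 0 i - c) (x 0 i + c); first by lra.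
    by rewrite in_itv/= -ltr_distlC => ?; exists q.
  pose q : 'rV[rat]_n := \row_i projT1 (cid (qx i)).
  have Bx : B q m x.
    split => [|i j]; first by rewrite invr_gt0.
    rewrite ord1 !mxE /ball/= distrC; exact: (projT2 (cid (qx j))).
  exists (pickle (q, m)) => //; rewrite /F pickleK; split => // y Bqy.
  apply: xeU; apply: (@ball_splitr _ _ (map_mx (ratr : rat -> R) q)).
    exact: le_ball (ltW me) _ Bx.
  exact: le_ball (ltW me) _ Bqy.
move=> k; rewrite /F; case: unpickle => [[q m]|]; last by left.
have [BU|nBU] := pselect (B q m `<=` U).
  right; rewrite (_ : [set _ | _] = B q m); last by apply/seteqP; split => x // [].
  by rewrite /B ball_box ?invr_gt0//; do 2 eexists.
by left; apply/seteqP; split => x // [].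
Qed.

Lemma open_measurable_rV n (U : set 'rV[R]_n) : open U -> measurable U.
Proof.
move=> /open_bigcup_box[F -> F_]; apply: bigcupT_measurable => k.
have [->//|[a [b ->]]] := F_ k; exact: measurable_box.
Qed.

Lemma open_continuous_measurable_rV n (U : set 'rV[R]_n) (f : 'rV[R]_n -> R) :
  open U -> (forall x, U x -> {for x, continuous f}) -> measurable_fun U f.
Proof.
move=> oU cf _; apply: (measurability _ (RGenOpens.measurableE R)) => //; last exact: open_measurable_rV.
move=> _ [_ [a [b ->]] <-]; apply: open_measurable_rV.
rewrite openE => x [Ux fx]; rewrite /interior; apply: filterI.
  by apply: open_nbhs_nbhs.
apply: (cf x Ux); apply: open_nbhs_nbhs; split => //; exact: interval_open.
Qed.

Lemma continuous_measurable_rV n (f : 'rV[R]_n -> R) :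
  continuous f -> measurable_fun setT f.
Proof. by move=> cf; apply: open_continuous_measurable_rV => [|x _]; [exact: openT|exact: cf]. Qed.

Lemma lower_semicontinuous_measurable_rV n (f : 'rV[R]_n -> \bar R) :
  lower_semicontinuous f -> measurable_fun setT f.
Proof.
move=> scif; apply: (measurability _ (ErealGenOInfty.measurableE R)) => //.
move=> /= _ [_ [a ->]] <-; rewrite setTI; apply: open_measurable_rV.
by rewrite preimage_itvoy; move/lower_semicontinuousP : scif; exact.
Qed.

Lemma closed_measurable_rV n (A : set 'rV[R]_n) : closed A -> measurable A.
Proof.
move=> cA; rewrite -(setCK A); apply: measurableC; apply: open_measurable_rV.
exact: closed_openC.
Qed.

Lemma lebesgueV_xsection n (A : set 'rV[R]_n.+1) : measurable A ->
  (leb n.+1 A = \int[lebesgue_measure]_t leb n [set x | A (consV (t, x))])%E.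
Proof.
move=> mA; rewrite -[LHS]/((lebesgue_measure \x leb n)%E (@consV R n @^-1` A)).
apply: eq_integral => t _ /=; congr (leb n _).
by apply/seteqP; split => x; rewrite /xsection/= inE.
Qed.

Lemma cvg_bigsum (T : Type) (F : set_system T) (FF : Filter F) (I : Type)
    (r : seq I) (f : I -> T -> R) (l : I -> R) :
  (forall i, f i x @[x --> F] --> l i) ->
  (\sum_(i <- r) f i x) @[x --> F] --> \sum_(i <- r) l i.
Proof.
move=> fl; elim: r => [|i r IHr].
  by rewrite big_nil; under eq_fun do rewrite big_nil; exact: cvg_cst.
by rewrite big_cons; under eq_fun do rewrite big_cons; exact: cvgD.
Qed.

Lemma continuous_dotv n (g : 'rV[R]_n) : continuous (dotv g).
Proof.
move=> x; apply: (@cvg_bigsum _ (nbhs x) _ _ _ (fun i (y : 'rV[R]_n) => g 0 i * y 0 i)) => i.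
by apply: cvgM; [exact: cvg_cst|exact: coord_continuous].
Qed.

(** Induction on the dimension by slices: either every slice is again a hyperplane, or only the
    first coefficient is nonzero and the set is a point of the line times a full space. *)
Lemma lebesgueV_hyperplane n (g : 'rV[R]_n) (c : R) : g != 0 ->
  leb n [set x | dotv g x = c] = 0.
Proof.
have mH m (h : 'rV[R]_m) (e : R) : measurable [set x | dotv h x = e].
  rewrite (_ : [set _ | _] = setT `&` dotv h @^-1` [set e]); last by rewrite setTI.
  by apply: continuous_measurable_rV => //; exact: continuous_dotv.
elim: n g c => [|n IHn] g c g0.
  by exfalso; move/eqP: g0; apply; apply/rowP => -[].
pose g' := (unconsV g).2.
have dotE t x : dotv g (consV (t, x)) = g 0 0 * t + dotv g' x.
  rewrite /dotv big_ord_recl mxE unlift_none; congr (_ + _); apply: eq_bigr => i _.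
  by rewrite !mxE liftK.
have [g'0|g'0] := eqVneq g' 0; last first.
  rewrite lebesgueV_xsection// integral0_eq// => t _.
  rewrite -[RHS](IHn g' (c - g 0 0 * t))//; congr (leb n _).
  by apply/seteqP; split => x/=; rewrite dotE => e; lra.
have g00 : g 0 0 != 0.
  apply: contra_neq g0 => g00; apply/rowP => i; rewrite mxE.
  by case: (unliftP 0 i) => [k ->|->//]; have /rowP/(_ k) := g'0; rewrite !mxE.
rewrite -[LHS]/((lebesgue_measure \x leb n)%E (@consV R n @^-1` [set x | dotv g x = c])).
rewrite (_ : _ @^-1` _ = [set c / g 0 0] `*` setT); last first.
  apply/seteqP; split => [[t x] /=|[t x] /= [-> _]]; rewrite dotE g'0.
    have -> : dotv 0 x = 0 by rewrite /dotv big1// => i _; rewrite mxE mul0r.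
    by rewrite addr0 => <-; split => //; rewrite mulrC mulKf.
  have -> : dotv 0 x = 0 by rewrite /dotv big1// => i _; rewrite mxE mul0r.
  by rewrite addr0 mulrC divfK.
rewrite product_measure1E//.
rewrite -[X in (X * _)%E]/(@lebesgue_measure R ([set c / g 0 0] : set R)).
by rewrite lebesgue_measure_set1 mul0e.
Qed.

Lemma ler_coord_norm n (x : 'rV[R]_n) i : `|x 0 i| <= `|x|.
Proof.
have -> : `|x| = mx_norm x by [].
by rewrite mx_normrE; exact: (le_bigmax _ (fun i => `|x i.1 i.2|) (0, i)).
Qed.

Lemma bounded_box n (A : set 'rV[R]_n) : bounded_set A ->
  exists2 r : R, 0 < r & A `<=` box (const_mx (- r)) (const_mx r).
Proof.
move=> [r [_ Ar]]; pose M := Num.max r 0 + 1.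
have rM : r < M by rewrite /M ltr_pwDr// le_max lexx.
have M0 : 0 < M by rewrite /M ltr_pwDr// le_max lexx orbT.
exists (M + 1); first by rewrite addr_gt0.
move=> x /(Ar _ rM) xM i; rewrite !mxE -ltr_norml.
apply: (@le_lt_trans _ _ M); last by rewrite ltrDl.
exact: le_trans (ler_coord_norm x i) xM.
Qed.

Lemma lebesgueV_bounded n (A : set 'rV[R]_n) : measurable A -> bounded_set A ->
  (leb n A < +oo)%E.
Proof.
move=> mA /bounded_box[r r0 Ar].
apply: (@le_lt_trans _ _ (leb n (box (const_mx (- r)) (const_mx r)))).
  by apply: le_measure => //; rewrite ?inE//; exact: measurable_box.
by rewrite lebesgueV_box ?ltry// => i; rewrite !mxE; lra.
Qed.

Lemma lebesgueV_open_gt0 n (U : set 'rV[R]_n) : open U -> U !=set0 ->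
  (0 < leb n U)%E.
Proof.
move=> oU [x Ux]; have /nbhs_ballP[e /= e0 xeU] := open_nbhs_nbhs (conj oU Ux).
apply: (@lt_le_trans _ _ (leb n (ball x e))).
  rewrite ball_box// lebesgueV_box => [|i]; last by rewrite !mxE; lra.
  by rewrite lte_fin; apply: prodr_gt0 => i _; rewrite !mxE; lra.
apply: le_measure => //; rewrite ?inE//; last exact: open_measurable_rV.
by apply: open_measurable_rV; exact: ball_open.
Qed.

End lebesgueV_theory.

Local Close Scope ereal_scope.

(** * Bump functions supported in polytopes *)

Section flat_functions.
Context (R : realType).
Implicit Types (t : R) (k : nat).

(* The family t^-k exp(-1/t), extended by 0 to t <= 0, is closed under
   differentiation up to linear combinations. *)
Definition flat k t : R := if 0 < t then t^-1 ^+ k * expR (- t^-1) else 0.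

Lemma flat_ge0 k t : 0 <= flat k t.
Proof.
rewrite /flat; case: ifPn => // t0.
by rewrite mulr_ge0 ?expR_ge0// exprn_ge0// invr_ge0 ltW.
Qed.

Lemma flat_npos k t : t <= 0 -> flat k t = 0.
Proof. by move=> t0; rewrite /flat ltNge t0. Qed.

Lemma flat0_le1 t : flat 0 t <= 1.
Proof.
rewrite /flat expr0 mul1r; case: ifPn => // t0.
by rewrite -[leRHS]expR0 ler_expR oppr_le0 invr_ge0 ltW.
Qed.

(** The factor |t| is gained from exp s >= s^(k+1)/(k+1)! at s = 1/t. It gives continuity of
    [flat k] at 0 and, applied to k+1, differentiability there. *)
Lemma flat_le k t : `|flat k t| <= (k.+1)`!%:R * `|t|.
Proof.
rewrite ger0_norm ?flat_ge0// /flat; case: ifPn => t0; last first.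
  by rewrite mulr_ge0.
have s0 : 0 < t^-1 by rewrite invr_gt0.
rewrite gtr0_norm// -[X in _ <= _ * X]invrK; set s := t^-1 in s0 *.
rewrite expRN ler_pdivlMr// mulrAC -exprSr ler_pdivrMr ?expR_gt0//.
have := expR_ge1Dxn k (ltW s0).
rewrite -ler_pdivrMl ?ltr0n ?fact_gt0// mulrC.
by apply: le_trans; rewrite lerDr.
Qed.

Lemma cvg_flat0 k : flat k t @[t --> 0] --> 0.
Proof.
apply/cvgrPdist_le => e e0; near=> x.
rewrite sub0r normrN (le_trans (flat_le _ _))// mulrC -ler_pdivlMr ?ltr0n ?fact_gt0//.
near: x; apply/nbhs_ballP; exists (e / (k.+1)`!%:R) => /=.
  by rewrite divr_gt0// ltr0n fact_gt0.
by move=> y; rewrite /ball/= sub0r normrN => /ltW.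
Unshelve. all: by end_near. Qed.

Lemma is_derive_flat k t :
  is_derive t 1 (flat k) (flat k.+2 t - k%:R * flat k.+1 t).
Proof.
have [t0|t0|->] := ltgtP t 0.
- rewrite !flat_npos ?(ltW t0)// mulr0 subr0.
  apply: (@near_eq_is_derive _ _ _ (cst 0)).
  near=> x; rewrite flat_npos//; near: x.
  by apply: filterS (lt_nbhsl t0) => x; exact: ltW.
- have t_n0 : t != 0 by rewrite gt_eqF.
  have dV : is_derive t 1 (fun x : R => x^-1) (- t ^- 2).
    by apply: is_derive_eq; [apply: is_deriveV|rewrite /GRing.scale/= mulr1].
  have dE : is_derive t 1 (expR \o (fun x : R => - x^-1)) (expR (- t^-1) * t ^- 2).
    apply: (@is_derive1_comp R expR _ t (expR (- t^-1)) (t ^- 2)).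
    by rewrite -(opprK (t ^- 2)); exact: is_deriveN dV.
  have dX := is_deriveX k dV.
  have dP := is_deriveM dX dE.
  apply: (@is_derive_eq _ _ _ _ _ _ _ _ (near_eq_is_derive _ dP)).
    near=> x; rewrite /flat ifT; last by near: x; exact: lt_nbhsr.
    by rewrite !fctE.
  rewrite !fctE /flat t0 !exprS; case: k {dX dP} => [|k].
    by rewrite /GRing.scale/=; field.
  by rewrite /GRing.scale/= !exprS; field.
- rewrite !flat_npos// mulr0 subr0.
  (* At 0 the difference quotient of [flat k] is [flat k.+1], which tends to 0. *)
  have cv : h^-1 *: (flat k (h *: 1 + 0) - flat k 0) @[h --> 0^'] --> 0.
    have cvf := @cvg_flat0 k.+1.
    have : flat k.+1 h @[h --> 0^'] --> 0 by apply: cvg_trans cvf; apply: cvg_app; exact: nbhs_dnbhs.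
    apply: cvg_trans; apply: near_eq_cvg; near=> h.
    rewrite addr0 /GRing.scale/= mulr1 (flat_npos _ (lexx 0)) subr0 /flat.
    by case: ifPn => h0; rewrite ?mulr0// exprS mulrA.
  apply: DeriveDef; first by apply/cvg_ex; exists 0.
  exact/cvg_lim.
Unshelve. all: by end_near. Qed.

Lemma continuous_flat k : continuous (flat k).
Proof.
move=> t; apply: differentiable_continuous; apply/derivable1_diffP.
exact: (@ex_derive _ _ _ _ _ _ _ (is_derive_flat k t)).
Qed.

Lemma cvg_flat0_pinfty : flat 0 t @[t --> +oo] --> (1 : R).
Proof.
have : expR (- t^-1) @[t --> +oo] --> expR (- (0 : R)).
  apply: continuous_cvg; first exact: continuous_expR.
  apply: (@cvgN _ R^o _ _ _ (fun t : R => t^-1)).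
  by apply/gtr0_cvgV0; [exact: nbhs_pinfty_gt|exact: cvg_id].
rewrite oppr0 expR0; apply: cvg_trans; apply: near_eq_cvg; near=> t.
by rewrite /flat expr0 mul1r ifT//; near: t; exact: nbhs_pinfty_gt.
Unshelve. all: by end_near. Qed.

(** [flat 2] is the derivative of [flat 0], which climbs from 0 to 1. It is thus a probability
    density, the profile of the boundary layers below. *)
Lemma integral_flat2 : (\int[@lebesgue_measure R]_t (flat 2 t)%:E = 1)%E.
Proof.
transitivity (\int[@lebesgue_measure R]_(t in `[0%R, +oo[) (flat 2 t)%:E)%E.
  rewrite [RHS]integral_mkcond; apply: eq_integral => t _.
  rewrite patchE; case: ifPn => //; rewrite notin_setE/= in_itv/= andbT => /negP.
  by rewrite -ltNge => /ltW/flat_npos ->.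
rewrite (@ge0_continuous_FTC2y R (flat 2) (flat 0) 0 1).
- by rewrite flat_npos// oppe0 adde0.
- by move=> x _; exact: flat_ge0.
- by apply: continuous_subspaceT => x; exact: continuous_flat.
- exact: cvg_flat0_pinfty.
- by move=> x _; exact: (@ex_derive _ _ _ _ _ _ _ (is_derive_flat 0 x)).
- by apply: cvg_at_right_filter; exact: continuous_flat.
- move=> x _; rewrite derive1E (@derive_val _ _ _ _ _ _ _ (is_derive_flat 0 x)).
  by rewrite mul0r subr0.
Qed.

End flat_functions.

(** * Smooth functions built from [flat], and the bumps of a polytope *)

Section smooth_functions.
Context (R : realType) (n : nat).
Implicit Types (g v x : 'rV[R]_n) (f h : 'rV[R]_n -> R).

Lemma dotvC x v : dotv x v = dotv v x.
Proof. by apply: eq_bigr => i _; rewrite mulrC. Qed.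

Lemma dotvDr g x v : dotv g (x + v) = dotv g x + dotv g v.
Proof. by rewrite -big_split; apply: eq_bigr => i _; rewrite mxE mulrDr. Qed.

Lemma dotvZr g (a : R) x : dotv g (a *: x) = a * dotv g x.
Proof. by rewrite big_distrr; apply: eq_bigr => i _; rewrite mxE mulrCA. Qed.

Lemma dotvZl g (a : R) x : dotv (a *: g) x = a * dotv g x.
Proof. by rewrite dotvC dotvZr dotvC. Qed.

Lemma dotvNr g x : dotv g (- x) = - dotv g x.
Proof. by rewrite -scaleN1r dotvZr mulN1r. Qed.

Lemma dotvBr g x v : dotv g (x - v) = dotv g x - dotv g v.
Proof. by rewrite dotvDr dotvNr. Qed.

Lemma dotv0r g : dotv g 0 = 0.
Proof. by rewrite -(scale0r (0 : 'rV[R]_n)) dotvZr mul0r. Qed.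

Lemma dotv_unit g i : dotv g (unit_vec R i) = g 0 i.
Proof.
rewrite /dotv (bigD1 i)//= big1 => [|j ji]; rewrite /unit_vec mxE eqxx/=.
  by rewrite eqxx mulr1 addr0.
by rewrite (negbTE ji) mulr0.
Qed.

Lemma is_derive_dotv g (c : R) x v :
  is_derive x v (fun y => dotv g y + c) (dotv g v).
Proof.
have cv : h^-1 *: ((dotv g (h *: v + x) + c) - (dotv g x + c)) @[h --> (0:R)^'] --> dotv g v.
  apply: (@cvg_trans _ (dotv g v @[h --> (0:R)^'])); last exact: cvg_cst.
  apply: near_eq_cvg; near=> h.
  have h0 : h != 0 by near: h; exact: nbhs_dnbhs_neq.
  by rewrite dotvDr dotvZr /GRing.scale/=; field.
apply: DeriveDef; first by apply/cvg_ex; exists (dotv g v).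
exact/cvg_lim.
Unshelve. all: by end_near. Qed.

Lemma differentiable_dotv g (c : R) x : differentiable (fun y => dotv g y + c) x.
Proof.
apply: differentiableD => //.
have lin : linear (dotv g : 'rV[R]_n -> R^o).
  by move=> a y z; rewrite dotvDr dotvZr.
pose L : {linear 'rV[R]_n -> R^o} := HB.pack (dotv g : 'rV[R]_n -> R^o) (GRing.isLinear.Build _ _ _ _ _ lin).
apply: (@linear_differentiable _ _ _ L); exact: continuous_dotv.
Qed.

(** A syntax closed under directional derivatives, all of whose members are differentiable.
    Smoothness, which concerns every iterated partial derivative, then follows by induction on the
    list of directions. *)
Inductive bump_algebra : ('rV[R]_n -> R) -> Prop :=
| BumpCst c : bump_algebra (cst c)
| BumpAff g c : bump_algebra (fun x => dotv g x + c)
| BumpFlat k g c : bump_algebra (fun x => flat k (dotv g x + c))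
| BumpAdd f h : bump_algebra f -> bump_algebra h -> bump_algebra (f \+ h)
| BumpMul f h : bump_algebra f -> bump_algebra h -> bump_algebra (f \* h).

Lemma is_derive_flat_dotv k g (c : R) x v :
  is_derive x v (fun y => flat k (dotv g y + c))
   (dotv g v * (flat k.+2 (dotv g x + c) - k%:R * flat k.+1 (dotv g x + c))) /\
  differentiable (fun y => flat k (dotv g y + c)) x.
Proof.
have da := differentiable_dotv g c x.
have idf := is_derive_flat k (dotv g x + c).
have df : differentiable (flat k) (dotv g x + c).
  by apply/derivable1_diffP; exact: (@ex_derive _ _ _ _ _ _ _ idf).
have dc : differentiable (flat k \o (fun y => dotv g y + c)) x by exact: differentiable_comp.
split => //; apply: DeriveDef; first exact: diff_derivable.
have e1 : 'd (fun y => dotv g y + c) x v = dotv g v.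
  by rewrite -deriveE// (@derive_val _ _ _ _ _ _ _ (is_derive_dotv g c x v)).
rewrite deriveE// diff_comp//= e1 diff1E//.
by rewrite derive1E (@derive_val _ _ _ _ _ _ _ idf).
Qed.

Lemma bump_differentiable f x : bump_algebra f -> differentiable f x.
Proof.
elim=> {f} [c|g c|k g c|f h _ df _ dh|f h _ df _ dh].
- exact: differentiable_cst.
- exact: differentiable_dotv.
- by have [] := is_derive_flat_dotv k g c x x.
- exact: differentiableD.
- exact: differentiableM.
Qed.

Lemma bump_derive f v : bump_algebra f -> bump_algebra (fun x => 'D_v f x).
Proof.
elim=> {f} [c|g c|k g c|f h bf df bh dh|f h bf df bh dh].
- under eq_fun do rewrite derive_cst; exact: BumpCst.
- have -> : (fun x => 'D_v (fun y => dotv g y + c) x) = cst (dotv g v).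
    by apply/funext => x; rewrite (@derive_val _ _ _ _ _ _ _ (is_derive_dotv g c x v)).
  exact: BumpCst.
- have -> : (fun x => 'D_v (fun y => flat k (dotv g y + c)) x) =
     cst (dotv g v) \* ((fun x => flat k.+2 (dotv g x + c)) \+
       (cst (- k%:R) \* (fun x => flat k.+1 (dotv g x + c)))).
    apply/funext => x; have [d _] := is_derive_flat_dotv k g c x v.
    by rewrite (@derive_val _ _ _ _ _ _ _ d)/= mulNr.
  apply: BumpMul; first exact: BumpCst.
  by apply: BumpAdd; [exact: BumpFlat|apply: BumpMul; [exact: BumpCst|exact: BumpFlat]].
- have -> : (fun x => 'D_v (f \+ h) x) = (fun x => 'D_v f x) \+ (fun x => 'D_v h x).
    by apply/funext => x; rewrite deriveD//; apply: diff_derivable; exact: bump_differentiable.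
  exact: BumpAdd.
- have -> : (fun x => 'D_v (f \* h) x) = f \* (fun x => 'D_v h x) \+ h \* (fun x => 'D_v f x).
    by apply/funext => x; rewrite deriveM//; apply: diff_derivable; exact: bump_differentiable.
  by apply: BumpAdd; apply: BumpMul.
Qed.

Lemma bump_smooth f : bump_algebra f -> smooth f.
Proof.
move=> bf s; have bs : bump_algebra (partials s f).
  by elim: s => [//|i s IHs] /=; exact: bump_derive.
split=> [x|x i].
  exact/differentiable_continuous/bump_differentiable.
exact/diff_derivable/bump_differentiable.
Qed.

Lemma bump_prod (I : Type) (r : seq I) (f : I -> 'rV[R]_n -> R) :
  (forall i, bump_algebra (f i)) ->
  bump_algebra (fun x => \prod_(i <- r) f i x).
Proof.
move=> bf; elim: r => [|i r IHr].
  by under eq_fun do rewrite big_nil; exact: BumpCst.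
under eq_fun do rewrite big_cons.
exact: (BumpMul (bf i) IHr).
Qed.

Lemma derive_bigprod (I : eqType) (r : seq I) (f : I -> 'rV[R]_n -> R) x v :
  uniq r -> (forall i y, differentiable (f i) y) ->
  'D_v (fun y => \prod_(i <- r) f i y) x =
  \sum_(i <- r) 'D_v (f i) x * \prod_(j <- r | j != i) f j x.
Proof.
move=> ur df; elim: r ur => [_|i r IHr /= /andP[ir ur]].
  by under eq_fun do rewrite big_nil; rewrite big_nil derive_cst.
have dfr y : differentiable (fun y => \prod_(i <- r) f i y) y.
  elim: {ir ur IHr} r => [|j r IHr].
    by under eq_fun do rewrite big_nil; exact: differentiable_cst.
  by under eq_fun do rewrite big_cons; exact: (differentiableM (df j y) IHr).
under eq_fun do rewrite big_cons.
rewrite (@deriveM _ _ (f i) (fun y => \prod_(j <- r) f j y)); [|exact: diff_derivable|exact: diff_derivable].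
rewrite big_cons big_cons eqxx /= addrC /GRing.scale/=; congr (_ + _).
  rewrite mulrC; congr (_ * _); rewrite [RHS]big_seq_cond [LHS]big_seq.
  apply: eq_bigl => j; have [jr|//] := boolP (j \in r).
  by rewrite (contraNneq _ ir)// => <-.
rewrite IHr// big_distrr/= big_seq [RHS]big_seq; apply: eq_bigr => j jr.
have ij : i != j by apply: contraNneq ir => ->.
by rewrite big_cons ij mulrCA.
Qed.

Section polytope_bump.
Context (I : finType) (g : I -> 'rV[R]_n) (c : I -> R).

Definition polytope : set 'rV[R]_n := [set x | forall i, 0 < dotv (g i) x + c i].

(** The shift by 1 makes the i-th factor vanish as soon as the i-th affine form is at most 1/(m+1),
    which keeps the support away from the faces; the scaling by m+1 lets the product tend to 1
    inside. *)
Definition bump (m : nat) (x : 'rV[R]_n) : R :=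
  \prod_i flat 0 (m.+1%:R * (dotv (g i) x + c i) - 1).

Lemma bumpE m : bump m =
  fun x => \prod_i flat 0 (dotv (m.+1%:R *: g i) x + (m.+1%:R * c i - 1)).
Proof.
apply/funext => x; apply: eq_bigr => i _; congr flat.
by rewrite dotvZl mulrDr addrA.
Qed.

Lemma bump_in_algebra m : bump_algebra (bump m).
Proof. by rewrite bumpE; apply: bump_prod => i; exact: BumpFlat. Qed.

Lemma bump_ge0 m x : 0 <= bump m x.
Proof. by apply: prodr_ge0 => i _; exact: flat_ge0. Qed.

End polytope_bump.
End smooth_functions.

Lemma cvg_bigprod (R : realType) (T : Type) (F : set_system T) (FF : Filter F) (I : Type)
    (r : seq I) (f : I -> T -> R) (l : I -> R) :
  (forall i, f i x @[x --> F] --> l i) ->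
  (\prod_(i <- r) f i x) @[x --> F] --> \prod_(i <- r) l i.
Proof.
move=> fl; elim: r => [|i r IHr].
  by rewrite big_nil; under eq_fun do rewrite big_nil; exact: cvg_cst.
by rewrite big_cons; under eq_fun do rewrite big_cons; exact: cvgM.
Qed.

Lemma cvg_flat0_scale (R : realType) (l c : R) : 0 < l ->
  flat 0 (m.+1%:R * l - c) @[m --> \oo] --> (1 : R).
Proof.
move=> l0; apply: (@cvg_comp _ _ _ (fun m : nat => m.+1%:R * l - c) (flat 0) _ (+oo)).
  apply/cvgryPge => A; near=> m.
  rewrite lerBrDr -ler_pdivrMr//; apply: (@le_trans _ _ m%:R); last by rewrite ler_nat.
  by near: m; exact: nbhs_infty_ger.
exact: cvg_flat0_pinfty.
Unshelve. all: by end_near. Qed.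

Section bump_estimates.
Context (R : realType) (n : nat).
Implicit Types (g v x : 'rV[R]_n) (f h : 'rV[R]_n -> R).
Section polytope_bump.
Context (I : finType) (g : I -> 'rV[R]_n) (c : I -> R).
Local Notation bump := (bump g c).
Local Notation polytope := (polytope g c).
Lemma bump_le1 m x : bump m x <= 1.
Proof. by apply: prodr_ile1 => i _; rewrite flat_ge0 flat0_le1. Qed.

Lemma bump_neq0 m x i : bump m x != 0 -> m.+1%:R^-1 < dotv (g i) x + c i.
Proof.
move=> /prodf_neq0/(_ i isT); apply: contraNlt => xi; apply/eqP/flat_npos.
by rewrite subr_le0 mulrC -ler_pdivlMr ?div1r.
Qed.

Lemma bump_polytope m x : ~ polytope x -> bump m x = 0.
Proof.
move=> nVx; apply/eqP; apply/negP => /negP b0; apply: nVx => i.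
exact: lt_trans (bump_neq0 i b0).
Qed.

(** The i-th summand contains (m+1) times [flat 2] of (m+1) l - 1, with l the i-th affine form: a
    density of mass one in the variable l, concentrating on l = 0. *)
Lemma derive_bump m v x : 'D_v (bump m) x =
  \sum_i m.+1%:R * dotv (g i) v * flat 2 (m.+1%:R * (dotv (g i) x + c i) - 1) *
    \prod_(j | j != i) flat 0 (m.+1%:R * (dotv (g j) x + c j) - 1).
Proof.
have aE i y : dotv (m.+1%:R *: g i) y + (m.+1%:R * c i - 1) = m.+1%:R * (dotv (g i) y + c i) - 1.
  by rewrite dotvZl mulrDr addrA.
rewrite bumpE derive_bigprod ?index_enum_uniq// => [|i y]; last first.
  by have [] := is_derive_flat_dotv 0 (m.+1%:R *: g i) (m.+1%:R * c i - 1) y v.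
apply: eq_bigr => i _.
have [d _] := is_derive_flat_dotv 0 (m.+1%:R *: g i) (m.+1%:R * c i - 1) x v.
rewrite (@derive_val _ _ _ _ _ _ _ d) mul0r subr0 aE dotvZl.
by congr (_ * _); apply: eq_bigr => j _; rewrite aE.
Qed.

Lemma cvg_bump x : polytope x -> bump m x @[m --> \oo] --> (1 : R).
Proof.
move=> Vx; have -> : 1 = \prod_(i : I) 1 :> R by rewrite big1.
by apply: cvg_bigprod => i; exact: cvg_flat0_scale.
Qed.

End polytope_bump.
End bump_estimates.

Lemma bounded_subset (R : realType) n (A B : set 'rV[R]_n) :
  A `<=` B -> bounded_set B -> bounded_set A.
Proof. by move=> AB [M [Mr BM]]; exists M; split => // y /BM By x /AB /By. Qed.

Section bump_test_functions.
Context (R : realType) (n : nat).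
Implicit Types (g v x : 'rV[R]_n) (f h : 'rV[R]_n -> R).
Section polytope_bump.
Context (I : finType) (g : I -> 'rV[R]_n) (c : I -> R).
Local Notation bump := (bump g c).
Local Notation polytope := (polytope g c).

Lemma bump_test_function (Omega : set 'rV[R]_n) (f : 'rV[R]_n -> R) m :
  bounded_set polytope -> polytope `<=` Omega -> bump_algebra f ->
  test_function Omega (f \* bump m).
Proof.
move=> bV VO bf; split.
  by apply: bump_smooth; apply: BumpMul => //; exact: bump_in_algebra.
(* The bounds 1/(m+1) are positive, so this closed set lies inside the open polytope. *)
pose K := \bigcap_(i in [set: I]) [set x | m.+1%:R^-1 <= dotv (g i) x + c i].
have KV : K `<=` polytope.
  by move=> x Kx i; have := Kx i Logic.I; apply: lt_le_trans; rewrite invr_gt0.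
exists K; split => //.
- apply: bounded_closed_compact; first exact: bounded_subset KV bV.
  apply: closed_bigI => i _.
  apply: (@closed_comp _ _ (fun x => dotv (g i) x + c i) [set y | m.+1%:R^-1 <= y]).
    by move=> x _; apply/differentiable_continuous/differentiable_dotv.
  exact: closed_ge.
- by move=> x /KV/VO.
- move=> x nKx /=; have [->|b0] := eqVneq (bump m x) 0; first by rewrite mulr0.
  by exfalso; apply: nKx => i _; apply: ltW; exact: bump_neq0.
Qed.

End polytope_bump.

End bump_test_functions.

(** * Integrals of real functions on R^n *)

Section real_integrals.
Context d (T : measurableType d) (R : realType) (mu : {measure set T -> \bar R}).
Context (D : set T) (mD : measurable D).

Lemma cvg_Rintegral (f_ : nat -> T -> R) (f g : T -> R) :
  (forall m, measurable_fun D (f_ m)) ->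
  (forall x, D x -> f_ m x @[m --> \oo] --> f x) ->
  mu.-integrable D (EFin \o g) ->
  (forall m x, D x -> `|f_ m x| <= g x) ->
  mu.-integrable D (EFin \o f) /\
  (\int[mu]_(x in D) f_ m x) @[m --> \oo] --> \int[mu]_(x in D) f x.
Proof.
move=> mf_ f_f ig f_g.
have mf : measurable_fun D f by exact: measurable_fun_cvg f_f.
have [] := @dominated_convergence _ _ _ mu D mD (fun m => EFin \o f_ m) (EFin \o f) (EFin \o g).
- by move=> m; exact/measurable_EFinP.
- exact/measurable_EFinP.
- by apply: aeW => x Dx; apply: cvg_EFin; [exact: nearW|exact: f_f].
- exact: ig.
- by apply: aeW => x m Dx; rewrite /= lee_fin f_g.
move=> intf _ cv; split => //; apply: fine_cvg.
by rewrite fineK//; exact: integrable_fin_num.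
Qed.

Lemma Rintegral_sum (I : Type) (r : seq I) (f : I -> T -> R) :
  (forall i, mu.-integrable D (EFin \o f i)) ->
  \int[mu]_(x in D) (\sum_(i <- r) f i x) = \sum_(i <- r) \int[mu]_(x in D) f i x.
Proof.
move=> fi; elim: r => [|i r IHr].
  rewrite big_nil; under eq_Rintegral do rewrite big_nil.
  by rewrite /Rintegral integral0.
rewrite big_cons; under eq_Rintegral do rewrite big_cons.
rewrite RintegralD ?IHr//.
rewrite (_ : EFin \o _ = fun x => (\sum_(i <- r) (f i x)%:E)%E); last first.
  by apply/funext => x /=; rewrite sumEFin.
by apply: (integrable_sum mD) => j _; exact: fi.
Qed.

Lemma integrable_bounded (f g : T -> R) : measurable_fun D f ->
  mu.-integrable D (EFin \o g) -> (forall x, D x -> `|f x| <= g x) ->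
  mu.-integrable D (EFin \o f).
Proof.
move=> mf ig fg; apply: le_integrable ig => //; first exact/measurable_EFinP.
move=> x Dx; rewrite /= lee_fin; exact: le_trans (fg _ Dx) (ler_norm _).
Qed.

Lemma integrable_mul_bounded (f h : T -> R) (C : R) :
  mu.-integrable D (EFin \o f) -> measurable_fun D h ->
  (forall x, D x -> `|h x| <= C) ->
  mu.-integrable D (EFin \o (fun x => f x * h x)).
Proof.
move=> intf mh hC; have mf : measurable_fun D f by exact/measurable_EFinP/measurable_int/intf.
apply: (@integrable_bounded _ (fun x => C * `|f x|)).
- exact: measurable_funM.
- by have := integrableZl mD C (integrable_norm intf).
- by move=> x Dx; rewrite normrM mulrC ler_wpM2r// hC.
Qed.

End real_integrals.

(** * Boxes, vanishing against test functions, and integrals of derivatives *)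

Section box_generation.
Context (R : realType) (n : nat).

(** The empty set is added because the covers of open sets by [open_bigcup_box] may use it. *)
Definition boxes : set (set 'rV[R]_n) := [set A | A = set0 \/ exists a b, A = box a b].

Lemma measurable_rVE : @measurable _ 'rV[R]_n = <<s boxes >>.
Proof.
apply/seteqP; split; last first.
  apply: smallest_sub; first exact: sigma_algebra_measurable.
  by move=> _ [->|[a [b ->]]]; [exact: measurable0|exact: measurable_box].
have openB (U : set 'rV[R]_n) : open U -> <<s boxes >> U.
  move=> /open_bigcup_box[F -> FB]; apply: sigma_algebra_bigcup => k.
  by apply: sub_sigma_algebra; exact: FB.
apply: smallest_sub; first exact: smallest_sigma_algebra.
rewrite -bigcup_seq => A [i _ [B mB <-]].
pose coordB := (fun x : 'rV[R]_n => x 0 i) : g_sigma_algebraType boxes -> R.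
suff : measurable_fun setT coordB by move=> /(_ measurableT B mB).
apply: (measurability _ (RGenOpens.measurableE R)) => //.
move=> _ [_ [a [b ->]] <-]; apply: openB; rewrite setTI.
apply: (@open_comp _ _ (fun x : 'rV[R]_n => x 0 i)); last exact: interval_open.
by move=> x _; exact: coord_continuous.
Qed.

Lemma boxes_setI : setI_closed boxes.
Proof.
move=> _ _ [->|[a [b ->]]] [->|[a' [b' ->]]]; rewrite ?set0I ?setI0; try by left.
right; exists (\row_i Num.max (a 0 i) (a' 0 i)), (\row_i Num.min (b 0 i) (b' 0 i)).
apply/seteqP; split => x /=.
  move=> [h h'] i; rewrite !mxE gt_max lt_min.
  by have /andP[-> ->] := h i; have /andP[-> ->] := h' i.
by move=> h; split => i; have := h i; rewrite !mxE gt_max lt_min => /andP[/andP[? ?] /andP[? ?]]; exact/andP.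
Qed.

End box_generation.

Lemma ler_norm_rV (R : realType) n (x : 'rV[R]_n) (M : R) :
  0 <= M -> (forall i, `|x 0 i| <= M) -> `|x| <= M.
Proof.
move=> M0 xM; have -> : `|x| = mx_norm x by [].
by rewrite mx_normrE; apply: bigmax_le => // -[i j] _ /=; rewrite ord1.
Qed.

Lemma box_bounded (R : realType) n (a b : 'rV[R]_n) : bounded_set (box a b).
Proof.
exists (`|a| + `|b|); split; first exact: num_real.
move=> M aM x abx; apply: ler_norm_rV.
  by apply: le_trans (ltW aM); rewrite addr_ge0.
move=> i; have := abx i; have := ler_coord_norm a i; have := ler_coord_norm b i.
rewrite !ler_norml => /andP[? ?] /andP[? ?] /andP[? ?].
by apply/andP; have := normr_ge0 a; have := normr_ge0 b; split; lra.
Qed.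

Section du_bois_reymond.
Context (R : realType) (n : nat).
Local Notation leb := (lebesgueV R n).

(* Test functions increasing to the indicator of a box show that the integral of
   g over every box inside Omega vanishes. *)
Lemma Rintegral_box_eq0 (Omega : set 'rV[R]_n) (g : 'rV[R]_n -> R) (a b : 'rV[R]_n) :
  open Omega -> leb.-integrable Omega (EFin \o g) ->
  (forall w, test_function Omega w -> \int[leb]_(x in Omega) (g x * w x) = 0) ->
  box a b `<=` Omega -> \int[leb]_(x in box a b) g x = 0.
Proof.
move=> oO ig g0 BO; have mO := open_measurable_rV oO.
have mg : measurable_fun Omega g by exact/measurable_EFinP/measurable_int/ig.
pose G (i : 'I_n + 'I_n) : 'rV[R]_n :=
  match i with inl i => unit_vec R i | inr i => - unit_vec R i end.
pose c (i : 'I_n + 'I_n) := match i with inl i => - a 0 i | inr i => b 0 i end.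
have BE : box a b = polytope G c.
  apply/seteqP; split => x /= xB.
    by case=> i /=; rewrite ?dotvNl dotvC ?dotvNr dotv_unit; have := xB i; lra.
  move=> i; have := xB (inl i); have := xB (inr i).
  by rewrite /= dotvC dotvNr ![dotv _ (unit_vec R i)]dotv_unit [dotv (unit_vec R i) _]dotvC dotv_unit; lra.
have bB := box_bounded a b.
have test m : test_function Omega (bump G c m).
  have -> : bump G c m = cst 1 \* bump G c m by apply/funext => x /=; rewrite mul1r.
  by apply: bump_test_function; [rewrite -BE|rewrite -BE|exact: BumpCst].
have mbump m : measurable_fun Omega (bump G c m).
  apply: (@measurable_funS _ _ _ _ setT) => //.
  apply: continuous_measurable_rV => x; apply/differentiable_continuous.
  by apply: bump_differentiable; exact: bump_in_algebra.
have cv x : Omega x -> g x * bump G c m x @[m --> \oo] --> (g \_ (box a b)) x.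
  move=> Ox; rewrite patchE; rewrite BE; case: ifPn; rewrite ?notin_setE ?inE => Bx.
    by rewrite -[X in _ --> X]mulr1; apply: cvgM; [exact: cvg_cst|exact: cvg_bump].
  apply: cvg_near_cst; apply: nearW => m.
  by rewrite bump_polytope ?mulr0.
have ing := integrable_norm ig.
have [| |_ cvI] := cvg_Rintegral mO _ cv ing.
- by move=> m; exact: measurable_funM.
- move=> m x _; rewrite normrM ler_piMr// ger0_norm ?bump_ge0//.
  exact: bump_le1.
have : (fun=> 0 : R) @ \oo --> \int[leb]_(x in Omega) (g \_ (box a b)) x.
  by apply: cvg_trans cvI; apply: near_eq_cvg; apply: nearW => m; rewrite g0.
move/(cvg_unique (@Rhausdorff R)) => /(_ _ (cvg_cst 0)) => e0.
by rewrite -(setIidr BO) Rintegral_mkcondr e0.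
Qed.

(** Integrals of g vanish on the boxes inside Omega and hence, by a Dynkin argument on each member
    of a countable cover by boxes, on the measurable subsets of that member. So g is zero almost
    everywhere on it. *)
Lemma ae_eq0_of_test_functions (Omega : set 'rV[R]_n) (g : 'rV[R]_n -> R) :
  open Omega -> leb.-integrable Omega (EFin \o g) ->
  (forall w, test_function Omega w -> \int[leb]_(x in Omega) (g x * w x) = 0) ->
  {ae leb, forall x, Omega x -> g x = 0}.
Proof.
move=> oO ig g0; have mO := open_measurable_rV oO.
have mg : measurable_fun Omega g by exact/measurable_EFinP/measurable_int/ig.
have [F OF FB] := open_bigcup_box oO.
have FO k : F k `<=` Omega by rewrite OF; exact: bigcup_sup.
have mF k : measurable (F k).
  by have [->|[a [b ->]]] := FB k; [exact: measurable0|exact: measurable_box].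
have igF k A : measurable A -> leb.-integrable (A `&` F k) (EFin \o g).
  move=> mA; apply: integrableS ig => //; first exact: measurableI.
  by apply: subset_trans (FO k); exact: subIsetr.
have AF0 k A : measurable A -> (\int[leb]_(x in A `&` F k) (g x)%:E = 0)%E.
  have box0 B : @boxes R n B -> (\int[leb]_(x in B `&` F k) (g x)%:E = 0)%E.
    move=> bB; have : @boxes R n (B `&` F k) by apply: boxes_setI => //; exact: FB.
    have BO : B `&` F k `<=` Omega by apply: subset_trans (FO k); exact: subIsetr.
    move=> [->|[a [b abE]]]; first by rewrite integral_set0.
    rewrite abE in BO *; rewrite -[RHS]/((0 : R)%:E) -(Rintegral_box_eq0 oO ig g0 BO) /Rintegral fineK//.
    rewrite -abE; apply: integrable_fin_num; first by rewrite abE; exact: measurable_box.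
    by rewrite abE; apply: integrableS ig => //; exact: measurable_box.
  move=> mA; apply: (@dynkin_induction _ _ (@boxes R n)
      (fun A => \int[leb]_(x in A `&` F k) (g x)%:E = 0)%E); last by rewrite -measurable_rVE.
  - exact: measurable_rVE.
  - exact: boxes_setI.
  - by rewrite setTI -[F k]setIid; apply: box0; exact: FB.
  - exact: box0.
  - move=> S mS S0.
    have : (\int[leb]_(x in F k) (g x)%:E = 0)%E by rewrite -[F k]setIid; apply: box0; exact: FB.
    rewrite -{1}(setTI (F k)) -(setUCr S) setIUl integral_setU_EFin//.
    + by rewrite S0 add0e.
    + exact: measurableI.
    + by apply: measurableI => //; exact: measurableC.
    + by rewrite -setIUl setUCr setTI; apply: measurable_funS mg.
    + by rewrite disj_set2E setIACA setICr set0I.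
  - move=> S mS tS S0; rewrite setI_bigcupl integral_bigcup//.
    + by rewrite eseries0// => j _ _; exact: S0.
    + exact: trivIset_setIr.
    + by move=> j; exact: measurableI.
    + by rewrite -setI_bigcupl; apply: igF; exact: bigcupT_measurable.
have aeF k : {ae leb, forall x, F k x -> g x = 0}.
  have : ae_eq leb (F k) (EFin \o g) (cst 0%E).
    apply: integral_ae_eq => //.
    - by rewrite -(setTI (F k)); exact: igF.
    - move=> E EF mE; rewrite integral0 -(setIidl EF); exact: AF0.
  by apply: filterS => x h Fx; have := h Fx => -[].
have : {ae leb, forall x k, F k x -> g x = 0} by exact/ae_foralln.
by apply: filterS => x h; rewrite OF => -[k _ Fx]; exact: h Fx.
Qed.

End du_bois_reymond.

Lemma compact_continuous_bounded (R : realType) (T : topologicalType) (K : set T) (f : T -> R) :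
  compact K -> {within K, continuous f} ->
  exists2 C : R, 0 < C & forall x, K x -> `|f x| <= C.
Proof.
move=> cK cf; have /compact_bounded[M [_ fM]] := continuous_compact cf cK.
exists (Num.max M 0 + 1); first by rewrite ltr_wpDl// le_max lexx orbT.
move=> x Kx; apply: fM; last by exists x.
by rewrite ltr_pwDr// le_max lexx.
Qed.

Lemma cvg_harmonic_dnbhs (R : realType) : (m.+1%:R^-1 : R) @[m --> \oo] --> (0 : R)^'.
Proof.
move=> P nP; have [N _ NP] := @cvg_harmonic R _ nP.
by exists N => // m Nm; apply: (NP m Nm); rewrite invr_eq0 pnatr_eq0.
Qed.

Lemma is_derive_line (R : realType) n (H : 'rV[R]_n -> R) (x v : 'rV[R]_n) (t : R) :
  derivable H (x + t *: v) v ->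
  is_derive t 1 (fun s : R => H (x + s *: v)) ('D_v H (x + t *: v)).
Proof.
move=> dH.
have e : (fun h : R => h^-1 *: (H (x + (h *: (1 : R) + t) *: v) - H (x + t *: v))) =
         (fun h : R => h^-1 *: (H (h *: v + (x + t *: v)) - H (x + t *: v))).
  apply/funext => h; congr (_ *: (H _ - _)).
  by rewrite scalerDl /GRing.scale/= mulr1 addrCA.
by apply: DeriveDef; rewrite /derivable /derive e.
Qed.

Section compact_support.
Context (R : realType) (n : nat).
Local Notation leb := (lebesgueV R n).

Lemma continuous_bounded_support (H : 'rV[R]_n -> R) (r : R) :
  continuous H -> (forall x, r < `|x| -> H x = 0) ->
  (exists2 C : R, 0 < C & forall x, `|H x| <= C * \1_(box (const_mx (- (r + 1))) (const_mx (r + 1))) x).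
Proof.
move=> cH H0; pose K := [set x : 'rV[R]_n | `|x| <= r].
have cK : compact K.
  apply: bounded_closed_compact.
    by exists r; split; [exact: num_real|move=> M rM x /le_trans; apply; exact: ltW].
  apply: (@closed_comp _ _ (fun x : 'rV[R]_n => `|x|) [set y | y <= r]).
    by move=> x _; exact: norm_continuous.
  exact: closed_le.
have [C C0 HC] := compact_continuous_bounded cK (continuous_subspaceT cH).
exists C => // x; have [rx|xr] := ltP r `|x|.
  by rewrite H0// normr0 mulr_ge0// ltW.
rewrite indicE mem_set ?mulr1; first exact: HC.
move=> i; rewrite !mxE -ltr_norml; apply: le_lt_trans (ler_coord_norm _ _) _.
by rewrite (le_lt_trans xr)// ltrDl.
Qed.

Lemma integrable_cst_box (C : R) (a b : 'rV[R]_n) :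
  leb.-integrable setT (EFin \o (fun x => C * \1_(box a b) x)).
Proof.
have := @integrableZl _ _ _ leb setT measurableT C (EFin \o \1_(box a b)); apply.
have iB : leb.-integrable (box a b) (EFin \o cst (1 : R)).
  apply: measurable_bounded_integrable => //; first exact: measurable_box.
    by apply: lebesgueV_bounded; [exact: measurable_box|exact: box_bounded].
  exact: bounded_cst.
have := (integrable_mkcond (EFin \o cst (1 : R)) (measurable_box a b)).1 iB.
apply: eq_integrable => // x _; rewrite patchE /= indicE.
by case: ifPn => //= _.
Qed.

Lemma integrable_compact_support (H : 'rV[R]_n -> R) (r : R) :
  continuous H -> (forall x, r < `|x| -> H x = 0) ->
  leb.-integrable setT (EFin \o H).
Proof.
move=> cH H0; have [C C0 HC] := continuous_bounded_support cH H0.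
apply: (@integrable_bounded _ _ _ _ _ measurableT _ _ _ (integrable_cst_box _ _ _)) => [|x _].
  exact: continuous_measurable_rV.
exact: HC.
Qed.

End compact_support.

Section integrable_real.
Context d (T : measurableType d) (R : realType) (mu : {measure set T -> \bar R}).
Context (D : set T) (mD : measurable D).
Implicit Types f g : T -> R.

Lemma integrable_realD f g : mu.-integrable D (EFin \o f) ->
  mu.-integrable D (EFin \o g) -> mu.-integrable D (EFin \o (fun x => f x + g x)).
Proof. by move=> fi gi; exact: (integrableD mD fi gi). Qed.

Lemma integrable_realB f g : mu.-integrable D (EFin \o f) ->
  mu.-integrable D (EFin \o g) -> mu.-integrable D (EFin \o (fun x => f x - g x)).
Proof. by move=> fi gi; exact: (integrableB mD fi gi). Qed.

Lemma integrable_realZ (k : R) f : mu.-integrable D (EFin \o f) ->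
  mu.-integrable D (EFin \o (fun x => k * f x)).
Proof. by move=> fi; exact: (integrableZl mD k fi). Qed.

Lemma integrable_realN f : mu.-integrable D (EFin \o f) ->
  mu.-integrable D (EFin \o (fun x => - f x)).
Proof. by move=> fi; exact: (integrableN fi). Qed.

Lemma integrable_real_sum (I : Type) (r : seq I) (f : I -> T -> R) :
  (forall i, mu.-integrable D (EFin \o f i)) ->
  mu.-integrable D (EFin \o (fun x => \sum_(i <- r) f i x)).
Proof.
move=> fi; rewrite (_ : EFin \o _ = fun x => (\sum_(i <- r) (f i x)%:E)%E); last first.
  by apply/funext => x /=; rewrite sumEFin.
by apply: (integrable_sum mD) => i _; exact: fi.
Qed.

End integrable_real.

Section integral_derive.
Context (R : realType) (n : nat).
Local Notation leb := (lebesgueV R n).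

(* The integral of the difference quotients vanishes by translation invariance. *)
Lemma Rintegral_derive_eq0 (H : 'rV[R]_n -> R) (v : 'rV[R]_n) (r : R) :
  (forall x, derivable H x v) -> continuous H -> continuous (fun x => 'D_v H x) ->
  (forall x, r < `|x| -> H x = 0) ->
  \int[leb]_x 'D_v H x = 0.
Proof.
move=> dH cH cD H0.
have D0 x : r < `|x| -> 'D_v H x = 0.
  move=> rx; suff d0 : is_derive x v H 0 by rewrite derive_val.
  apply: (@near_eq_is_derive _ _ _ (cst 0)); near=> y; rewrite H0//.
  near: y; exact: (@norm_continuous _ _ x _ (lt_nbhsr rx)).
have [C C0 DC] := continuous_bounded_support cD D0.
pose q (m : nat) x := m.+1%:R * (H (x + m.+1%:R^-1 *: v) - H x).
have m1 (m : nat) : 0 <= (m.+1%:R^-1 : R) <= 1.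
  by rewrite invr_ge0 ler0n/= invf_le1 ?ler1n.
(* Domination uniform in m: the steps are at most 1, so the supports stay in a ball of radius r +
   |v|, and the mean value theorem bounds the quotients by a bound of the derivative. *)
have qC m x : `|q m x| <= C * \1_(box (const_mx (- (r + `|v| + 1))) (const_mx (r + `|v| + 1))) x.
  have /andP[h0 h1] := m1 m.
  have [rx|xr] := ltP (r + `|v|) `|x|.
    have rx' : r < `|x| by apply: le_lt_trans rx; rewrite lerDl.
    have rx2 : r < `|x + m.+1%:R^-1 *: v|.
      rewrite -ltrBrDr in rx; apply: (lt_le_trans rx).
      rewrite lerBlDr; have := ler_normB (x + m.+1%:R^-1 *: v) (m.+1%:R^-1 *: v).
      rewrite addrK => /le_trans; apply; rewrite lerD2l normrZ ger0_norm//.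
      by rewrite ler_piMl.
    by rewrite /q !H0// subrr mulr0 normr0 mulr_ge0// ltW.
  rewrite indicE mem_set ?mulr1; last first.
    move=> i; rewrite !mxE -ltr_norml; apply: le_lt_trans (ler_coord_norm _ _) _.
    by rewrite (le_lt_trans xr)// ltrDl.
  have [|||c _] := @MVT_segment R (fun s => H (x + s *: v)) (fun s => 'D_v H (x + s *: v)) 0 m.+1%:R^-1.
  - exact: h0.
  - by move=> s _; exact: is_derive_line.
  - apply: continuous_subspaceT => s; apply: differentiable_continuous.
    apply/derivable1_diffP; exact: (@ex_derive _ _ _ _ _ _ _ (is_derive_line (dH _))).
  rewrite scale0r addr0 subr0 => e; rewrite /q e mulrCA divff ?mulr1 ?pnatr_eq0//.
  by apply: le_trans (DC _) _; rewrite ler_piMr ?(ltW C0)// indicE; case: (_ \in _).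
have iH := integrable_compact_support cH H0.
have mH : measurable_fun setT H by exact: continuous_measurable_rV.
have mS (c : 'rV[R]_n) : measurable_fun setT (fun x : 'rV[R]_n => H (x + c)).
  apply: (measurableT_comp mH).
  exact: measurable_addV.
have eT (c : 'rV[R]_n) : (\int[leb]_x (H (x + c))%:E = \int[leb]_x (H x)%:E)%E.
  rewrite -(@integral_affineV _ _ 1%:M c (EFin \o H)) ?unitmx1//; last first.
    exact/measurable_EFinP.
  rewrite det1 normr1 mul1e; apply: eq_integral => x _ /=.
  by rewrite mulmx1 addrC.
have iT (c : 'rV[R]_n) : leb.-integrable setT (EFin \o (fun x : 'rV[R]_n => H (x + c))).
  apply/integrableP; split; first exact/measurable_EFinP.
  have /integrableP[_] := iH; apply: le_lt_trans.
  rewrite -(@integral_affineV _ _ 1%:M c (abse \o (EFin \o H))) ?unitmx1//; last first.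
    by apply: measurableT_comp => //; exact/measurable_EFinP.
  rewrite det1 normr1 mul1e le_eqVlt; apply/orP; left; apply/eqP; apply: eq_integral => x _ /=.
  by rewrite mulmx1 addrC.
have q0 m : \int[leb]_x q m x = 0.
  rewrite /q RintegralZl//; last exact: (integrableB measurableT (iT _) iH).
  by rewrite RintegralB// /Rintegral eT subrr mulr0.
have cvq x : setT x -> q m x @[m --> \oo] --> 'D_v H x.
  move=> _; have := dH x; rewrite /derivable => dHx.
  have := @cvg_comp _ _ _ _ (fun h : R => h^-1 *: (H (h *: v + x) - H x)) _ _ _ (@cvg_harmonic_dnbhs R) dHx.
  apply: cvg_trans; apply: near_eq_cvg; apply: nearW => m /=.
  by rewrite /q invrK [X in H X]addrC.
have mq m : measurable_fun setT (q m).
  apply: measurable_funM => //; apply: measurable_funB => //.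
have [_ cvI] := cvg_Rintegral measurableT mq cvq (integrable_cst_box _ _ _) (fun m x _ => qC m x).
have : (fun=> 0 : R) @ \oo --> \int[leb]_x 'D_v H x.
  by apply: cvg_trans cvI; apply: near_eq_cvg; apply: nearW => m; rewrite q0.
by move/(cvg_unique (@Rhausdorff R)) => /(_ _ (cvg_cst 0)).
Unshelve. all: by end_near. Qed.

End integral_derive.

(** * Barycentric coordinates and Green's formula on a simplex *)

Section barycentric.
Context (R : realType) (n : nat).
Implicit Types (a : 'I_n.+1 -> 'rV[R]_n) (x v : 'rV[R]_n).

Lemma dotv_sumr (I : Type) (r : seq I) (g : 'rV[R]_n) (F : I -> 'rV[R]_n) :
  dotv g (\sum_(i <- r) F i) = \sum_(i <- r) dotv g (F i).
Proof.
elim: r => [|i r IHr]; first by rewrite !big_nil dotv0r.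
by rewrite !big_cons dotvDr IHr.
Qed.

Lemma row_mulmxE m (xi : 'rV[R]_m) (A : 'M[R]_(m, n)) :
  xi *m A = \sum_i xi 0 i *: row i A.
Proof.
apply/rowP => j; rewrite mxE summxE; apply: eq_bigr => i _.
by rewrite !mxE.
Qed.

Lemma mulmx_edges m (b : 'I_m.+1 -> 'rV[R]_n) (xi : 'rV[R]_m) :
  xi *m edges b = \sum_i xi 0 i *: (b (lift ord0 i) - b ord0).
Proof.
rewrite row_mulmxE; apply: eq_bigr => i _; congr (_ *: _).
by apply/rowP => j; rewrite !mxE.
Qed.

(* The rows of [vertex_mx a] are the points (1, a_i), so that the barycentric
   coordinates of x are the entries of (1, x) times its inverse. *)
Definition vertex_mx a : 'M[R]_(1 + n) := \matrix_(i < n.+1) (row_mx 1%:M (a i)).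

Definition bgrad a (i : 'I_n.+1) : 'rV[R]_n :=
  \row_j invmx (vertex_mx a) (rshift 1 j) i.

Definition bcst a (i : 'I_n.+1) : R := invmx (vertex_mx a) (lshift n 0) i.

Definition bary a x i : R := dotv (bgrad a i) x + bcst a i.

(** A row in the left kernel is an affine dependence of the vertices: weights of sum 0 with zero
    combination. Eliminating the weight of the first vertex leaves a kernel vector of [edges a]. *)
Lemma vertex_mx_unit a : affinely_independent a -> vertex_mx a \in unitmx.
Proof.
move=> /row_freeP[B eB].
rewrite -row_free_unit -kermx_eq0; apply/rowV0P => u /sub_kermxP uV.
have u1 : \sum_i u 0 i = 0.
  have /rowP/(_ (lshift n 0)) := uV; rewrite !mxE => e.
  rewrite -[RHS]e; apply: eq_bigr => i _.
  by rewrite !mxE; case: splitP => // j; rewrite !ord1 mxE eqxx mulr1.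
have ua : \sum_i u 0 i *: a i = 0.
  apply/rowP => j; have /rowP/(_ (rshift 1 j)) := uV; rewrite !mxE => e.
  rewrite -[RHS]e summxE; apply: eq_bigr => i _; rewrite !mxE.
  case: splitP => [k jk|k jk]; first by have := ltn_ord k; rewrite -jk.
  by congr (_ * a i _ _); apply/val_inj; move: jk => /= [].
pose u' : 'rV[R]_n := \row_i u 0 (lift ord0 i).
have u'0 : u' *m edges a = 0.
  rewrite mulmx_edges; under eq_bigr do rewrite mxE scalerBr.
  rewrite sumrB -scaler_suml.
  move: u1 ua; rewrite !big_ord_recl => /eqP; rewrite addrC addr_eq0 => /eqP -> /eqP.
  by rewrite addrC addr_eq0 => /eqP ->; rewrite scaleNr opprK addrC subrr.
have u'00 : u' = 0 by rewrite -[u']mulmx1 -eB mulmxA u'0 mul0mx.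
have uS i : u 0 (lift ord0 i) = 0 by have /rowP/(_ i) := u'00; rewrite !mxE.
apply/rowP => i; rewrite mxE; case: (unliftP ord0 i) => [j ->|->]; first exact: uS.
by move: u1; rewrite big_ord_recl big1 ?addr0// => j _; exact: uS.
Qed.

Section affinely_independent_vertices.
Context (a : 'I_n.+1 -> 'rV[R]_n) (fa : affinely_independent a).

Lemma baryE x i : bary a x i = (row_mx 1%:M x *m invmx (vertex_mx a)) 0 i.
Proof.
rewrite /bary !mxE (@big_split_ord _ _ _ 1 n) big_ord1 addrC row_mxEl !mxE eqxx mul1r.
congr (_ + _); apply: eq_bigr => j _; rewrite row_mxEr mulrC; congr (_ * _).
by rewrite mxE.
Qed.

Lemma bary_mul x : (\row_i bary a x i) *m vertex_mx a = row_mx 1%:M x.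
Proof.
have -> : \row_i bary a x i = row_mx 1%:M x *m invmx (vertex_mx a).
  by apply/rowP => i; rewrite mxE baryE.
by rewrite mulmxKV// vertex_mx_unit.
Qed.

Lemma bary_sum1 x : \sum_i bary a x i = 1.
Proof.
have /rowP/(_ (lshift n 0)) := bary_mul x; rewrite row_mxEl !mxE eqxx mulr1n => e.
rewrite -[RHS]e; apply: eq_bigr => i _; rewrite !mxE; case: splitP => // j.
by rewrite !ord1 mxE eqxx mulr1.
Qed.

Lemma bary_comb x : x = \sum_i bary a x i *: a i.
Proof.
apply/rowP => j; have /rowP/(_ (rshift 1 j)) := bary_mul x; rewrite row_mxEr => <-.
rewrite mxE summxE; apply: eq_bigr => i _; rewrite !mxE.
case: splitP => [k jk|k jk]; first by have := ltn_ord k; rewrite -jk.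
by congr (_ * a i _ _); apply/val_inj; move: jk => /= [].
Qed.

Lemma bary_vertex i j : bary a (a j) i = (i == j)%:R.
Proof.
rewrite baryE (_ : row_mx _ _ = row j (vertex_mx a)); last by rewrite rowK.
by rewrite -row_mul mulmxV ?vertex_mx_unit// !mxE eq_sym.
Qed.

Lemma baryD x v i : bary a (x + v) i = bary a x i + dotv (bgrad a i) v.
Proof. by rewrite /bary dotvDr addrAC. Qed.

Lemma dotv_bgradB x y i : dotv (bgrad a i) (x - y) = bary a x i - bary a y i.
Proof. by rewrite dotvBr /bary; lra. Qed.

Lemma bary_unique (t : 'I_n.+1 -> R) i : \sum_j t j = 1 ->
  bary a (\sum_j t j *: a j) i = t i.
Proof.
move=> t1; rewrite /bary dotv_sumr -[bcst a i]mul1r -t1 big_distrl/= -big_split/=.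
rewrite (bigD1 i)//= big1 => [|j ji].
  rewrite dotvZr -mulrDr -[_ + bcst _ _]/(bary a (a i) i) bary_vertex eqxx.
  by rewrite mulr1 addr0.
by rewrite dotvZr -mulrDr -[_ + bcst _ _]/(bary a (a j) i) bary_vertex eq_sym (negbTE ji) mulr0.
Qed.

Lemma faceP (P : set 'I_n.+1) x : face a P x <->
  (forall i, 0 <= bary a x i) /\ (forall i, ~ P i -> bary a x i = 0).
Proof.
split => [[t [t0 tP t1 ->]]|[x0 xP]].
  by split => i; rewrite bary_unique//; exact: tP.
by exists (bary a x); split => //; [exact: bary_sum1|exact: bary_comb].
Qed.

Lemma simplexP x : simplex a x <-> forall i, 0 <= bary a x i.
Proof. by rewrite /simplex faceP; split => [[]//|x0]; split => // i /(_ I). Qed.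

End affinely_independent_vertices.
End barycentric.

(** * Affine charts adapted to a side *)

Section side_frame.
Context (R : realType) (d : nat).
Local Notation n := d.+1.
Context (a : 'I_n.+1 -> 'rV[R]_n) (fa : affinely_independent a).
Implicit Types (i : 'I_n.+1) (x v : 'rV[R]_n).

(** Coincides by conversion with [side k i] when a is [elt k]; several later steps pass silently
    from one to the other. *)
Definition opp_side i : 'I_n -> 'rV[R]_n := fun j => a (lift i j).

Definition side_point i (xi : 'rV[R]_d) : 'rV[R]_n :=
  opp_side i ord0 + xi *m edges (opp_side i).

(** Linear part of the chart (t, xi) in which t is the i-th barycentric coordinate and xi
    parametrizes the side. *)
Definition side_frame i : 'M[R]_n :=
  (col_mx (a i - opp_side i ord0) (edges (opp_side i)) : 'M[R]_(1 + d, n)).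

Lemma bary_side_point i xi :
  [/\ bary a (side_point i xi) i = 0,
      forall j, bary a (side_point i xi) (lift i (lift ord0 j)) = xi 0 j &
      bary a (side_point i xi) (lift i ord0) = 1 - \sum_j xi 0 j].
Proof.
rewrite /side_point mulmx_edges; split => [|j|]; rewrite baryD dotv_sumr.
- rewrite /opp_side bary_vertex// (negbTE (neq_lift _ _)) add0r big1// => j _.
  by rewrite dotvZr dotv_bgradB !bary_vertex// !(negbTE (neq_lift _ _)) subrr mulr0.
- rewrite /opp_side bary_vertex// (inj_eq lift_inj) add0r (bigD1 j)//= big1 => [|k kj].
    rewrite dotvZr dotv_bgradB !bary_vertex// !(inj_eq lift_inj) eqxx /=.
    by rewrite subr0 mulr1 addr0.
  rewrite dotvZr dotv_bgradB !bary_vertex// !(inj_eq lift_inj) eq_sym (negbTE kj).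
  by rewrite subrr mulr0.
- rewrite /opp_side bary_vertex// eqxx -sumrN; congr (_ + _); apply: eq_bigr => j _.
  rewrite dotvZr dotv_bgradB !bary_vertex// !(inj_eq lift_inj) eqxx/=.
  by rewrite sub0r mulrN1.
Qed.

Lemma row_lift_side_frame i j : row (lift ord0 j) (side_frame i) = opp_side i (lift ord0 j) - opp_side i ord0.
Proof.
rewrite [X in row X _](_ : _ = rshift 1 j); last by apply/val_inj.
by apply/rowP => k; rewrite mxE (@col_mxEd _ 1 d) !mxE.
Qed.

Lemma row0_side_frame i : row ord0 (side_frame i) = a i - opp_side i ord0.
Proof.
rewrite [X in row X _](_ : _ = lshift d 0 :> 'I_(1 + d)); last by apply/val_inj.
by apply/rowP => k; rewrite mxE (@col_mxEu _ 1 d).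
Qed.

Lemma side_frame_unit i : side_frame i \in unitmx.
Proof.
(* The inverse is explicit: the gradients of the barycentric coordinates of all vertices except the
   base point [lift i ord0] form the dual basis of the frame. *)
pose k (j : 'I_n) := if unlift ord0 j is Some j' then lift i (lift ord0 j') else i.
pose G : 'M[R]_n := \matrix_(l, j) bgrad a (k j) 0 l.
suff /mulmx1_unit[] : side_frame i *m G = 1%:M by [].
have dotG v j : (v *m G) 0 j = dotv (bgrad a (k j)) v.
  by rewrite mxE; apply: eq_bigr => l _; rewrite mxE mulrC.
apply/row_matrixP => l; apply/rowP => j; rewrite row_mul dotG !mxE.
case: (unliftP ord0 l) => [l' ->|->].
  rewrite row_lift_side_frame dotv_bgradB !bary_vertex// /k.
  case: (unliftP ord0 j) => [j' ->|->].
    by rewrite !(inj_eq lift_inj) subr0 eq_sym.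
  by rewrite !(negbTE (neq_lift _ _)) subrr eq_sym.
rewrite row0_side_frame dotv_bgradB !bary_vertex// /k.
case: (unliftP ord0 j) => [j' ->|->].
  by rewrite (inj_eq lift_inj) eq_sym (negbTE (neq_lift _ _)) subr0.
by rewrite (negbTE (neq_lift _ _)) subr0 eqxx.
Qed.

Lemma side_frame_mulE i (t : R) (xi : 'rV[R]_d) :
  opp_side i ord0 + consV ((t, xi) : measurableTypeR R * 'rV[R]_d) *m side_frame i =
  side_point i xi + t *: (a i - opp_side i ord0).
Proof.
rewrite consVE /side_frame (@mul_row_col _ _ 1 d n) /= mul_scalar_mx /side_point.
by rewrite -addrA [_ *: _ + _]addrC.
Qed.

Lemma bary_frame i (t : R) (xi : 'rV[R]_d) :
  let x := side_point i xi + t *: (a i - opp_side i ord0) in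
  [/\ bary a x i = t,
      forall j, bary a x (lift i (lift ord0 j)) = xi 0 j &
      bary a x (lift i ord0) = 1 - \sum_j xi 0 j - t].
Proof.
have [h1 h2 h3] := bary_side_point i xi.
split => [|j|]; rewrite baryD ?h1 ?h2 ?h3 dotvZr dotv_bgradB !bary_vertex//.
- by rewrite eqxx (negbTE (neq_lift _ _)) subr0 mulr1 add0r.
- by rewrite eq_sym (negbTE (neq_lift _ _)) (inj_eq lift_inj) subrr mulr0 addr0.
- by rewrite eq_sym (negbTE (neq_lift _ _)) eqxx sub0r mulrN1.
Qed.

End side_frame.

Section topology_of_simplices.
Context (R : realType).

Lemma within_continuous_comp (X Y : topologicalType) (B : set X) (A : set Y)
    (P : X -> Y) (F : Y -> R) :
  continuous P -> (forall x, B x -> A (P x)) -> {within A, continuous F} ->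
  {within B, continuous (F \o P)}.
Proof.
move=> cP BA /subspace_continuousP cF; apply/subspace_continuousP => x Bx.
apply: (@cvg_comp _ _ _ P F _ (within A (nbhs (P x)))); last exact: cF (BA _ Bx).
move=> V VA; have h : nbhs x (P @^-1` [set y | A y -> V y]) by exact: (cP x _ VA).
suff : nbhs x [set y | B y -> V (P y)] by [].
by apply: filterS h => y h By; exact: h (BA _ By).
Qed.

Lemma within_continuous_measurable_rV n (A : set 'rV[R]_n) (f : 'rV[R]_n -> R) :
  measurable A -> {within A, continuous f} -> measurable_fun A f.
Proof.
move=> mA /continuousP cf; apply: (measurability _ (RGenOpens.measurableE R)) => //.
move=> _ [_ [a [b ->]] <-].
have oI : open `]a, b[%classic by exact: interval_open.
have [V oV VA] := (@open_subspaceP _ A (f @^-1` `]a, b[)).1 (cf _ oI).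
rewrite setIC -VA; apply: measurableI => //; exact: open_measurable_rV.
Qed.

Lemma open_polytope n (I : finType) (g : I -> 'rV[R]_n) (c : I -> R) :
  open (polytope g c).
Proof.
rewrite openE => x Vx;
suff : \forall y \near x, forall i, 0 < dotv (g i) y + c i by [].
apply: (@filter_forall _ _ (fun i (y : 'rV[R]_n) => 0 < dotv (g i) y + c i) (nbhs x)) => i.
have cA : {for x, continuous (fun y => dotv (g i) y + c i)}.
  exact/differentiable_continuous/differentiable_dotv.
exact: cA _ (lt_nbhsr (Vx i)).
Qed.

Lemma simplex_bounded n m (a : 'I_m -> 'rV[R]_n) : bounded_set (simplex a).
Proof.
exists (\sum_i `|a i|); split; first exact: num_real.
move=> M aM x [t [t0 _ t1 ->]]; apply: le_trans (ltW aM).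
apply: le_trans (ler_norm_sum _ _ _) _; apply: ler_sum => i _.
rewrite normrZ ger0_norm// ler_piMl// -t1 (bigD1 i)//= lerDl.
by apply: sumr_ge0.
Qed.

Lemma continuous_bary n (a : 'I_n.+1 -> 'rV[R]_n) i : continuous (fun x => bary a x i).
Proof. by move=> x; apply/differentiable_continuous/differentiable_dotv. Qed.

Lemma simplex_closed n (a : 'I_n.+1 -> 'rV[R]_n) :
  affinely_independent a -> closed (simplex a).
Proof.
move=> fa; have -> : simplex a = \bigcap_(i in [set: 'I_n.+1]) [set x | 0 <= bary a x i].
  apply/seteqP; split => x; first by move=> /(simplexP fa) x0 i _; exact: x0.
  by move=> x0; apply/(simplexP fa) => i; exact: x0.
apply: closed_bigI => i _.
apply: (@closed_comp _ _ (fun x => bary a x i) [set y | 0 <= y]).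
  by move=> x _; exact: continuous_bary.
exact: closed_ge.
Qed.

Lemma simplex_compact n (a : 'I_n.+1 -> 'rV[R]_n) :
  affinely_independent a -> compact (simplex a).
Proof.
by move=> fa; apply: bounded_closed_compact; [exact: simplex_bounded|exact: simplex_closed].
Qed.

End topology_of_simplices.

(** * Integration against the layer profile, and the reference simplex *)

Section flat_product.
Context (R : realType) (d : nat).
Local Notation leb := (lebesgueV R).

Lemma measurable_unconsV2 (W : 'rV[R]_d -> \bar R) : measurable_fun setT W ->
  measurable_fun setT (fun y : 'rV[R]_d.+1 => W (unconsV y).2).
Proof.
move=> mW; apply: (measurableT_comp mW).
exact: (measurableT_comp (@measurable_snd _ _ _ _) (@measurable_unconsV R d)).
Qed.

Lemma measurable_flat0 k : measurable_fun setT (fun y : 'rV[R]_d.+1 => flat k (y 0 0)).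
Proof.
apply: continuous_measurable_rV => y.
apply: continuous_comp; first exact: coord_continuous.
exact: continuous_flat.
Qed.

(** Tonelli in the first coordinate, where the profile has integral 1: limits of layer integrals
    thereby become integrals over the side alone. *)
Lemma ge0_integral_flat2_mul (W : 'rV[R]_d -> \bar R) :
  measurable_fun setT W -> (forall x, 0 <= W x)%E ->
  (\int[leb d.+1]_y ((flat 2 (y 0 0))%:E * W (unconsV y).2) = \int[leb d]_x W x)%E.
Proof.
move=> mW W0; rewrite ge0_integral_consV; last 2 first.
- apply: emeasurable_funM; last exact: measurable_unconsV2.
  by apply/measurable_EFinP; exact: measurable_flat0.
- by move=> y; apply: mule_ge0 => //; rewrite lee_fin flat_ge0.
transitivity (\int[lebesgue_measure]_t ((flat 2 (t : R))%:E * \int[leb d]_x W x))%E.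
  apply: eq_integral => t _.
  rewrite -(ge0_integralZl_EFin (leb d) measurableT (fun x _ => W0 x) mW (flat_ge0 2 t)).
  by apply: eq_integral => x _; rewrite consVK/= mxE unlift_none.
rewrite ge0_integralZr//; last 3 first.
- by apply/measurable_EFinP; apply: continuous_measurable_fun; exact: continuous_flat.
- by move=> t _; rewrite lee_fin flat_ge0.
- exact: integral_ge0.
by rewrite integral_flat2 mul1e.
Qed.

Lemma integral_flat2_mul (w : 'rV[R]_d -> R) : measurable_fun setT w ->
  (\int[leb d.+1]_y (flat 2 (y 0 0) * w (unconsV y).2)%:E = \int[leb d]_x (w x)%:E)%E.
Proof.
move=> mw; rewrite integralE [RHS]integralE; congr (_ - _)%E.
- rewrite -ge0_integral_flat2_mul//; last exact/measurable_funepos/measurable_EFinP.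
  apply: eq_integral => y _; rewrite !funeposE -!EFin_max -EFinM.
  by rewrite maxr_pMr ?flat_ge0// mulr0.
- rewrite -ge0_integral_flat2_mul//; last exact/measurable_funeneg/measurable_EFinP.
  apply: eq_integral => y _; rewrite !funenegE -!EFinN -!EFin_max -EFinM.
  by rewrite maxr_pMr ?flat_ge0// mulr0 mulrN.
Qed.

Lemma integrable_flat2_mul (w : 'rV[R]_d -> R) :
  (leb d).-integrable setT (EFin \o w) ->
  (leb d.+1).-integrable setT (EFin \o (fun y : 'rV[R]_d.+1 => flat 2 (y 0 0) * w (unconsV y).2)).
Proof.
move=> iw; have /integrableP[mw wfin] := iw.
apply/integrableP; split.
  apply/measurable_EFinP; apply: measurable_funM; first exact: measurable_flat0.
  by apply/measurable_EFinP; exact: (measurable_unconsV2 mw).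
apply: le_lt_trans wfin; rewrite -ge0_integral_flat2_mul//; last exact: measurableT_comp.
rewrite le_eqVlt; apply/orP; left; apply/eqP; apply: eq_integral => y _ /=.
by rewrite normrM EFinM ger0_norm ?flat_ge0.
Qed.

End flat_product.

Section ref_simplex.
Context (R : realType) (d : nat).
Local Notation leb := (lebesgueV R).

Definition open_ref_simplex : set 'rV[R]_d :=
  [set xi | (forall i, 0 < xi 0 i) /\ \sum_i xi 0 i < 1].

Lemma open_ref_simplexS : open_ref_simplex `<=` ref_simplex d.
Proof. by move=> xi [xi0 xi1]; split; [move=> i; exact: ltW|exact: ltW]. Qed.

Lemma sum_coord_dotv (xi : 'rV[R]_d) : \sum_i xi 0 i = dotv (const_mx 1) xi.
Proof. by apply: eq_bigr => i _; rewrite mxE mul1r. Qed.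

Lemma open_open_ref_simplex : open open_ref_simplex.
Proof.
have -> : open_ref_simplex = polytope (fun i : 'I_d => unit_vec R i) (fun=> 0) `&`
   [set xi | dotv (const_mx 1) xi < 1].
  apply/seteqP; split => xi [h1 h2]; split => [i|]; rewrite /= -?sum_coord_dotv// ?sum_coord_dotv//.
    by rewrite addr0 dotvC dotv_unit.
  by have := h1 i; rewrite addr0 dotvC dotv_unit.
apply: openI; first exact: open_polytope.
apply: (@open_comp _ _ (dotv (const_mx 1)) [set y | y < 1]).
  by move=> x _; exact: continuous_dotv.
exact: open_lt.
Qed.

Lemma closed_ref_simplex : closed (ref_simplex d : set 'rV[R]_d).
Proof.
have -> : ref_simplex d = (\bigcap_(i in [set: 'I_d]) [set xi : 'rV[R]_d | 0 <= xi 0 i]) `&`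
   [set xi | dotv (const_mx 1) xi <= 1].
  apply/seteqP; split => xi [h1 h2]; split.
  - by move=> i _; exact: h1.
  - by rewrite /= -sum_coord_dotv.
  - by move=> i; exact: h1.
  - by rewrite sum_coord_dotv.
apply: closedI.
  apply: closed_bigI => i _.
  apply: (@closed_comp _ _ (fun x : 'rV[R]_d => x 0 i) [set y | 0 <= y]).
    by move=> x _; exact: coord_continuous.
  exact: closed_ge.
apply: (@closed_comp _ _ (dotv (const_mx 1)) [set y | y <= 1]).
  by move=> x _; exact: continuous_dotv.
exact: closed_le.
Qed.

End ref_simplex.

Lemma integral_negligible_setD d (T : measurableType d) (R : realType)
    (mu : {measure set T -> \bar R}) (E D : set T) (f : T -> \bar R) :
  measurable E -> measurable D -> E `<=` D -> mu.-negligible (D `\` E) ->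
  measurable_fun D f ->
  (\int[mu]_(x in E) f x = \int[mu]_(x in D) f x)%E.
Proof.
move=> mE mD ED [N [mN N0 DN]] mf.
rewrite -{1}(setIidr ED) integral_mkcondr; apply: ae_eq_integral => //.
  by apply/measurable_restrict => //; apply: measurable_funS mf => //; exact: subIsetl.
exists N; split => // x /not_implyP[Dx fx]; apply: DN; split => // Ex.
by apply: fx; rewrite patchE mem_set.
Qed.

Section ref_simplex_measure.
Context (R : realType) (d : nat).
Local Notation leb := (lebesgueV R).
Local Notation open_ref_simplex := (@open_ref_simplex R d).

Lemma measurable_ref_simplex : measurable (ref_simplex d : set 'rV[R]_d).
Proof. by apply: closed_measurable_rV; exact: closed_ref_simplex. Qed.

Lemma open_ref_simplex_box : open_ref_simplex `<=` box (const_mx 0) (const_mx 1).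
Proof.
move=> xi [xi0 xi1] i; rewrite !mxE xi0/=; apply: le_lt_trans xi1.
by rewrite (bigD1 i)//= lerDl sumr_ge0// => j _; exact: ltW.
Qed.

Lemma ref_simplex_bounded : bounded_set (ref_simplex d : set 'rV[R]_d).
Proof.
exists 1; split; first exact: num_real.
move=> M M1 xi [xi0 xi1]; apply: le_trans (ltW M1); apply: ler_norm_rV => // i.
rewrite ger0_norm//; apply: le_trans xi1.
by rewrite (bigD1 i)//= lerDl sumr_ge0.
Qed.

(** The difference lies in the d+1 hyperplanes that bound the simplex. *)
Lemma negligible_ref_boundary :
  (leb d).-negligible (ref_simplex d `\` open_ref_simplex).
Proof.
pose H (i : option 'I_d) : set 'rV[R]_d :=
  match i with Some i => [set xi | dotv (unit_vec R i) xi = 0]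
             | None => [set xi | dotv (const_mx 1) xi = 1] end.
have mH i : measurable (H i).
  case: i => [i|]; rewrite /H.
    rewrite (_ : [set _ | _] = setT `&` dotv (unit_vec R i) @^-1` [set 0]); last by rewrite setTI.
    by apply: continuous_measurable_rV => //; exact: continuous_dotv.
  rewrite (_ : [set _ | _] = setT `&` dotv (const_mx 1) @^-1` [set 1]); last by rewrite setTI.
  by apply: continuous_measurable_rV => //; exact: continuous_dotv.
(* In dimension 0 the vector [const_mx 1] is zero and defines no hyperplane; the closed and the open
   simplex are then the same point. *)
have [d0|d0] := posnP d.
  exists set0; split => // xi [[xi0 xi1] nxi]; exfalso; apply: nxi; split.
    by move=> i; have := ltn_ord i; rewrite {2}d0.
  rewrite big1 ?ltr01// => i _.
  by have := ltn_ord i; rewrite {2}d0.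
have nH i : (leb d).-negligible (H i).
  exists (H i); split => //; case: i => [i|]; apply: lebesgueV_hyperplane.
    apply/eqP => /rowP/(_ i); rewrite /unit_vec !mxE !eqxx => /eqP.
    by rewrite oner_eq0.
  by apply/eqP => /rowP/(_ (Ordinal d0)); rewrite !mxE => /eqP; rewrite oner_eq0.
apply: (@negligibleS _ _ _ _ (\big[setU/set0]_(i : option 'I_d) H i)).
  move=> xi [[xi0 xi1] nxi]; rewrite -bigcup_seq.
  have [e1|] := eqVneq (\sum_i xi 0 i) 1.
    by exists None => /=; rewrite ?mem_index_enum// -sum_coord_dotv.
  rewrite neq_lt [_ < \sum_i _]ltNge xi1 orbF => lt1.
  apply: contrapT => nex; apply: nxi; split => // i.
  rewrite lt_neqAle xi0 andbT; apply/eqP => xii; apply: nex.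
  by exists (Some i) => /=; rewrite ?mem_index_enum// dotvC dotv_unit.
by elim/big_ind: _ => [|A B|i _]; [exact: negligible_set0|exact: negligibleU|exact: nH].
Qed.

Lemma Rintegral_open_ref_simplex (f : 'rV[R]_d -> R) :
  measurable_fun (ref_simplex d) f ->
  \int[leb d]_(x in open_ref_simplex) f x = \int[leb d]_(x in ref_simplex d) f x.
Proof.
move=> mf; rewrite /Rintegral; congr fine.
apply: integral_negligible_setD.
- by apply: open_measurable_rV; exact: open_open_ref_simplex.
- exact: measurable_ref_simplex.
- exact: open_ref_simplexS.
- exact: negligible_ref_boundary.
- exact/measurable_EFinP.
Qed.

End ref_simplex_measure.

Lemma Rintegral_affineV (R : realType) n (E : 'M[R]_n) s (f : 'rV[R]_n -> R) :
  E \in unitmx -> measurable_fun setT f ->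
  `|\det E| * \int[lebesgueV R n]_x f (s + x *m E) = \int[lebesgueV R n]_x f x.
Proof.
move=> uE mf; rewrite /Rintegral -(integral_affineV s uE (f := EFin \o f)); last first.
  exact/measurable_EFinP.
have D0 : 0 < `|\det E| by rewrite normr_gt0 -unitfE -unitmxE.
(* [fine] sends infinite values to 0, so a divergent integral gives 0 on both sides, the determinant
   being nonzero. *)
case: (X in fine (_ * X)%E) => [x| |]/=.
- by [].
- by rewrite mulr0 gt0_muley// lte_fin.
- by rewrite mulr0 gt0_muleNy// lte_fin.
Qed.

Section open_simplex.
Context (R : realType) (d : nat).
Local Notation n := d.+1.
Local Notation leb := (lebesgueV R).
Context (a : 'I_n.+1 -> 'rV[R]_n) (fa : affinely_independent a).
Context (F : 'rV[R]_n -> R) (cF : {within simplex a, continuous F}).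
Local Notation U := (polytope (bgrad a) (bcst a)).

Lemma polytope_simplex : U `<=` simplex a.
Proof. by move=> x Ux; apply/(simplexP fa) => i; exact: ltW (Ux i). Qed.

Lemma measurable_polytope : measurable U.
Proof. by apply: open_measurable_rV; exact: open_polytope. Qed.

Lemma measurable_fun_polytope : measurable_fun U F.
Proof.
apply: (measurable_funS _ polytope_simplex).
  by apply: closed_measurable_rV; exact: simplex_closed.
apply: within_continuous_measurable_rV => //.
by apply: closed_measurable_rV; exact: simplex_closed.
Qed.

Lemma forall_lift (i : 'I_n.+1) (P : 'I_n.+1 -> Prop) :
  P i -> P (lift i ord0) -> (forall j, P (lift i (lift ord0 j))) -> forall j, P j.
Proof.
move=> Pi P0 PS j; case: (unliftP i j) => [k ->|->//].
by case: (unliftP ord0 k) => [l ->|->].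
Qed.

Lemma side_point_simplex i xi : ref_simplex d xi -> simplex a (side_point a i xi).
Proof.
move=> [xi0 xi1]; apply/(simplexP fa).
have [h1 h2 h3] := bary_side_point fa i xi.
by apply: (@forall_lift i) => [||j]; rewrite ?h1 ?h2 ?h3 ?subr_ge0.
Qed.

End open_simplex.

Lemma cvg_rV (R : realType) (T : Type) (F : set_system T) (FF : Filter F) n
    (f : T -> 'rV[R]_n) (l : 'rV[R]_n) :
  (forall j, f x 0 j @[x --> F] --> l 0 j) -> f @ F --> l.
Proof.
move=> fl P /nbhs_ballP[e /= e0 eP].
have h : F (fun x => forall j, ball (l 0 j) e (f x 0 j)).
  apply: (@filter_forall _ _ (fun j x => ball (l 0 j) e (f x 0 j)) F) => j.
  by apply: (fl j); exact: nbhsx_ballx.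
suff : F (f @^-1` P) by [].
by apply: filterS h => x hx; apply: eP; split => // i j; rewrite ord1; exact: hx.
Qed.

Lemma continuous_mulmx (R : realType) m k (A : 'M[R]_(m, k)) :
  continuous (fun x : 'rV[R]_m => x *m A).
Proof.
move=> x; apply: (@cvg_rV _ _ (nbhs x)) => j.
rewrite mxE; under eq_fun do rewrite mxE.
apply: (@cvg_bigsum _ _ (nbhs x) _ _ _ (fun i (y : 'rV[R]_m) => y 0 i * A i j)) => i.
by apply: cvgM; [exact: coord_continuous|exact: cvg_cst].
Qed.

(** * Concentration of the bump gradients on the sides *)

Section boundary_layer.
Context (R : realType) (d : nat).
Local Notation n := d.+1.
Local Notation leb := (lebesgueV R).
Context (a : 'I_n.+1 -> 'rV[R]_n) (fa : affinely_independent a).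
Context (F : 'rV[R]_n -> R) (cF : {within simplex a, continuous F}).
Local Notation U := (polytope (bgrad a) (bcst a)).

Lemma continuous_side_point i : continuous (side_point a i).
Proof.
move=> x; apply: (@cvgD _ 'rV[R]_n _ (nbhs x) _ (fun=> opp_side a i ord0)
  (fun xi => xi *m edges (opp_side a i))); [exact: cvg_cst|exact: continuous_mulmx].
Qed.

(* Coordinates near the i-th side: y_0 = (m + 1) bary_i - 1 is the variable in which
   the derivative of the bump function concentrates as m grows. *)
Definition layer_point i (m : nat) (y : 'rV[R]_n) :=
  side_point a i (unconsV y).2 + (m.+1%:R^-1 * (y 0 0 + 1)) *: (a i - opp_side a i ord0).

Definition layer_scale (m : nat) : 'M[R]_n :=
  (block_mx (m.+1%:R^-1)%:M (0 : 'rV[R]_d) (0 : 'cV[R]_d) (1%:M : 'M[R]_d) : 'M[R]_(1 + d)).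

Lemma det_layer_scale m : \det (layer_scale m) = m.+1%:R^-1.
Proof. by rewrite /layer_scale (@det_ublock R 1 d) det_scalar1 det1 mulr1. Qed.

Lemma layer_pointE i m y : layer_point i m y =
  (opp_side a i ord0 + m.+1%:R^-1 *: (a i - opp_side a i ord0)) +
  y *m (layer_scale m *m side_frame a i).
Proof.
rewrite mulmxA -{2}(unconsVK y) consV_mul_block scaler0 add0r mulmx1 mulmx0 mxE addr0.
rewrite addrAC side_frame_mulE -addrA -scalerDl /layer_point; congr (_ + _ *: _).
by rewrite mulrDr mulr1.
Qed.

Lemma layer_frame_unit i m :
  (layer_scale m *m side_frame a i) \in unitmx.
Proof.
rewrite unitmx_mul side_frame_unit// andbT unitmxE det_layer_scale.
by rewrite unitfE invr_eq0 pnatr_eq0.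
Qed.

(** The coefficient of [dotv (bgrad a i) v] in the derivative of the bump along v. *)
Definition layer m (i : 'I_n.+1) (x : 'rV[R]_n) : R :=
  m.+1%:R * flat 2 (m.+1%:R * bary a x i - 1) *
  \prod_(j | j != i) flat 0 (m.+1%:R * bary a x j - 1).

(** The integrand over the element in layer coordinates; the factor m+1 of [layer] has been absorbed
    by the Jacobian. *)
Definition layer_fun i m (y : 'rV[R]_n) : R :=
  (F \_ U) (layer_point i m y) * (flat 2 (y 0 0) *
  \prod_(j | j != i) flat 0 (m.+1%:R * bary a (layer_point i m y) j - 1)).

Lemma bary_layer_point i m y : bary a (layer_point i m y) i = m.+1%:R^-1 * (y 0 0 + 1).
Proof. by have [] := bary_frame fa i (m.+1%:R^-1 * (y 0 0 + 1)) (unconsV y).2. Qed.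

Lemma layer_layer_point i m y : layer m i (layer_point i m y) =
  m.+1%:R * (flat 2 (y 0 0) *
  \prod_(j | j != i) flat 0 (m.+1%:R * bary a (layer_point i m y) j - 1)).
Proof.
by rewrite /layer bary_layer_point mulVKf ?pnatr_eq0// addrK mulrA.
Qed.

(** A confinement independent of m: these functions live over the open reference simplex, itself
    inside the unit box. This supplies the dominating function. *)
Lemma layer_fun_neq0 i m y : layer_fun i m y != 0 ->
  0 < y 0 0 /\ open_ref_simplex (unconsV y).2.
Proof.
rewrite /layer_fun !mulf_eq0 !negb_or => /and3P[FU f2 /prodf_neq0 pi].
have y0 : 0 < y 0 0 by rewrite ltNge; apply: contra f2 => ?; rewrite flat_npos.
have b0 j : j != i -> 0 < bary a (layer_point i m y) j.
  move=> ji; rewrite ltNge; apply: contra (pi j ji) => b0; rewrite flat_npos//.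
  by rewrite subr_le0 (le_trans _ ler01)// mulr_ge0_le0.
have [h1 h2 h3] := bary_frame fa i (m.+1%:R^-1 * (y 0 0 + 1)) (unconsV y).2.
split => //; split => [j|].
  by rewrite -h2; apply: b0; rewrite eq_sym neq_lift.
have : 0 < bary a (layer_point i m y) (lift i ord0) by apply: b0; rewrite eq_sym neq_lift.
rewrite h3 -addrA -opprD subr_gt0; apply: le_lt_trans.
by rewrite lerDl mulr_ge0 ?invr_ge0// addr_ge0// ltW.
Qed.

Lemma cvg_layer_point i y : layer_point i m y @[m --> \oo] --> side_point a i (unconsV y).2.
Proof.
rewrite -[X in _ --> X]addr0 -(scale0r (a i - opp_side a i ord0)).
apply: cvgD; first exact: cvg_cst.
apply: cvgZr_tmp; rewrite -(mul0r (y 0 0 + 1)).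
by apply: cvgM; [exact: cvg_harmonic|exact: cvg_cst].
Qed.

(** When y_0 > 0 and the other coordinates lie in the open simplex, the layer point is eventually in
    the open element and tends to the side. The remaining barycentric coordinates have positive
    limits, so their factors tend to 1. *)
Lemma cvg_layer_fun i y : layer_fun i m y @[m --> \oo] -->
  flat 2 (y 0 0) * ((F \o side_point a i) \_ (@open_ref_simplex R d)) (unconsV y).2.
Proof.
have [y0|y0] := leP (y 0 0) 0.
  rewrite flat_npos// mul0r; apply: cvg_near_cst; apply: nearW => m.
  by rewrite /layer_fun (flat_npos _ y0) mul0r mulr0.
have [xi|nxi] := pselect (open_ref_simplex (unconsV y).2); last first.
  rewrite patchE memNset// mulr0; apply: cvg_near_cst; apply: nearW => m.
  by apply/eqP; apply: contrapT => /negP /layer_fun_neq0[_].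
rewrite patchE mem_set// /comp mulrC -[flat 2 _]mulr1.
have bE m := bary_frame fa i (m.+1%:R^-1 * (y 0 0 + 1)) (unconsV y).2.
have [xi0 xi1] := xi.
have c0 : m.+1%:R^-1 * (y 0 0 + 1) @[m --> \oo] --> (0 : R).
  by rewrite -(mul0r (y 0 0 + 1)); apply: cvgM; [exact: cvg_harmonic|exact: cvg_cst].
have nearU : \forall m \near \oo, U (layer_point i m y).
  near=> m; have [h1 h2 h3] := bE m.
  apply: (@forall_lift d i (fun j => 0 < bary a (layer_point i m y) j)) => [||j].
  - by rewrite bary_layer_point mulr_gt0 ?invr_gt0// addr_gt0.
  - rewrite h3 subr_gt0; near: m; apply: (cvgr_lt _ c0).
    by rewrite subr_gt0.
  - by rewrite h2.
apply: cvgM; last apply: cvgM.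
- have cvT : F (layer_point i m y) @[m --> \oo] --> F (side_point a i (unconsV y).2).
    have /subspace_continuousP cF' := cF.
    have sT : simplex a (side_point a i (unconsV y).2).
      by apply: (side_point_simplex fa); exact: open_ref_simplexS.
    apply: (@cvg_comp _ _ _ _ F _ (within (simplex a) (nbhs (side_point a i (unconsV y).2)))); last exact: cF' sT.
    move=> V VT; have h := cvg_layer_point VT.
    have : \forall m \near \oo, V (layer_point i m y).
      near=> m; have : simplex a (layer_point i m y).
        by apply: (polytope_simplex fa); near: m.
      by near: m.
    by [].
  apply: cvg_trans cvT; apply: near_eq_cvg; near=> m.
  by rewrite patchE mem_set//; near: m.
- exact: cvg_cst.
- have cp : (\prod_j (if j != i then flat 0 (m.+1%:R * bary a (layer_point i m y) j - 1) else 1))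
      @[m --> \oo] --> \prod_(j : 'I_n.+1) (1 : R); last first.
    rewrite big1_eq in cp; apply: cvg_trans cp; apply: near_eq_cvg; apply: nearW => m.
    by rewrite [RHS]big_mkcond.
  apply: cvg_bigprod; apply: (@forall_lift d i).
  + by rewrite eqxx; exact: cvg_cst.
  + rewrite eq_sym neq_lift.
    have l0 : 0 < 1 - \sum_j (unconsV y).2 0 j by rewrite subr_gt0.
    (* The coordinate at the base vertex is its limit minus (y_0 + 1)/(m+1); multiplied by m+1, this
       drift only adds the constant y_0 + 1 to the shift 1. *)
    apply: cvg_trans (cvg_flat0_scale (y 0 0 + 1 + 1) l0); apply: near_eq_cvg; apply: nearW => m.
    have [_ _ h3] := bE m; rewrite /layer_point h3 [in RHS]mulrBr mulVKf ?pnatr_eq0//.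
    by rewrite opprD addrA.
  + move=> j; rewrite eq_sym neq_lift.
    have xij : 0 < (unconsV y).2 0 j by exact: xi0.
    apply: cvg_trans (cvg_flat0_scale 1 xij); apply: near_eq_cvg; apply: nearW => m.
    by have [_ h2 _] := bE m; rewrite /layer_point h2.
Unshelve. all: by end_near. Qed.

End boundary_layer.

Section boundary_layer_limit.
Context (R : realType) (d : nat).
Local Notation n := d.+1.
Local Notation leb := (lebesgueV R).
Context (a : 'I_n.+1 -> 'rV[R]_n) (fa : affinely_independent a).
Context (F : 'rV[R]_n -> R) (cF : {within simplex a, continuous F}).
Local Notation U := (polytope (bgrad a) (bcst a)).

Lemma measurable_flat_comp k i (c1 c2 : R) :
  measurable_fun setT (fun x : 'rV[R]_n => flat k (c1 * bary a x i - c2)).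
Proof.
have -> : (fun x : 'rV[R]_n => flat k (c1 * bary a x i - c2)) =
    fun x => flat k (dotv (c1 *: bgrad a i) x + (c1 * bcst a i - c2)).
  by apply/funext => x; rewrite /bary dotvZl mulrDr addrA.
apply: continuous_measurable_rV => x; apply/differentiable_continuous.
by apply: bump_differentiable; exact: BumpFlat.
Qed.

Lemma measurable_layer m i : measurable_fun setT (layer a m i).
Proof.
rewrite /layer; apply: measurable_funM.
  by apply: measurable_funM => //; exact: measurable_flat_comp.
under eq_fun do rewrite -big_filter.
by apply: measurable_prod => j _; exact: measurable_flat_comp.
Qed.

Lemma integrable_layer_dominating (C : R) : (leb n).-integrable setT (EFin \o
  (fun y : 'rV[R]_n => flat 2 (y 0 0) * (C * \1_(box (const_mx 0) (const_mx 1)) (unconsV y).2))).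
Proof.
apply: (@integrable_flat2_mul _ _ (fun xi => C * \1_(box (const_mx 0) (const_mx 1)) xi)).
exact: integrable_cst_box.
Qed.

(** The chart has Jacobian |det [side_frame]|/(m+1), which cancels the height m+1 of the layer.
    Dominated convergence then leaves [flat 2] times the values of F on the side. *)
Lemma cvg_boundary_layer i :
  (\int[leb n]_(x in U) (F x * layer a m i x)) @[m --> \oo] -->
  `|\det (side_frame a i)| * \int[leb d]_(xi in ref_simplex d) F (side_point a i xi).
Proof.
have [C C0 FC] := compact_continuous_bounded (simplex_compact fa) cF.
have mFU : measurable_fun setT (F \_ U).
  exact: ((measurable_restrictT F (measurable_polytope a)).1 (measurable_fun_polytope fa cF)).
pose f0 m x := (F \_ U) x * layer a m i x.
have mf0 m : measurable_fun setT (f0 m).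
  by apply: measurable_funM => //; exact: measurable_layer.
have layE m y : layer_fun a F i m y = m.+1%:R^-1 * f0 m (layer_point a i m y).
  by rewrite /f0 (layer_layer_point fa) mulrCA mulKf ?pnatr_eq0.
have mlay m : measurable_fun setT (layer_fun a F i m).
  rewrite (funext (layE m)); under eq_fun do rewrite layer_pointE.
  apply: measurable_funM => //; apply: (measurableT_comp (mf0 m)).
  exact: measurable_affineV.
have dom m y : setT y -> `|layer_fun a F i m y| <=
    flat 2 (y 0 0) * (C * \1_(box (const_mx 0) (const_mx 1)) (unconsV y).2).
  move=> _; have [->|l0] := eqVneq (layer_fun a F i m y) 0.
    rewrite normr0; apply: mulr_ge0; first exact: flat_ge0.
    by apply: mulr_ge0; [exact: ltW|rewrite indicE; case: (_ \in _)].
  have [y0 xi] := layer_fun_neq0 fa l0.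
  rewrite indicE mem_set ?mulr1; last exact: open_ref_simplex_box.
  rewrite /layer_fun normrM mulrC normrM [`|flat 2 _|]ger0_norm ?flat_ge0//.
  rewrite -mulrA ler_wpM2l ?flat_ge0// -[leRHS]mul1r; apply: ler_pM => //.
    rewrite ger0_norm ?prodr_ge0// => [|j _]; last exact: flat_ge0.
    by apply: prodr_ile1 => j _; rewrite flat_ge0 flat0_le1.
  rewrite patchE; case: ifPn => [|_]; last by rewrite normr0 ltW.
  by rewrite inE => Ux; apply: FC; exact: (polytope_simplex fa).
have ilay m : (leb n).-integrable setT (EFin \o layer_fun a F i m).
  exact: (integrable_bounded measurableT (mlay m) (integrable_layer_dominating C) (dom m)).
have intE m : \int[leb n]_(x in U) (F x * layer a m i x) =
    `|\det (side_frame a i)| * \int[leb n]_y layer_fun a F i m y.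
  rewrite Rintegral_mkcond.
  transitivity (\int[leb n]_x f0 m x).
    by apply: eq_Rintegral => x _; rewrite /f0 !patchE; case: ifPn; rewrite // mul0r.
  rewrite -(Rintegral_affineV (opp_side a i ord0 + m.+1%:R^-1 *: (a i - opp_side a i ord0))
    (layer_frame_unit fa i m) (mf0 m)).
  under eq_Rintegral do rewrite -layer_pointE.
  have if0 : (leb n).-integrable setT (EFin \o (fun y => f0 m (layer_point a i m y))).
    have := integrable_realZ measurableT m.+1%:R (ilay m).
    by apply: eq_integrable => // y _; rewrite /= layE mulVKf ?pnatr_eq0.
  under [in RHS]eq_Rintegral do rewrite layE.
  rewrite RintegralZl// det_mulmx det_layer_scale normrM mulrA ger0_norm ?invr_ge0//.
  by rewrite [_^-1 * _]mulrC.
under eq_fun do rewrite intE.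
apply: cvgM; first exact: cvg_cst.
have [_ cvI] := cvg_Rintegral measurableT mlay (fun y _ => @cvg_layer_fun _ _ _ fa _ cF i y)
  (integrable_layer_dominating C) dom.
have msp : measurable_fun (ref_simplex d) (F \o side_point a i).
  apply: within_continuous_measurable_rV; first exact: measurable_ref_simplex.
  apply: within_continuous_comp cF => [|xi]; first exact: continuous_side_point.
  exact: side_point_simplex.
have mO : measurable (@open_ref_simplex R d) by apply: open_measurable_rV; exact: open_open_ref_simplex.
rewrite -Rintegral_open_ref_simplex// [X in _ --> X]Rintegral_mkcond.
pose w := (F \o side_point a i) \_ (@open_ref_simplex R d).
have mw : measurable_fun setT w.
  apply: (measurable_restrictT _ mO).1.
  by apply: measurable_funS msp; [exact: measurable_ref_simplex|exact: open_ref_simplexS].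
have e : \int[leb n]_y (flat 2 (y 0 0) * w (unconsV y).2) = \int[leb d]_xi w xi.
  by rewrite /Rintegral (integral_flat2_mul mw).
by rewrite e in cvI; exact: cvI.
Qed.

Lemma continuous_layer m i : continuous (layer a m i).
Proof.
have fE k (j : 'I_n.+1) : bump_algebra (fun x => flat k (m.+1%:R * bary a x j - 1)).
  have -> : (fun x : 'rV[R]_n => flat k (m.+1%:R * bary a x j - 1)) =
      fun x => flat k (dotv (m.+1%:R *: bgrad a j) x + (m.+1%:R * bcst a j - 1)).
    by apply/funext => x; rewrite /bary dotvZl mulrDr addrA.
  exact: BumpFlat.
have bl : bump_algebra (layer a m i).
  have -> : layer a m i = (cst m.+1%:R \* (fun x => flat 2 (m.+1%:R * bary a x i - 1))) \*
      (fun x => \prod_(j <- [seq j <- index_enum 'I_n.+1 | j != i]) flat 0 (m.+1%:R * bary a x j - 1)).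
    by apply/funext => x; rewrite /layer /= big_filter.
  apply: BumpMul; first by apply: BumpMul; [exact: BumpCst|exact: fE].
  by apply: bump_prod => j; exact: fE.
by move=> x; exact/differentiable_continuous/bump_differentiable.
Qed.

Lemma polytope_lty : (leb n U < +oo)%E.
Proof.
apply: lebesgueV_bounded; first exact: measurable_polytope.
by apply: bounded_subset (simplex_bounded a); exact: (polytope_simplex fa).
Qed.

Lemma integrable_polytope : (leb n).-integrable U (EFin \o F).
Proof.
have [C C0 FC] := compact_continuous_bounded (simplex_compact fa) cF.
apply: measurable_bounded_integrable.
- exact: measurable_polytope.
- exact: polytope_lty.
- exact: (measurable_fun_polytope fa cF).
- exists C; split; first exact: num_real.
  move=> M CM x Ux; apply: le_trans (ltW CM).
  by apply: FC; exact: (polytope_simplex fa).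
Qed.

(** F is merely continuous, and g acts as its derivative along v against the bumps. This formulation
    serves smooth functions and products with Sobolev functions alike. *)
Lemma green (v : 'rV[R]_n) (g : 'rV[R]_n -> R) :
  (leb n).-integrable U (EFin \o g) ->
  (forall m, \int[leb n]_(x in U) (F x * 'D_v (bump (bgrad a) (bcst a) m) x) =
           - \int[leb n]_(x in U) (g x * bump (bgrad a) (bcst a) m x)) ->
  \int[leb n]_(x in U) g x = - \sum_i dotv (bgrad a i) v *
    (`|\det (side_frame a i)| * \int[leb d]_(xi in ref_simplex d) F (side_point a i xi)).
Proof.
move=> ig Fg; have mU := measurable_polytope a.
have mg : measurable_fun U g by exact/measurable_EFinP/measurable_int/ig.
have iFl m i : (leb n).-integrable U (EFin \o (fun x => F x * layer a m i x)).
  have [C C0 lC] := compact_continuous_bounded (simplex_compact fa) (continuous_subspaceT (@continuous_layer m i)).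
  apply: (@integrable_mul_bounded _ _ _ _ _ mU _ _ C integrable_polytope).
    by apply: measurable_funTS; exact: measurable_layer.
  by move=> x Ux; apply: lC; exact: (polytope_simplex fa).
have lhs m : \int[leb n]_(x in U) (F x * 'D_v (bump (bgrad a) (bcst a) m) x) =
    \sum_i dotv (bgrad a i) v * \int[leb n]_(x in U) (F x * layer a m i x).
  transitivity (\int[leb n]_(x in U) (\sum_i dotv (bgrad a i) v * (F x * layer a m i x))).
    apply: eq_Rintegral => x _; rewrite derive_bump big_distrr/=; apply: eq_bigr => i _.
    by rewrite /layer /bary; set p := \prod_(_ | _) _; set q := flat _ _; ring.
  rewrite Rintegral_sum//; last by move=> i; exact: integrable_realZ.
  by apply: eq_bigr => i _; rewrite RintegralZl.
have cvL : (\sum_i dotv (bgrad a i) v * \int[leb n]_(x in U) (F x * layer a m i x)) @[m --> \oo] -->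
    \sum_i dotv (bgrad a i) v *
    (`|\det (side_frame a i)| * \int[leb d]_(xi in ref_simplex d) F (side_point a i xi)).
  apply: (@cvg_bigsum _ _ (nbhs \oo) _ _ _ (fun i m => dotv (bgrad a i) v * \int[leb n]_(x in U) (F x * layer a m i x))) => i.
  by apply: cvgM; [exact: cvg_cst|exact: cvg_boundary_layer].
have mb m : measurable_fun U (bump (bgrad a) (bcst a) m).
  apply: measurable_funTS; apply: continuous_measurable_rV => x.
  by apply/differentiable_continuous/bump_differentiable/bump_in_algebra.
have [| | |_ cvR] := @cvg_Rintegral _ _ _ (leb n) U mU (fun m x => g x * bump (bgrad a) (bcst a) m x) g
  _ _ _ (integrable_norm ig).
- by move=> m; exact: measurable_funM.
- move=> x Ux; rewrite -[X in _ --> X]mulr1; apply: cvgM; [exact: cvg_cst|exact: cvg_bump].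
- move=> m x _; rewrite normrM ler_piMr// ger0_norm ?bump_ge0//; exact: bump_le1.
apply: (cvg_unique (@Rhausdorff R) cvR).
apply: cvg_trans (cvgN cvL); apply: near_eq_cvg; apply: nearW => m.
by have := Fg m; rewrite lhs => e; rewrite -[RHS]opprK -e.
Qed.

End boundary_layer_limit.

(** * Surface integrals and normals of simplices *)

Section simplex_parametrization.
Context (R : realType) (n d : nat).
Local Notation leb := (lebesgueV R).
Implicit Types b : 'I_d.+1 -> 'rV[R]_n.

Definition param b (xi : 'rV[R]_d) : 'rV[R]_n := b ord0 + xi *m edges b.

Lemma simplex_paramP b x : simplex b x <-> exists2 xi, ref_simplex d xi & x = param b xi.
Proof.
split=> [[t [t0 _ t1 ->]]|[xi [xi0 xi1] ->]].
  exists (\row_i t (lift ord0 i)).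
    split=> [i|]; first by rewrite mxE.
    under eq_bigr do rewrite mxE.
    by rewrite -t1 big_ord_recl lerDr.
  rewrite /param mulmx_edges; under [in RHS]eq_bigr do rewrite mxE scalerBr.
  rewrite sumrB -scaler_suml big_ord_recl addrA addrAC; congr (_ + _).
  move/eqP: t1; rewrite big_ord_recl eq_sym -subr_eq => /eqP <-.
  by rewrite scalerBl scale1r.
exists (fun i => if unlift ord0 i is Some j then xi 0 j else 1 - \sum_j xi 0 j).
split => //.
- by move=> i; case: unliftP => [j _|_]; rewrite ?subr_ge0.
- by move=> i /(_ I).
- rewrite big_ord_recl unlift_none [X in _ + X](eq_bigr (fun j => xi 0 j)) ?subrK// => j _.
  by rewrite liftK.
- rewrite /param mulmx_edges big_ord_recl unlift_none.
  rewrite [in RHS](eq_bigr (fun j => xi 0 j *: b (lift ord0 j))); last first.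
    by move=> j _; rewrite liftK.
  rewrite [in LHS](eq_bigr (fun j => xi 0 j *: b (lift ord0 j) - xi 0 j *: b ord0)); last first.
    by move=> j _; rewrite scalerBr.
  rewrite sumrB -scaler_suml scalerBl scale1r.
  by rewrite [in RHS]addrAC -addrA.
Qed.

Lemma param_inj b : row_free (edges b) -> injective (param b).
Proof. by move=> fb x y /addrI; exact: row_free_inj. Qed.

Lemma vertex_simplex b j : simplex b (b j).
Proof.
exists (fun i => (i == j)%:R); split => //.
- by move=> i /(_ I).
- by rewrite (bigD1 j)//= eqxx big1 ?addr0// => i /negbTE ->.
- rewrite (bigD1 j)//= eqxx scale1r big1 ?addr0// => i /negbTE ->.
  by rewrite scale0r.
Qed.

Lemma continuous_param b : continuous (param b).
Proof.
move=> x; apply: (@cvgD _ 'rV[R]_n _ (nbhs x) _ (fun=> b ord0)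
  (fun xi => xi *m edges b)); [exact: cvg_cst|exact: continuous_mulmx].
Qed.

Lemma ref_simplex_gt0 : (0 < leb d (ref_simplex d))%E.
Proof.
apply: (@lt_le_trans _ _ (leb d (@open_ref_simplex R d))).
  apply: lebesgueV_open_gt0; first exact: open_open_ref_simplex.
  exists (const_mx d.+1%:R^-1); split => [i|]; first by rewrite mxE invr_gt0.
  under eq_bigr do rewrite mxE.
  rewrite sumr_const card_ord -[X in X < _]mulr_natl ltr_pdivrMr// mul1r ltr_nat.
  by [].
apply: le_measure; rewrite ?inE; last exact: open_ref_simplexS.
- by apply: open_measurable_rV; exact: open_open_ref_simplex.
- exact: measurable_ref_simplex.
Qed.

Lemma ref_simplex_lty : (leb d (ref_simplex d) < +oo)%E.
Proof.
by apply: lebesgueV_bounded; [exact: measurable_ref_simplex|exact: ref_simplex_bounded].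
Qed.

(** The two parametrizations differ by an affine bijection of the reference simplex, which preserves
    a positive finite volume; hence its determinant is 1 in absolute value. Integrals over a shared
    side thus do not depend on the element from which it is seen. *)
Lemma simplex_reparam b b' : row_free (edges b) -> row_free (edges b') ->
  simplex b = simplex b' ->
  exists (Q : 'M[R]_d) (eta : 'rV[R]_d), [/\ Q \in unitmx, `|\det Q| = 1,
    edges b' = Q *m edges b, forall xi, param b' xi = param b (eta + xi *m Q) &
    forall xi, ref_simplex d (eta + xi *m Q) <-> ref_simplex d xi].
Proof.
move=> fb fb' bb'.
have etaP j : exists xi, b' j = param b xi.
  have : simplex b (b' j) by rewrite bb'; exact: vertex_simplex.
  by move=> /simplex_paramP[xi _ ->]; exists xi.
pose eta j := projT1 (cid (etaP j)).
have etaE j : b' j = param b (eta j) by exact: (projT2 (cid (etaP j))).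
pose Q : 'M[R]_d := \matrix_i (eta (lift ord0 i) - eta ord0).
have QE : edges b' = Q *m edges b.
  apply/row_matrixP => i; rewrite row_mul !rowK [in LHS]etaE [in LHS]etaE /param.
  by rewrite opprD addrACA subrr add0r mulmxBl.
have uQ : Q \in unitmx.
  rewrite -row_free_unit -kermx_eq0; apply/rowV0P => u /sub_kermxP uQ0.
  by apply: (row_free_inj fb'); rewrite /= QE mulmxA uQ0 !mul0mx.
have PE xi : param b' xi = param b (eta ord0 + xi *m Q).
  by rewrite /param [in LHS]etaE /param QE mulmxDl mulmxA addrA.
have refE xi : ref_simplex d (eta ord0 + xi *m Q) <-> ref_simplex d xi.
  split => h.
    have : simplex b (param b' xi) by apply/simplex_paramP; exists (eta ord0 + xi *m Q).
    by rewrite bb' => /simplex_paramP[xi' h' /(param_inj fb') ->].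
  have : simplex b' (param b' xi) by apply/simplex_paramP; exists xi.
  by rewrite -bb' => /simplex_paramP[xi' h']; rewrite PE => /(param_inj fb) ->.
exists Q, (eta ord0); split => //.
have := @integral_affineV _ _ Q (eta ord0) (EFin \o \1_(ref_simplex d : set 'rV[R]_d)) uQ.
have mr := @measurable_ref_simplex R d.
have -> : (\int[leb d]_x (EFin \o \1_(ref_simplex d : set 'rV[R]_d)) (eta ord0 + x *m Q)%R =
          \int[leb d]_x (EFin \o \1_(ref_simplex d : set 'rV[R]_d)) x)%E.
  apply: eq_integral => xi _ /=; rewrite !indicE; congr (_%:R)%:E.
  congr nat_of_bool; apply/idP/idP => /set_mem/refE; exact: mem_set.
have mind : measurable_fun setT (EFin \o (\1_(ref_simplex d) : 'rV[R]_d -> R)).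
  apply/(@measurable_EFinP _ _ R); exact: (@measurable_indic _ _ R).
have [v v0 ev] : exists2 v, 0 < v & leb d (ref_simplex d) = v%:E.
  have := ref_simplex_gt0; have := ref_simplex_lty.
  by case: (leb d (ref_simplex d)) => [v| |]//= _; rewrite lte_fin => v0; exists v.
move=> /(_ mind); rewrite /= integral_indic// setIT => e.
have [e'] : (`|\det Q|%:E * v%:E = v%:E)%E by rewrite -ev.
by apply: (mulIf (lt0r_neq0 v0)); rewrite mul1r.
Qed.

End simplex_parametrization.

(** * Real-valued integrals over sides *)

Section side_integral.
Context (R : realType) (n d : nat).
Local Notation leb := (lebesgueV R).
Implicit Types b : 'I_d.+1 -> 'rV[R]_n.

Lemma affine_freeP b : row_free (edges b) <->
  forall t : 'I_d.+1 -> R, \sum_i t i = 0 -> \sum_i t i *: b i = 0 -> forall i, t i = 0.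
Proof.
have key (t : 'I_d.+1 -> R) : \sum_i t i = 0 ->
    \sum_i t i *: b i = (\row_i t (lift ord0 i)) *m edges b.
  move=> t0; rewrite mulmx_edges; under [RHS]eq_bigr do rewrite mxE scalerBr.
  rewrite sumrB -scaler_suml big_ord_recl/= addrC; congr (_ + _).
  move/eqP: t0; rewrite big_ord_recl addr_eq0 => /eqP ->.
  by rewrite scaleNr.
split => [fb t t0 tb|h].
  have {}tb : \row_i t (lift ord0 i) = 0.
    by apply: (row_free_inj fb); rewrite /= mul0mx -key.
  have tl j : t (lift ord0 j) = 0 by have /rowP/(_ j) := tb; rewrite !mxE.
  move=> i; case: (unliftP ord0 i) => [j ->|->]; first exact: tl.
  by move: t0; rewrite big_ord_recl big1 ?addr0.
rewrite -kermx_eq0; apply/rowV0P => u /sub_kermxP ub.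
pose t i := if unlift ord0 i is Some j then u 0 j else - \sum_j u 0 j.
have tl j : t (lift ord0 j) = u 0 j by rewrite /t liftK.
have t0 : \sum_i t i = 0.
  by rewrite big_ord_recl (eq_bigr _ (fun j _ => tl j)) /t unlift_none addNr.
apply/rowP => j; rewrite mxE -tl; apply: h => //.
rewrite key// -[RHS]ub; congr (_ *m _); apply/rowP => k; rewrite mxE.
exact: tl.
Qed.

Lemma affine_free_reindex b (s : 'I_d.+1 -> 'I_d.+1) : injective s ->
  row_free (edges b) -> row_free (edges (b \o s)).
Proof.
move=> si /affine_freeP fb; apply/affine_freeP => t t0 tb i.
have sK := invF_f si; have Ks := f_invF si.
rewrite -(sK i); apply: (fb (fun j => t (invF si j))).
- rewrite (reindex_inj si)/= -[RHS]t0; apply: eq_bigr => j _; by rewrite sK.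
- rewrite (reindex_inj si)/= -[RHS]tb; apply: eq_bigr => j _; by rewrite sK.
Qed.

Lemma simplex_reindex b (s : 'I_d.+1 -> 'I_d.+1) : injective s ->
  simplex (b \o s) = simplex b.
Proof.
move=> si; have sK := invF_f si; have Ks := f_invF si.
apply/seteqP; split => x [t [t0 _ t1 ->]].
  exists (fun j => t (invF si j)); split => //.
  - by move=> i /(_ I).
  - by rewrite (reindex_inj si)/= -[RHS]t1; apply: eq_bigr => j _; rewrite sK.
  - by rewrite [RHS](reindex_inj si)/=; apply: eq_bigr => j _; rewrite sK.
exists (fun j => t (s j)); split => //.
- by move=> i /(_ I).
- by rewrite -[RHS]t1 [RHS](reindex_inj si).
- by rewrite [LHS](reindex_inj si).
Qed.

Definition side_integral b (h : 'rV[R]_n -> R) : R :=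
  Num.sqrt (\det (edges b *m (edges b)^T)) *
  \int[leb d]_(xi in ref_simplex d) h (param b xi).

Lemma measurable_param b (h : 'rV[R]_n -> R) : {within simplex b, continuous h} ->
  measurable_fun (ref_simplex d) (h \o param b).
Proof.
move=> ch; apply: within_continuous_measurable_rV; first exact: measurable_ref_simplex.
apply: within_continuous_comp ch; first exact: continuous_param.
by move=> xi hxi; apply/simplex_paramP; exists xi.
Qed.

Lemma integrable_param b (h : 'rV[R]_n -> R) : {within simplex b, continuous h} ->
  (leb d).-integrable (ref_simplex d) (EFin \o (h \o param b)).
Proof.
move=> ch.
have cr : compact (ref_simplex d : set 'rV[R]_d).
  apply: bounded_closed_compact; [exact: ref_simplex_bounded|exact: closed_ref_simplex].
have chb : {within ref_simplex d, continuous (h \o param b)}.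
  apply: within_continuous_comp ch; first exact: continuous_param.
  by move=> xi hxi; apply/simplex_paramP; exists xi.
have [C C0 hC] := compact_continuous_bounded cr chb.
apply: measurable_bounded_integrable.
- exact: measurable_ref_simplex.
- exact: ref_simplex_lty.
- exact: measurable_param.
exists C; split; first exact: num_real.
by move=> x Cx y hy; apply: le_trans (ltW Cx); exact: hC.
Qed.

Lemma Rintegral_param_reparam b b' (h : 'rV[R]_n -> R) :
  row_free (edges b) -> row_free (edges b') -> simplex b = simplex b' ->
  {within simplex b, continuous h} ->
  \int[leb d]_(xi in ref_simplex d) h (param b' xi) =
  \int[leb d]_(xi in ref_simplex d) h (param b xi).
Proof.
move=> fb fb' bb' ch; have [Q [eta [uQ Q1 _ PE refE]]] := simplex_reparam fb fb' bb'.
have mr := @measurable_ref_simplex R d.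
have := Rintegral_affineV eta uQ ((measurable_restrictT (h \o param b) mr).1 (measurable_param ch)).
rewrite Q1 mul1r /Rintegral => e.
rewrite [in RHS]integral_mkcond [in LHS]integral_mkcond.
move: e; rewrite /= => e.
transitivity (fine (\int[leb d]_x (((h \o param b) \_ (ref_simplex d)) (eta + x *m Q))%:E)).
  congr fine; apply: eq_integral => xi _; rewrite !patchE.
  have -> : (eta + xi *m Q \in ref_simplex d) = (xi \in ref_simplex d).
    by apply/idP/idP => /set_mem/refE; exact: mem_set.
  by case: ifP => //; rewrite PE.
rewrite e; congr fine; apply: eq_integral => xi _; rewrite !patchE.
by case: ifP.
Qed.

Lemma side_integral_reparam b b' (h : 'rV[R]_n -> R) :
  row_free (edges b) -> row_free (edges b') -> simplex b = simplex b' ->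
  {within simplex b, continuous h} -> side_integral b' h = side_integral b h.
Proof.
move=> fb fb' bb' ch; rewrite /side_integral (Rintegral_param_reparam fb fb' bb' ch).
congr (Num.sqrt _ * _); have [Q [eta [uQ Q1 -> _ _]]] := simplex_reparam fb fb' bb'.
rewrite trmx_mul mulmxA -(mulmxA Q) !det_mulmx det_tr mulrAC -expr2.
by rewrite -(real_normK (num_real (\det Q))) Q1 expr1n mul1r.
Qed.

Lemma eq_side_integral b (h h' : 'rV[R]_n -> R) : (forall x, simplex b x -> h x = h' x) ->
  side_integral b h = side_integral b h'.
Proof.
move=> hh'; rewrite /side_integral; congr (_ * _); apply: eq_Rintegral => xi /set_mem rxi.
by apply: hh'; apply/simplex_paramP; exists xi.
Qed.

Lemma side_integralB b (h h' : 'rV[R]_n -> R) :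
  {within simplex b, continuous h} -> {within simplex b, continuous h'} ->
  side_integral b (fun x => h x - h' x) = side_integral b h - side_integral b h'.
Proof.
move=> ch ch'; rewrite /side_integral -mulrBr; congr (_ * _).
apply: RintegralB; [exact: measurable_ref_simplex|exact: integrable_param..].
Qed.

Lemma side_integralZ b c (h : 'rV[R]_n -> R) : {within simplex b, continuous h} ->
  side_integral b (fun x => c * h x) = c * side_integral b h.
Proof.
move=> ch; rewrite /side_integral mulrCA; congr (_ * _).
rewrite RintegralZl//; [exact: measurable_ref_simplex|exact: integrable_param].
Qed.

Lemma surface_integralE b (h : 'rV[R]_n -> R) : {within simplex b, continuous h} ->
  surface_integral b (EFin \o h) = (side_integral b h)%:E.
Proof.
move=> ch; rewrite /surface_integral /side_integral EFinM; congr (_ * _)%E.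
rewrite /Rintegral fineK//; apply: integrable_fin_num; first exact: measurable_ref_simplex.
exact: integrable_param.
Qed.

Lemma continuous_affine (g : 'rV[R]_n) c : continuous (fun x => dotv g x + c).
Proof. by move=> x; apply/differentiable_continuous/differentiable_dotv. Qed.

(** The barycentre rule by symmetry: each cyclic rotation of the vertices leaves the integral
    unchanged, and the sum of the rotated integrands is zero at every point. *)
Lemma side_integral_affine b (g : 'rV[R]_n) c : row_free (edges b) ->
  dotv g (barycenter b) + c = 0 -> side_integral b (fun x => dotv g x + c) = 0.
Proof.
move=> fb gc0; pose v x := dotv g x + c.
have cv : continuous v by exact: continuous_affine.
have cvb : {within simplex b, continuous v} by exact: continuous_subspaceT.
have inj k : injective (fun i : 'I_d.+1 => i + k) by move=> i j /addIr.
have vE (b' : 'I_d.+1 -> 'rV[R]_n) xi :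
    v (param b' xi) = v (b' ord0) + \sum_i xi 0 i * (v (b' (lift ord0 i)) - v (b' ord0)).
  rewrite /v /param mulmx_edges dotvDr dotv_sumr addrAC; congr (_ + _).
  by apply: eq_bigr => i _; rewrite dotvZr dotvBr; congr (_ * _); lra.
have S0 : \sum_k v (b k) = 0.
  move: gc0; rewrite /barycenter dotvZr dotv_sumr => gc0.
  rewrite big_split/= sumr_const card_ord -[c *+ _]mulr_natl.
  have d0 : d.+1%:R != 0 :> R by rewrite pnatr_eq0.
  by apply: (mulfI (invr_neq0 d0)); rewrite mulrDr mulKf// mulr0.
have sumE xi : \sum_k v (param (b \o (fun i => i + k)) xi) = 0.
  under eq_bigr do rewrite vE.
  rewrite big_split/= exchange_big/=.
  have St (i : 'I_d.+1) : \sum_k v (b (i + k)) = 0.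
    by rewrite -[RHS]S0 [RHS](reindex_inj (addrI i)).
  rewrite St add0r big1// => i _; rewrite -mulr_sumr sumrB !St subrr mulr0//.
rewrite /side_integral; apply/eqP; rewrite mulf_eq0; apply/orP; right; apply/eqP.
have d0 : d.+1%:R != 0 :> R by rewrite pnatr_eq0.
apply: (mulfI d0); rewrite mulr0 mulr_natl -[X in _ *+ X]card_ord -sumr_const.
have step k : \int[leb d]_(xi in ref_simplex d) v (param (b \o (fun i => i + k)) xi) =
    \int[leb d]_(xi in ref_simplex d) v (param b xi).
  apply: Rintegral_param_reparam => //; first exact: affine_free_reindex.
  by rewrite simplex_reindex.
transitivity (\sum_(k < d.+1) \int[leb d]_(xi in ref_simplex d) v (param (b \o (fun i => i + k)) xi)).
  by apply: eq_bigr => k _; rewrite step.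
rewrite -Rintegral_sum.
- under eq_Rintegral do rewrite sumE.
  by rewrite /Rintegral integral0.
- exact: measurable_ref_simplex.
- move=> k; apply: integrable_param; exact: continuous_subspaceT.
Qed.

End side_integral.

(** * Normals of sides and the Gram determinant *)

Section side_normal.
Context (R : realType) (d : nat).
Local Notation n := d.+1.
Context (a : 'I_n.+1 -> 'rV[R]_n) (fa : affinely_independent a).
Local Notation leb := (lebesgueV R).

Lemma opp_side_free i : row_free (edges (opp_side a i)).
Proof.
apply/affine_freeP => t t0 ta j.
pose t' k := if unlift i k is Some l then t l else 0.
have t'l l : t' (lift i l) = t l by rewrite /t' liftK.
have t'i : t' i = 0 by rewrite /t' unlift_none.
rewrite -t'l; apply: (affine_freeP a).1 => //.
  by rewrite (bigD1_ord i)//= t'i add0r -[RHS]t0; apply: eq_bigr => l _.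
rewrite (bigD1_ord i)//= t'i scale0r add0r -[RHS]ta; apply: eq_bigr => l _.
by rewrite t'l.
Qed.

Lemma dotv_bgrad_frame i : dotv (bgrad a i) (a i - opp_side a i ord0) = 1.
Proof.
by rewrite dotv_bgradB /opp_side !bary_vertex// eqxx (negbTE (neq_lift _ _)) subr0.
Qed.

Lemma dotv_bgrad_side i j l : dotv (bgrad a i) (opp_side a i j - opp_side a i l) = 0.
Proof.
by rewrite dotv_bgradB /opp_side !bary_vertex// !(negbTE (neq_lift _ _)) subr0.
Qed.

Lemma dotvv_ge0 m (x : 'rV[R]_m) : 0 <= dotv x x.
Proof. by apply: sumr_ge0 => i _; rewrite -expr2 sqr_ge0. Qed.

Lemma dotvv_eq0 m (x : 'rV[R]_m) : (dotv x x == 0) = (x == 0).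
Proof.
apply/eqP/eqP => [x0|->]; last by rewrite dotv0r.
apply/rowP => i; rewrite mxE; apply/eqP; rewrite -sqrf_eq0 expr2.
by apply/eqP; apply: (psumr_eq0P _ x0) => // j _; rewrite -expr2 sqr_ge0.
Qed.

Lemma enorm_ge0 m (x : 'rV[R]_m) : 0 <= enorm x.
Proof. exact: sqrtr_ge0. Qed.

Lemma enorm_eq0 m (x : 'rV[R]_m) : (enorm x == 0) = (x == 0).
Proof. by rewrite sqrtr_eq0 -dotvv_eq0 eq_le dotvv_ge0 andbT. Qed.

Lemma enormZ m c (x : 'rV[R]_m) : enorm (c *: x) = `|c| * enorm x.
Proof.
by rewrite /enorm dotvZr dotvZl mulrA -expr2 sqrtrM ?sqr_ge0// sqrtr_sqr.
Qed.

Lemma bgrad_neq0 i : bgrad a i != 0.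
Proof.
apply/eqP => g0; have := dotv_bgrad_frame i; rewrite g0 dotvC dotv0r => /eqP.
by rewrite eq_sym oner_eq0.
Qed.

Lemma dotv_mx m (x y : 'rV[R]_m) : x *m y^T = (dotv x y)%:M.
Proof.
apply/matrixP => i j; rewrite !ord1 !mxE eqxx mulr1n; apply: eq_bigr => k _.
by rewrite mxE.
Qed.

Lemma edges_mul_bgrad i : edges (opp_side a i) *m (bgrad a i)^T = 0.
Proof.
apply/matrixP => j l; rewrite !ord1 !mxE.
rewrite -[RHS](dotv_bgrad_side i (lift ord0 j) ord0).
by rewrite dotvC; apply: eq_bigr => k _; rewrite !mxE.
Qed.

(** Let N be the frame with its transversal row replaced by g = [bgrad a i], which is orthogonal to
    the side. Then det(frame) det N = det(S S^T) and (det N)^2 = |g|^2 det(S S^T); eliminating det N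
    gives the identity. *)
Lemma sqrt_gram i :
  Num.sqrt (\det (edges (opp_side a i) *m (edges (opp_side a i))^T)) =
  `|\det (side_frame a i)| * enorm (bgrad a i).
Proof.
set S := edges _; set g := bgrad a i; pose w := a i - opp_side a i ord0.
pose N : 'M[R]_(1 + d, n) := col_mx g S.
have SG0 : \det (S *m S^T) != 0.
  rewrite -unitfE -unitmxE -row_free_unit -kermx_eq0; apply/rowV0P => u /sub_kermxP u0.
  apply: (row_free_inj (opp_side_free i)); rewrite /= mul0mx; apply/eqP.
  rewrite -dotvv_eq0; have := dotv_mx (u *m S) (u *m S).
  rewrite trmx_mul mulmxA -(mulmxA u) u0 mul0mx => /matrixP/(_ 0 0).
  by rewrite !mxE eqxx mulr1n => <-.
have Sg : S *m g^T = 0 by exact: edges_mul_bgrad.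
have gS : g *m S^T = 0 by rewrite -[LHS]trmxK trmx_mul trmxK Sg trmx0.
have e1 : \det (side_frame a i) * \det (N : 'M[R]_n) = \det (S *m S^T).
  rewrite -[\det N]det_tr -det_mulmx /side_frame /N.
  rewrite (@tr_col_mx _ 1 d n) (@mul_col_row _ 1 d n 1 d) Sg.
  rewrite (@det_ublock R 1 d) dotv_mx dotvC dotv_bgrad_frame det_scalar1 mul1r//.
have e2 : \det (N : 'M[R]_n) ^+ 2 = dotv g g * \det (S *m S^T).
  rewrite expr2 -{2}[\det N]det_tr -det_mulmx /N.
  rewrite (@tr_col_mx _ 1 d n) (@mul_col_row _ 1 d n 1 d) Sg.
  by rewrite (@det_ublock R 1 d) dotv_mx det_scalar1.
have e3 : \det (S *m S^T) = \det (side_frame a i) ^+ 2 * dotv g g.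
  apply: (mulIf SG0); rewrite -mulrA -e2 -exprMn e1 expr2//.
by rewrite [in LHS]e3 sqrtrM ?sqr_ge0// sqrtr_sqr.
Qed.

(** The i-th barycentric coordinate decreases towards the outside, hence the minus sign. *)
Definition unit_normal i := - (enorm (bgrad a i))^-1 *: bgrad a i.

Lemma green_normal (F : 'rV[R]_n -> R) (v : 'rV[R]_n) (g : 'rV[R]_n -> R) :
  {within simplex a, continuous F} ->
  (leb n).-integrable (polytope (bgrad a) (bcst a)) (EFin \o g) ->
  (forall m, \int[leb n]_(x in polytope (bgrad a) (bcst a))
     (F x * 'D_v (bump (bgrad a) (bcst a) m) x) =
   - \int[leb n]_(x in polytope (bgrad a) (bcst a)) (g x * bump (bgrad a) (bcst a) m x)) ->
  \int[leb n]_(x in polytope (bgrad a) (bcst a)) g x =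
  \sum_i dotv (unit_normal i) v * side_integral (opp_side a i) F.
Proof.
move=> cF ig gb; rewrite (green fa cF ig gb) -sumrN; apply: eq_bigr => i _.
have -> : side_integral (opp_side a i) F = `|\det (side_frame a i)| * enorm (bgrad a i) *
    \int[leb d]_(xi in ref_simplex d) F (side_point a i xi).
  by rewrite /side_integral sqrt_gram.
have e0 : enorm (bgrad a i) != 0 by rewrite enorm_eq0 bgrad_neq0.
by rewrite /unit_normal dotvZl; field.
Qed.

Lemma normal_bgrad i nu :
  (forall j l, dotv nu (opp_side a i j - opp_side a i l) = 0) ->
  nu = dotv nu (a i - opp_side a i ord0) *: bgrad a i.
Proof.
move=> nuS.
have uE : (side_frame a i)^T \in unitmx by rewrite unitmx_tr; exact: side_frame_unit fa i.
apply: (can_inj (mulmxK uE)); apply/rowP => j.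
have dE y : (y *m (side_frame a i)^T) 0 j = dotv y (row j (side_frame a i)).
  by rewrite mxE; apply: eq_bigr => k _; rewrite !mxE.
rewrite !dE; case: (unliftP ord0 j) => [l ->|->].
  by rewrite row_lift_side_frame nuS dotvZl dotv_bgrad_side mulr0.
by rewrite row0_side_frame dotvZl dotv_bgrad_frame mulr1.
Qed.

Lemma unit_normalP i nu : enorm nu = 1 ->
  (forall j l, dotv nu (opp_side a i j - opp_side a i l) = 0) ->
  dotv nu (a i - opp_side a i ord0) < 0 -> nu = unit_normal i.
Proof.
move=> nu1 nuS nuw; have nuE := normal_bgrad nuS; set c := dotv nu _ in nuw nuE.
rewrite nuE /unit_normal; congr (_ *: _).
have := nu1; rewrite nuE enormZ ltr0_norm// => h.
have e0 : enorm (bgrad a i) != 0 by rewrite enorm_eq0 bgrad_neq0.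
by apply: oppr_inj; rewrite opprK; apply: (mulIf e0); rewrite h mulVf.
Qed.

Lemma unit_normal_outer i : [/\ enorm (unit_normal i) = 1,
  forall j l, dotv (unit_normal i) (opp_side a i j - opp_side a i l) = 0 &
  dotv (unit_normal i) (a i - opp_side a i ord0) < 0].
Proof.
have g0 : 0 < enorm (bgrad a i) by rewrite lt_neqAle eq_sym enorm_eq0 bgrad_neq0 enorm_ge0.
split.
- by rewrite enormZ normrN normfV (gtr0_norm g0) mulVf ?gt_eqF.
- by move=> j l; rewrite dotvZl dotv_bgrad_side mulr0.
- by rewrite dotvZl dotv_bgrad_frame mulr1 oppr_lt0 invr_gt0.
Qed.

End side_normal.

Lemma outer_normalE (R : realType) d (M : mesh R d.+1) k i :
  affinely_independent (elt k) -> @outer_normal R d M k i = unit_normal (elt k) i.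
Proof.
move=> fa; rewrite /outer_normal; apply: xget_unique => [|nu []].
  exact: unit_normal_outer.
exact: unit_normalP.
Qed.

Section pairwise_cancellation.
Context (R : realType) (I : finType) (e : rel I) (b : I -> R).
Context (e_refl : reflexive e) (e_sym : symmetric e) (e_trans : transitive e).

(* Each b x is spread evenly over the other members of its class; the weights are
   symmetric, so that the contributions cancel pairwise. *)
Lemma sum_pairwise_opposite :
  (forall x y, x != y -> e x y -> b x + b y = 0) ->
  (forall x, (forall y, e x y -> y = x) -> b x = 0) -> \sum_x b x = 0.
Proof.
move=> bN b0; pose w x : R := (\sum_(y | e x y && (y != x)) 1)^-1.
have wE x y : e x y -> w x = w y.
  move=> xy; congr (_^-1); pose N z : R := \sum_(y | e z y) 1.
  have h z : \sum_(y | e z y && (y != z)) 1 = N z - 1.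
    by rewrite /N [in RHS](bigD1 z)//= addrAC subrr add0r.
  rewrite !h /N; congr (_ - _); apply: eq_bigl => z; apply/idP/idP => h'.
    by apply: e_trans h'; rewrite e_sym.
  exact: e_trans h'.
have bE x : b x = \sum_(y | e x y && (y != x)) w x * b x.
  rewrite (eq_bigr (fun y => 1 * (w x * b x))); last by move=> y _; rewrite mul1r.
  rewrite -big_distrl/= mulrA.
  have [h|h] := eqVneq (\sum_(y | e x y && (y != x)) (1 : R)) 0; last first.
    by rewrite /w mulfV// mul1r.
  rewrite h !mul0r; apply: b0 => y xy; apply/eqP; apply: contraT => yx.
  have : 0 < \sum_(y | e x y && (y != x)) (1 : R).
    by rewrite (bigD1 y) ?xy//=; apply: ltr_pwDl => //; apply: sumr_ge0.
  by rewrite h ltxx.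
have S1 : \sum_x b x = \sum_x \sum_y (if e x y && (y != x) then w x * b x else 0).
  by apply: eq_bigr => x _; rewrite [LHS]bE big_mkcond.
have S2 : \sum_x b x = \sum_x \sum_y (if e x y && (y != x) then w x * b y else 0).
  rewrite S1 exchange_big; apply: eq_bigr => x _; apply: eq_bigr => y _.
  rewrite e_sym eq_sym; case: ifP => // /andP[xy _]; by rewrite (wE x y).
have : \sum_x b x + \sum_x b x = 0.
  rewrite {1}S1 S2 -big_split big1// => x _; rewrite -big_split big1// => y _ /=.
  by case: ifP => [/andP[xy yx]|_]; rewrite ?addr0// -mulrDr bN ?mulr0// eq_sym.
lra.
Qed.

End pairwise_cancellation.

(** * Lipschitz domains *)

Section lipschitz_domain.
Context (R : realType) (n : nat) (Omega : set 'rV[R]_n).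

Lemma enorm_le (x : 'rV[R]_n) : enorm x <= n%:R * `|x|.
Proof.
rewrite -[leRHS]ger0_norm ?mulr_ge0// -sqrtr_sqr; apply: ler_wsqrtr.
apply: (@le_trans _ _ (\sum_(i < n) `|x| ^+ 2)).
  apply: ler_sum => i _; rewrite -expr2 -real_normK ?num_real//.
  by apply: lerXn2r; rewrite ?nnegrE//; exact: ler_coord_norm.
rewrite sumr_const card_ord exprMn -[leLHS]mulr_natl; apply: ler_wpM2r; first exact: sqr_ge0.
by rewrite -natrX ler_nat; case: (n) => // m; rewrite expnS leq_pmulr// expn_gt0.
Qed.

Lemma lipschitz_continuous (gam : 'rV[R]_n -> R) L :
  (forall y z, `|gam y - gam z| <= L * enorm (y - z)) -> continuous gam.
Proof.
move=> gL x; apply/(@cvgrPdist_lt _ _ _ (nbhs x)) => e e0.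
have C0 : 0 < (`|L| + 1) * (n%:R + 1) :> R by rewrite mulr_gt0// ltr_wpDl.
have de0 : 0 < e / ((`|L| + 1) * (n%:R + 1)) by rewrite divr_gt0.
apply: (@filterS _ (nbhs x) _ _ _ _ (nbhsx_ballx x _ de0)) => y.
rewrite -ball_normE /= ltr_pdivlMr// => xy; apply: le_lt_trans (gL _ _) _.
apply: le_lt_trans xy.
apply: (@le_trans _ _ ((`|L| + 1) * enorm (x - y))).
  by apply: ler_wpM2r; [exact: sqrtr_ge0|rewrite (le_trans (ler_norm _))// lerDl].
rewrite mulrCA; apply: ler_wpM2l; first by rewrite addr_ge0.
by apply: le_trans (enorm_le _) _; rewrite mulrC; apply: ler_wpM2l => //; rewrite lerDl.
Qed.

(** Moving from x against nu keeps gam and lowers the height, so the new point is strictly below the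
    graph. By continuity a whole neighbourhood of it misses Omega. *)
Lemma lipschitz_boundary_exterior x (V : set 'rV[R]_n) :
  open Omega -> lipschitz_boundary Omega -> boundary Omega x -> nbhs x V ->
  exists2 y, V y & ~ closure Omega y.
Proof.
move=> oO lO bx Vx; have [nu [gam [L [nu1 gnu gL gA]]]] := lO _ bx.
have [_ nOx] := bx.
have {}nOx : dotv x nu <= gam x.
  rewrite leNgt; apply/negP => h; apply: nOx.
  by rewrite /interior; apply: open_nbhs_nbhs; split=> //; apply/(nbhs_singleton gA).
have cg := lipschitz_continuous gL.
pose W := [set y | V y /\ (Omega y <-> gam y < dotv y nu)].
have Wx : nbhs x W by exact: filterI.
have : \forall t \near (0 : R), interior W (x + t *: nu).
  have ct : x + t *: nu @[t --> (0 : R)] --> x.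
    rewrite -[X in _ --> X]addr0 -(scale0r nu).
    by apply: cvgD; [exact: cvg_cst|apply: cvgZr_tmp; exact: cvg_id].
  by apply: ct; apply: nbhs_interior.
move=> /nbhs_ballP[e /= e0 eW].
pose t := - (e / 2); pose y := x + t *: nu.
have Wy : interior W y.
  by apply: eW; rewrite /ball/= sub0r normrN /t normrN gtr0_norm ?divr_gt0// ltr_pdivrMr//; lra.
exists y; first by have [] := nbhs_singleton Wy.
have gy : dotv y nu < gam y.
  apply: lt_le_trans (_ : gam x <= _); last by rewrite gnu.
  apply: lt_le_trans nOx; rewrite /y dotvC dotvDr dotvZr dotvC.
  have -> : dotv nu nu = 1.
    by rewrite -[dotv nu nu]sqr_sqrtr ?dotvv_ge0// -/(enorm nu) nu1 expr1n.
  by rewrite mulr1 gtrDl /t oppr_lt0 divr_gt0.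
have : nbhs y [set z | dotv z nu < gam z].
  have -> : [set z | dotv z nu < gam z] = [set z | 0 < gam z - dotv nu z].
    by apply/seteqP; split => z /=; rewrite subr_gt0 dotvC.
  have : 0 < gam y - dotv nu y by rewrite subr_gt0 dotvC.
  apply: (@cvgr_gt _ _ (nbhs y)).
  by apply: cvgB; [exact: cg|exact: continuous_dotv].
move=> gN /(_ _ (filterI gN Wy))[z [Oz [/= gz Wz]]].
have [_ [/(_ Oz) + _]] := Wz.
by rewrite ltNge (ltW gz).
Qed.

(** This rules out slits. Applied to the open elements, it places them inside Omega, so that their
    bumps are admissible test functions. *)
Lemma open_closure_lipschitz (V : set 'rV[R]_n) : open Omega -> lipschitz_boundary Omega ->
  open V -> V `<=` closure Omega -> V `<=` Omega.
Proof.
move=> oO lO oV VO x Vx; apply: contrapT => nOx.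
have bx : boundary Omega x.
  by split; [exact: VO|move=> /nbhs_singleton].
have [y Vy nOy] := lipschitz_boundary_exterior oO lO bx (open_nbhs_nbhs (conj oV Vx)).
exact/nOy/VO.
Qed.

End lipschitz_domain.

(** * Topology of the triangulation *)

Section mesh_topology.
Context (R : realType) (d : nat).
Local Notation n := d.+1.
Local Notation leb := (lebesgueV R).
Context (kappa : R) (Omega : set 'rV[R]_n) (M : mesh R n).
Context (HOmega : polyhedral_lipschitz_domain Omega) (HM : triangulation kappa Omega M).
Local Notation E := 'I_(ne M).
Implicit Types (k l : E) (i j : 'I_n.+1) (x : 'rV[R]_n).

Definition cell k : set 'rV[R]_n := polytope (bgrad (elt k)) (bcst (elt k)).

Let fa k : affinely_independent (elt k). Proof. by have [] := HM. Qed.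
Let clO : closure Omega = \bigcup_(k in [set: E]) tri k. Proof. by have [] := HM. Qed.
Let oO : open Omega. Proof. by have [] := HOmega. Qed.
Let cf : @conforming R d M. Proof. by have [] := HM. Qed.

Lemma elt_inj k : injective (elt k).
Proof.
move=> i j ij; apply/eqP; apply: contraT => nij.
have := bary_vertex (fa k) i i; rewrite ij bary_vertex// eqxx (negbTE nij) => /eqP.
by rewrite eq_sym oner_eq0.
Qed.

Lemma cell_tri k : cell k `<=` tri k. Proof. exact: polytope_simplex. Qed.

Lemma tri_closed k : closed (tri k). Proof. exact: simplex_closed. Qed.

Lemma open_cell k : open (cell k). Proof. exact: open_polytope. Qed.

Lemma measurable_cell k : measurable (cell k). Proof. exact: measurable_polytope. Qed.

(** By conformity the intersection is the face spanned by the common vertices. A point with all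
    barycentric coordinates positive forces every vertex of k to be one of l; by counting, the
    vertex sets coincide, which distinct elements exclude. *)
Lemma cell_tri_disjoint k l x : cell k x -> tri l x -> l = k.
Proof.
move=> kx lx; apply/eqP; apply: contraT => lk.
have [nr] := cf lk; rewrite setIC => e.
have kl : k != l by rewrite eq_sym.
have {}[nr' {}e] := cf kl.
have : (tri k `&` tri l) x by split => //; exact: cell_tri.
rewrite e => /faceP -/(_ (fa k))[_ h].
have rk i : range (elt l) (elt k i).
  by apply: contrapT => /h h0; have := kx i; rewrite -/(bary _ _ _) h0 ltxx.
have [s sE] : exists s : 'I_n.+1 -> 'I_n.+1, forall i, elt l (s i) = elt k i.
  have : forall i, exists j, elt l j = elt k i by move=> i; have [j _ <-] := rk i; exists j.
  by move=> h'; exists (fun i => projT1 (cid (h' i))) => i; exact: projT2 (cid (h' i)).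
have si : injective s by move=> i j ij; apply: (@elt_inj k); rewrite -!sE ij.
exfalso; apply: nr'; apply/seteqP; split => [_ [i _ <-]|_ [j _ <-]]; first exact: rk.
by exists (invF si j) => //; rewrite -sE f_invF.
Qed.

Lemma cell_sub k : cell k `<=` Omega.
Proof.
have [_ _ _ _ [lO _]] := HOmega.
apply: (open_closure_lipschitz oO lO (@open_cell k)).
by rewrite clO => x kx; exists k => //; exact: cell_tri.
Qed.

Lemma sub_cells x : Omega x -> exists2 k, tri k x & cell k x \/ exists i, bary (elt k) x i = 0.
Proof.
move=> Ox; have : closure Omega x by exact: subset_closure.
rewrite clO => -[k _ kx]; exists k => //; have [h|h] := pselect (exists i, bary (elt k) x i = 0).
  by right.
left => i; have /(simplexP (fa k))/(_ i) := kx; rewrite le_eqVlt => /orP[/eqP e|//].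
by exfalso; apply: h; exists i.
Qed.

Lemma measurable_Omega : measurable Omega. Proof. exact: open_measurable_rV. Qed.

(** What the open elements miss lies on the finitely many hyperplanes carrying sides. *)
Lemma negligible_cells : (leb n).-negligible (Omega `\` \bigcup_k cell k).
Proof.
pose H (q : E * 'I_n.+1) := [set x | dotv (bgrad (elt q.1) q.2) x = - bcst (elt q.1) q.2].
have mH q : measurable (H q).
  apply: closed_measurable_rV; rewrite /H.
  have -> : [set x | dotv (bgrad (elt q.1) q.2) x = - bcst (elt q.1) q.2] =
     dotv (bgrad (elt q.1) q.2) @^-1` [set - bcst (elt q.1) q.2] by [].
  apply: closed_comp; last exact: closed_eq.
  by move=> x _; exact: continuous_dotv.
have nH q : (leb n).-negligible (H q).
  exists (H q); split => //; apply: lebesgueV_hyperplane.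
  exact: (bgrad_neq0 (fa q.1)).
apply: (@negligibleS _ _ _ _ (\big[setU/set0]_q H q)); last first.
  by elim/big_ind: _ => [|A B|q _]; [exact: negligible_set0|exact: negligibleU|exact: nH].
move=> x [Ox nx]; rewrite -bigcup_seq; have [k kx [cx|[i xi]]] := sub_cells Ox.
  by exfalso; apply: nx; exists k.
exists (k, i) => /=; first by rewrite mem_index_enum.
by move/eqP: xi; rewrite /bary addr_eq0 => /eqP.
Qed.

Lemma sideP k i x : simplex (side k i) x <-> tri k x /\ bary (elt k) x i = 0.
Proof.
split=> [/simplex_paramP[xi rxi ->]|[/(simplexP (fa k)) x0 xi]].
  split; first exact: side_point_simplex.
  by have [] := bary_side_point (fa k) i xi.
exists (fun j : 'I_n => bary (elt k) x (lift i j)); split => //.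
- by move=> j /(_ I).
- by rewrite -[RHS](bary_sum1 (fa k) x) [RHS](bigD1_ord i)//= xi add0r.
- by rewrite [LHS](bary_comb (fa k) x) [LHS](bigD1_ord i)//= xi scale0r add0r.
Qed.

Lemma bary_barycenter_side k i m :
  bary (elt k) (barycenter (side k i)) m = if m == i then 0 else n%:R^-1.
Proof.
have -> : barycenter (side k i) =
    \sum_m (if m == i then 0 else n%:R^-1) *: elt k m.
  rewrite [RHS](bigD1_ord i)//= eqxx scale0r add0r /barycenter scaler_sumr.
  by apply: eq_bigr => j _; rewrite eq_sym (negbTE (neq_lift _ _)).
rewrite (bary_unique (fa k))//.
rewrite (bigD1_ord i)//= eqxx add0r.
under eq_bigr => j _ do rewrite eq_sym (negbTE (neq_lift _ _)).
by rewrite sumr_const card_ord -[LHS]mulr_natl mulfV ?pnatr_eq0.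
Qed.

Lemma side_opposite_inj l j j' : simplex (side l j) = simplex (side l j') -> j = j'.
Proof.
move=> e; apply/eqP; apply: contraT => jj'.
have /sideP[_ ] : simplex (side l j) (barycenter (side l j')).
  rewrite e; apply/sideP; split; last by rewrite bary_barycenter_side eqxx.
  apply/(simplexP (fa l)) => m; rewrite bary_barycenter_side; case: ifP => // _.
by rewrite bary_barycenter_side (negbTE jj') => /eqP; rewrite invr_eq0 pnatr_eq0.
Qed.

(** A vertex of the side lies in both elements, so by conformity it is a vertex of l. It is not the
    j-th one, whose j-th coordinate is 1 while that coordinate vanishes on the side. *)
Lemma shared_vertices k l i j : k != l -> simplex (side k i) = simplex (side l j) ->
  exists2 s : 'I_n -> 'I_n, injective s & forall m, side k i m = side l j (s m).
Proof.
move=> kl e; have h m : exists m', side l j m' = side k i m.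
  have v1 : simplex (side k i) (side k i m) by exact: vertex_simplex.
  have /sideP[tk _] := v1; have := v1; rewrite e => /sideP[tl bl].
  have [_ cfe] := cf kl; have : (tri k `&` tri l) (side k i m) by [].
  rewrite cfe => /faceP -/(_ (fa k))[_ h0].
  have [j' _ j'E] : range (elt l) (side k i m).
    apply: contrapT => /h0; rewrite /side bary_vertex// eqxx => /eqP.
    by rewrite oner_eq0.
  case: (unliftP j j') => [m' j'm|j'j]; first by exists m'; rewrite /side -j'm j'E.
  move: bl; rewrite -j'E j'j bary_vertex// eqxx => /eqP; by rewrite oner_eq0.
exists (fun m => projT1 (cid (h m))) => [m m' mm'|m].
  apply: (@lift_inj _ i); apply: (@elt_inj k).
  by rewrite -[elt k (lift i m)]/(side k i m) -(projT2 (cid (h m))) mm' (projT2 (cid (h m'))).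
by rewrite (projT2 (cid (h m))).
Qed.

Lemma near_bary_gt0 k x v (P : set 'I_n.+1) : (forall m, P m -> 0 < bary (elt k) x m) ->
  \forall t \near (0 : R), forall m, P m -> 0 < bary (elt k) (x + t *: v) m.
Proof.
move=> h.
apply: (@filter_forall _ _ (fun m (t : R) => P m -> 0 < bary (elt k) (x + t *: v) m) (nbhs (0 : R))) => m.
have [Pm|nPm] := pselect (P m); last first.
  by apply: nearW => t /nPm.
suff : \forall t \near (0 : R), 0 < bary (elt k) (x + t *: v) m by apply: filterS => t.
have cb : bary (elt k) x m + t * dotv (bgrad (elt k) m) v @[t --> (0 : R)] -->
    bary (elt k) x m + 0 * dotv (bgrad (elt k) m) v.
  by apply: cvgD; [exact: cvg_cst|apply: cvgM; [exact: cvg_id|exact: cvg_cst]].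
apply: (@cvgr_gt _ _ (nbhs (0 : R)) _ _ (bary (elt k) x m)); last exact: h.
by move: cb; rewrite mul0r addr0; under eq_fun do rewrite -dotvZr -baryD.
Qed.

Lemma near0_gt0 (P : R -> Prop) : (\forall t \near (0 : R), P t) -> exists2 t, 0 < t & P t.
Proof.
move=> /nbhs_ballP[e /= e0 eP]; exists (e / 2); first by rewrite divr_gt0.
by apply: eP; rewrite /ball/= sub0r normrN gtr0_norm ?divr_gt0// ltr_pdivrMr//; lra.
Qed.

(** The two unit normals of the shared side agree up to sign. If they were equal, a small step from
    the common barycentre against them would lead into the interior of k and into l at once. *)
Lemma shared_normal k l i j : k != l -> simplex (side k i) = simplex (side l j) ->
  unit_normal (elt l) j = - unit_normal (elt k) i.
Proof.
move=> kl e; have [s si sE] := shared_vertices kl e.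
have [nl1 nlS nlw] := unit_normal_outer (fa l) j.
have [nk1 nkS nkw] := unit_normal_outer (fa k) i.
set nl := unit_normal (elt l) j in nl1 nlS nlw *.
have nlS' m m' : dotv nl (opp_side (elt k) i m - opp_side (elt k) i m') = 0.
  by rewrite -[opp_side _ _ m]/(side k i m) -[opp_side _ _ m']/(side k i m') !sE nlS.
have := normal_bgrad (fa k) nlS'; set q := dotv nl _ => nlE.
(* q pairs the normal of l with the direction from the side to the opposite vertex of k; its sign
   tells whether this normal points into k or out of it. *)
have [q0|q0|q0] := ltgtP q 0; last first.
- by have := nl1; rewrite nlE q0 scale0r /enorm dotv0r sqrtr0 => /eqP; rewrite eq_sym oner_eq0.
- rewrite -[LHS]opprK; congr (- _); apply: unit_normalP => //.
  + by rewrite -scaleN1r enormZ normrN1 mul1r.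
  + by move=> m m'; rewrite dotvC dotvNr dotvC nlS' oppr0.
  + by rewrite dotvC dotvNr dotvC oppr_lt0.
exfalso.
have nkl : nl = unit_normal (elt k) i by exact: unit_normalP.
have cc : barycenter (side k i) = barycenter (side l j).
  rewrite /barycenter; congr (_ *: _); rewrite [RHS](reindex_inj si).
  by apply: eq_bigr => m _.
have pos k' i' m : ([set m' | m' != i'] : set 'I_n.+1) m -> 0 < bary (elt k') (barycenter (side k' i')) m.
  by move=> /= mi; rewrite bary_barycenter_side (negbTE mi) invr_gt0.
have nposn k' i' : dotv (bgrad (elt k') i') (unit_normal (elt k') i') < 0.
  rewrite /unit_normal dotvZr mulNr oppr_lt0 mulr_gt0// ?invr_gt0.
    by rewrite lt_neqAle eq_sym enorm_eq0 bgrad_neq0// enorm_ge0.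
  by rewrite lt_neqAle eq_sym dotvv_eq0 bgrad_neq0// dotvv_ge0.
have nk := near_bary_gt0 (- nl) (@pos k i).
have := near_bary_gt0 (- nl) (@pos l j); rewrite -cc => nl'.
have [t t0 [tk tl]] := near0_gt0 (filterI nk nl').
move/eqP: kl; apply; apply: esym.
apply: (@cell_tri_disjoint k l (barycenter (side k i) + t *: - nl)).
  move=> m; have [->|mi] := eqVneq m i; last exact: tk.
  rewrite -[_ + _]/(bary _ _ i) baryD bary_barycenter_side eqxx add0r dotvZr.
  by rewrite dotvNr mulr_gt0// oppr_gt0 nkl.
apply/(simplexP (fa l)) => m; have [->|mj] := eqVneq m j; last by apply/ltW; exact: tl.
rewrite baryD cc bary_barycenter_side eqxx add0r dotvZr.
by rewrite dotvNr mulr_ge0// ?(ltW t0)// oppr_ge0 ltW.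
Qed.

(** A point of the side inside Omega can be moved towards the barycentre to a point x of the
    relative interior, still in Omega. Just across x lie points of other elements, so x belongs to
    one of these. Conformity then makes all vertices of the side vertices of that neighbour. *)
Lemma boundary_or_shared k i : simplex (side k i) `<=` boundary Omega \/
  exists l j, k != l /\ simplex (side k i) = simplex (side l j).
Proof.
have [|/existsNP[x0 /not_implyP[sx0 nbx0]]] := pselect (simplex (side k i) `<=` boundary Omega).
  by left.
right; have /sideP[tx0 bx0] := sx0.
have Ox0 : Omega x0.
  apply: contrapT => nO; apply: nbx0; split; last by move=> /nbhs_singleton.
  by rewrite clO; exists k.
have nearO x v : Omega x -> \forall t \near (0 : R), Omega (x + t *: v).
  move=> Ox; have ct : x + t *: v @[t --> (0 : R)] --> x.
    rewrite -[X in _ --> X]addr0 -(scale0r v).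
    by apply: cvgD; [exact: cvg_cst|apply: cvgZr_tmp; exact: cvg_id].
  by apply: ct; apply: open_nbhs_nbhs.
have near1 : \forall t \near (0 : R), t < 1.
  by apply: (@cvgr_lt _ _ (nbhs (0 : R)) _ id 0) => //; exact: cvg_id.
set c := barycenter (side k i).
have [t t0 [Ox' t1]] := near0_gt0 (filterI (nearO x0 (c - x0) Ox0) near1).
set x := x0 + t *: (c - x0) in Ox'.
have xE m : bary (elt k) x m = (1 - t) * bary (elt k) x0 m + t * bary (elt k) c m.
  by rewrite baryD dotvZr dotv_bgradB; ring.
have xi : bary (elt k) x i = 0 by rewrite xE bx0 bary_barycenter_side eqxx; ring.
have xm m : m != i -> 0 < bary (elt k) x m.
  move=> mi; rewrite xE ltr_wpDl//.
    by rewrite mulr_ge0 ?subr_ge0 ?(ltW t1)//; exact: (simplexP (fa k) x0).1.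
  by rewrite bary_barycenter_side (negbTE mi) mulr_gt0// invr_gt0.
(* Otherwise, the other elements forming a closed set, a small step from x away from the vertex
   [elt k i] stays in Omega, leaves k and avoids all other elements. *)
have [l lk tlx] : exists2 l, l != k & tri l x.
  have cC : closed (\bigcup_(l in [set l | l != k]) tri l).
    by apply: closed_bigcup => [|l _]; [exact: finite_finset|exact: tri_closed].
  apply: contrapT => nex.
  have nCx : (~` \bigcup_(l in [set l | l != k]) tri l) x.
    by move=> [l /= lk lx]; apply: nex; exists l.
  have oC := closed_openC cC.
  have nC : \forall t \near (0 : R), (~` \bigcup_(l in [set l | l != k]) tri l) (x + t *: (x - elt k i)).
    have ct : x + t *: (x - elt k i) @[t --> (0 : R)] --> x.
      rewrite -[X in _ --> X]addr0 -(scale0r (x - elt k i)).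
      by apply: cvgD; [exact: cvg_cst|apply: cvgZr_tmp; exact: cvg_id].
    by apply: ct; apply: open_nbhs_nbhs.
  have [r r0 [Or nCr]] := near0_gt0 (filterI (nearO x (x - elt k i) Ox') nC).
  have : closure Omega (x + r *: (x - elt k i)) by exact: subset_closure.
  rewrite clO => -[l _ lr]; apply: nCr; exists l => //=; apply/eqP => lk; move: lr.
  rewrite lk => /(simplexP (fa k))/(_ i).
  by rewrite baryD dotvZr dotv_bgradB xi bary_vertex// eqxx sub0r mulrN1 add0r oppr_ge0 leNgt r0.
have kl : k != l by rewrite eq_sym.
have tkx : tri k x.
  apply/(simplexP (fa k)) => m; have [->|mi] := eqVneq m i; first by rewrite xi.
  exact/ltW/xm.
have [_ cfe] := cf kl; have : (tri k `&` tri l) x by [].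
rewrite cfe => /faceP -/(_ (fa k))[_ h0].
have h m : exists j, elt l j = side k i m.
  have [j _ jE] : range (elt l) (elt k (lift i m)).
    apply: contrapT => /h0 e; have := xm (lift i m); rewrite e ltxx.
    by rewrite eq_sym neq_lift => /(_ isT).
  by exists j.
pose s m := projT1 (cid (h m)).
have sE m : elt l (s m) = side k i m by exact: projT2 (cid (h m)).
have si : injective s.
  by move=> m m' mm'; apply: (@lift_inj _ i); apply: (@elt_inj k); rewrite -![elt k _]/(side k i _) -!sE mm'.
(* The vertices of the side occupy at most n of the n+1 positions in l; a free position is the index
   of the shared side there. *)
have [j js] : exists j, forall m, s m != j.
  apply: contrapT => nj; have : (#|'I_n.+1| <= #|codom s|)%N.
    apply: subset_leq_card; apply/fintype.subsetP => j _; apply: contraT => js.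
    exfalso; apply: nj; exists j => m; apply: contra js => /eqP <-; exact: codom_f.
  by rewrite card_codom// !card_ord ltnn.
exists l, j; split => //.
have h' m : exists m', lift j m' = s m.
  by case: (unliftP j (s m)) => [m' ->|/eqP]; [exists m'|rewrite (negbTE (js m))].
pose s' m := projT1 (cid (h' m)).
have s'E m : lift j (s' m) = s m by exact: projT2 (cid (h' m)).
have s'i : injective s' by move=> m m' mm'; apply: si; rewrite -!s'E mm'.
rewrite -(simplex_reindex (side l j) s'i); congr simplex; apply/funext => m /=.
by rewrite -sE /side s'E.
Qed.

End mesh_topology.

Lemma bounded_integrable_rV n (R : realType) (A : set 'rV[R]_n) (h : 'rV[R]_n -> R) :
  measurable A -> bounded_set A -> measurable_fun A h ->
  (exists C, forall x, A x -> `|h x| <= C) -> (lebesgueV R n).-integrable A (EFin \o h).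
Proof.
move=> mA bA mh [C hC]; apply: measurable_bounded_integrable => //.
  exact: lebesgueV_bounded.
exists C; split; first exact: num_real.
by move=> M CM x Ax; apply: le_trans (ltW CM); exact: hC.
Qed.

(** * Piecewise functions and their integrals *)

Section piecewise_functions.
Context (R : realType) (d : nat).
Local Notation n := d.+1.
Local Notation leb := (lebesgueV R n).
Context (kappa : R) (Omega : set 'rV[R]_n) (M : mesh R n).
Context (HOmega : polyhedral_lipschitz_domain Omega) (HM : triangulation kappa Omega M).
Local Notation E := 'I_(ne M).
Implicit Types (k l : E) (x : 'rV[R]_n).

Let fa k : affinely_independent (elt k). Proof. by have [] := HM. Qed.
Let mO : measurable Omega. Proof. exact: measurable_Omega HOmega. Qed.
Let bO : bounded_set Omega. Proof. by have [] := HOmega. Qed.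

Lemma piecewise_cell (A : Type) (a0 : A) (F : E -> 'rV[R]_n -> A) k x :
  cell k x -> piecewise a0 F x = F k x.
Proof.
move=> kx; rewrite /piecewise; case: pickP => [l /asboolP lx|/(_ k)/asboolP []].
  by rewrite (cell_tri_disjoint HM kx lx).
exact: cell_tri HM _ _ kx.
Qed.

Lemma piecewise_map (A B : Type) (f : A -> B) (a0 : A) (F : E -> 'rV[R]_n -> A) x :
  f (piecewise a0 F x) = piecewise (f a0) (fun k y => f (F k y)) x.
Proof. by rewrite /piecewise; case: pickP. Qed.

Lemma measurable_piecewise d' (T : measurableType d') (a0 : T) (F : E -> 'rV[R]_n -> T) :
  (forall k, measurable_fun setT (F k)) -> measurable_fun setT (piecewise a0 F).
Proof.
move=> mF.
(* The search by [pick] is unfolded into nested tests of membership in closed sets. *)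
have -> : piecewise a0 F = fun x =>
    foldr (fun k acc => if `[< tri k x >] then F k x else acc) a0 (Finite.enum E).
  apply/funext => x; rewrite /piecewise /pick /enum_mem.
  elim: (Finite.enum E) => //= k s <-.
  by rewrite /in_mem /=; case: ifP.
elim: (Finite.enum E) => [|k s IHs] /=; first exact: measurable_cst.
apply: measurable_fun_ifT => //.
apply: (measurable_fun_bool true); rewrite setTI.
rewrite (_ : _ @^-1` _ = tri k); last first.
  by apply/seteqP; split => x /=; [move/asboolP|move=> kx; apply/asboolP].
by apply: closed_measurable_rV; exact: tri_closed HM _.
Qed.

Lemma trivIset_cell : trivIset setT (@cell R d M).
Proof.
apply/trivIsetP => k l _ _; apply: contraNeq => /set0P[x [kx lx]].
by rewrite (cell_tri_disjoint HM kx (cell_tri HM lx)).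
Qed.

Lemma Rintegral_cells (f : 'rV[R]_n -> R) : leb.-integrable Omega (EFin \o f) ->
  \int[leb]_(x in Omega) f x = \sum_(k : E) \int[leb]_(x in cell k) f x.
Proof.
move=> fi; have mf := measurable_int _ fi.
have cE : \big[setU/set0]_(k : E) cell k = \bigcup_(k in [set: E]) cell k.
  rewrite -bigcup_seq; apply: eq_bigcup => //.
  by split => k //= _; rewrite mem_index_enum.
have sO : \bigcup_(k in [set: E]) cell k `<=` Omega by move=> x [k _ kx]; exact: (cell_sub HOmega HM kx).
have mU : measurable (\bigcup_k @cell R d M k).
  by rewrite -cE; apply: bigsetU_measurable => k _; exact: measurable_cell.
rewrite /Rintegral.
rewrite -(integral_negligible_setD mU mO sO (negligible_cells HM) mf).
rewrite -cE (integral_bigsetU_EFin leb (@measurable_cell R d M)).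
- rewrite -sum_fine// => k _; apply: integrable_fin_num; first exact: measurable_cell.
  apply: integrableS fi => //; first exact: measurable_cell.
  by move=> x kx; exact: (cell_sub HOmega HM kx).
- exact: index_enum_uniq.
- apply: sub_trivIset trivIset_cell; exact: subsetT.
- by rewrite cE; apply: measurable_funS mf.
Qed.

(** The class containing all discrete quantities: it is stable under algebraic operations, and its
    members are integrable because Omega has finite measure. *)
Definition bounded_measurable (h : 'rV[R]_n -> R) :=
  measurable_fun setT h /\ exists C, forall x, Omega x -> `|h x| <= C.

Lemma bounded_measurable_integrable h : bounded_measurable h ->
  leb.-integrable Omega (EFin \o h).
Proof.
move=> [mh hC]; apply: bounded_integrable_rV => //.
exact: measurable_funS mh.
Qed.

Lemma bounded_measurable_cst c : bounded_measurable (cst c).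
Proof. by split; [exact: measurable_cst|exists `|c|]. Qed.

Lemma bounded_measurableD h1 h2 : bounded_measurable h1 -> bounded_measurable h2 ->
  bounded_measurable (fun x => h1 x + h2 x).
Proof.
move=> [m1 [C1 b1]] [m2 [C2 b2]]; split; first exact: measurable_funD.
exists (C1 + C2) => x Ox; apply: le_trans (ler_normD _ _) _.
by apply: lerD; [exact: b1|exact: b2].
Qed.

Lemma bounded_measurableM h1 h2 : bounded_measurable h1 -> bounded_measurable h2 ->
  bounded_measurable (fun x => h1 x * h2 x).
Proof.
move=> [m1 [C1 b1]] [m2 [C2 b2]]; split; first exact: measurable_funM.
exists (C1 * C2) => x Ox; rewrite normrM.
by apply: ler_pM => //; [exact: b1|exact: b2].
Qed.

Lemma bounded_measurableN h : bounded_measurable h -> bounded_measurable (fun x => - h x).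
Proof.
move=> [m1 [C1 b1]]; split; first exact: measurable_funN.
by exists C1 => x Ox; rewrite normrN; exact: b1.
Qed.

Lemma bounded_measurable_affine g c : bounded_measurable (fun x => dotv g x + c).
Proof.
split; first by apply: continuous_measurable_rV; exact: continuous_affine.
have [B [_ hB]] := bO.
have {}hB x : Omega x -> `|x| <= B + 1 by apply: hB; rewrite ltrDl.
exists (\sum_i `|g 0 i| * (B + 1) + `|c|) => x Ox.
apply: le_trans (ler_normD _ _) _; rewrite lerD2r.
apply: le_trans (ler_norm_sum _ _ _) _; apply: ler_sum => i _.
by rewrite normrM ler_wpM2l// (le_trans (ler_coord_norm _ _))// hB.
Qed.

Lemma bounded_measurable_piecewise (F : E -> 'rV[R]_n -> R) a0 :
  (forall k, bounded_measurable (F k)) -> bounded_measurable (piecewise a0 F).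
Proof.
move=> bF; split; first by apply: measurable_piecewise => k; have [] := bF k.
have [C CP] : exists C : E -> R, forall k x, Omega x -> `|F k x| <= C k.
  exists (fun k => projT1 (cid (bF k).2)) => k; exact: (projT2 (cid (bF k).2)).
exists (`|a0| + \sum_k `|C k|) => x Ox; rewrite /piecewise; case: pickP => [k _|_].
  apply: le_trans (CP k x Ox) _; rewrite (bigD1 k)//= addrCA.
  by rewrite (le_trans (ler_norm _))// lerDl addr_ge0// sumr_ge0.
by rewrite lerDl sumr_ge0.
Qed.

Lemma bounded_measurable_sum (I : Type) (r : seq I) (F : I -> 'rV[R]_n -> R) :
  (forall i, bounded_measurable (F i)) ->
  bounded_measurable (fun x => \sum_(i <- r) F i x).
Proof.
move=> bF; elim: r => [|i r IHr].
  by under eq_fun do rewrite big_nil; exact: bounded_measurable_cst.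
by under eq_fun do rewrite big_cons; exact: bounded_measurableD.
Qed.

Lemma bounded_measurable_dotv (G H : 'rV[R]_n -> 'rV[R]_n) :
  (forall i, bounded_measurable (fun x => G x 0 i)) ->
  (forall i, bounded_measurable (fun x => H x 0 i)) ->
  bounded_measurable (fun x => dotv (G x) (H x)).
Proof. by move=> bG bH; apply: bounded_measurable_sum => i; exact: bounded_measurableM. Qed.

Lemma bounded_measurable_pw0 (c : L0 M) : bounded_measurable (pw0 c).
Proof. by apply: bounded_measurable_piecewise => k; exact: bounded_measurable_cst. Qed.

Lemma bounded_measurable_pw1 (v : L1 M) : bounded_measurable (pw1 v).
Proof. by apply: bounded_measurable_piecewise => k; exact: bounded_measurable_affine. Qed.

Lemma bounded_measurable_pw0V (c : L0V M) i : bounded_measurable (fun x => pw0V c x 0 i).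
Proof.
under eq_fun do rewrite /pw0V (piecewise_map (fun y : 'rV[R]_n => y 0 i)).
by apply: bounded_measurable_piecewise => k; exact: bounded_measurable_cst.
Qed.

Lemma restrV_coord (y : L1V M) k x i :
  restrV y k x 0 i = dotv (\row_j (y k).1 j i) x + (y k).2 0 i.
Proof.
rewrite /restrV !mxE; congr (_ + _); apply: eq_bigr => j _.
by rewrite !mxE mulrC.
Qed.

Lemma bounded_measurable_pw1V (y : L1V M) i : bounded_measurable (fun x => pw1V y x 0 i).
Proof.
under eq_fun do rewrite /pw1V (piecewise_map (fun y : 'rV[R]_n => y 0 i)).
apply: bounded_measurable_piecewise => k.
by under eq_fun do rewrite restrV_coord; exact: bounded_measurable_affine.
Qed.

Lemma cell_nonempty k : exists x, cell k x.
Proof.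
exists (barycenter (elt k)) => i; rewrite -/(bary _ _ _) /barycenter scaler_sumr.
rewrite (bary_unique (fa k)) ?invr_gt0//.
by rewrite sumr_const card_ord -[LHS]mulr_natl mulfV ?pnatr_eq0.
Qed.

Lemma cell_gt0 k : (0 < leb (cell k))%E.
Proof. by apply: lebesgueV_open_gt0; [exact: open_cell|exact: cell_nonempty]. Qed.

Lemma cell_lty k : (leb (cell k) < +oo)%E.
Proof.
apply: lebesgueV_bounded; first exact: measurable_cell.
by apply: bounded_subset bO => x kx; exact: (cell_sub HOmega HM kx).
Qed.

Lemma Omega_lty : (leb Omega < +oo)%E.
Proof. exact: lebesgueV_bounded. Qed.

End piecewise_functions.

(** * Green's formula on the triangulation *)

Section projection.
Context (R : realType) (d : nat).
Local Notation n := d.+1.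
Local Notation leb := (lebesgueV R n).
Context (kappa : R) (Omega : set 'rV[R]_n) (M : mesh R n).
Context (HOmega : polyhedral_lipschitz_domain Omega) (HM : triangulation kappa Omega M).
Local Notation E := 'I_(ne M).
Let mO : measurable Omega. Proof. exact: measurable_Omega HOmega. Qed.
Local Notation bm := (bounded_measurable Omega).

Lemma eq_Rintegral_cell (F G : 'rV[R]_n -> R) (k : E) : (forall x, cell k x -> F x = G x) ->
  \int[leb]_(x in cell k) F x = \int[leb]_(x in cell k) G x.
Proof. by move=> FG; apply: eq_Rintegral => x /set_mem; exact: FG. Qed.

Lemma Rintegral_fineK (f : 'rV[R]_n -> R) : leb.-integrable Omega (EFin \o f) ->
  (\int[leb]_(x in Omega) (f x)%:E)%E = (\int[leb]_(x in Omega) f x)%:E.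
Proof. by move=> fi; rewrite /Rintegral fineK//; exact: integrable_fin_num. Qed.

(** [Pi0] is chosen among the solutions of the orthogonality relations, so a solution has to be
    exhibited: the averages of w over the elements. *)
Lemma Pi0P (w : 'rV[R]_n -> R) (q : L0 M) : bm w ->
  \int[leb]_(x in Omega) (pw0 (Pi0 Omega w : L0 M) x * pw0 q x) =
  \int[leb]_(x in Omega) (w x * pw0 q x).
Proof.
move=> bw; have bq (c : L0 M) := bounded_measurable_pw0 HM c.
have wi := bounded_measurable_integrable HOmega bw.
have bd (c q' : L0 M) : bm (fun x => (w x - pw0 c x) * pw0 q' x).
  apply: bounded_measurableM => //; apply: bounded_measurableD => //.
  exact: bounded_measurableN.
pose c : L0 M := fun k => (fine (leb (cell k)))^-1 * \int[leb]_(x in cell k) w x.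
have cP : forall q : L0 M,
    (\int[leb]_(x in Omega) ((w x - pw0 c x) * pw0 q x)%:E = 0)%E.
  move=> q'; have bd' := bounded_measurable_integrable HOmega (bd c q').
  rewrite (Rintegral_fineK bd') (Rintegral_cells HOmega HM bd') big1// => k _.
  rewrite (@eq_Rintegral_cell _ (fun x => q' k * (w x - c k))); last first.
    by move=> x kx; rewrite /pw0 !(piecewise_cell HM _ _ kx) mulrC.
  have mk : measurable (cell k) by exact: measurable_cell.
  have wk : leb.-integrable (cell k) (EFin \o w).
    by apply: integrableS wi => // x kx; exact: (cell_sub HOmega HM kx).
  have ck : leb.-integrable (cell k) (EFin \o cst (c k)).
    have := bounded_measurable_integrable HOmega (bounded_measurable_cst Omega (c k)).
    by apply: integrableS => // x kx; exact: (cell_sub HOmega HM kx).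
  rewrite RintegralZl//; last exact: integrable_realB.
  have m0 : fine (leb (cell k)) != 0.
    have := cell_lty HOmega HM k; have := cell_gt0 HM k.
    by case: (leb (cell k)) => //= r; rewrite lte_fin => r0 _; rewrite gt_eqF.
  rewrite RintegralB// Rintegral_cst// [c k * _]mulrC /c mulVKf//.
  by rewrite subrr mulr0.
pose P : set (L0 M) := [set c0 | forall q0 : L0 M,
    (\int[leb]_(x in Omega) ((w x - pw0 c0 x) * pw0 q0 x)%:E = 0)%E].
have : P (Pi0 Omega w) by exact: (@xgetI _ _ P c cP).
move=> /(_ q); set c' : L0 M := Pi0 _ _ => h.
have := bounded_measurable_integrable HOmega (bd c' q) => id'.
move: h; rewrite (Rintegral_fineK id') => -[h].
apply/eqP; rewrite eq_sym -subr_eq0 -RintegralB//.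
- by rewrite -[X in _ == X]h; apply/eqP; apply: eq_Rintegral => x _; rewrite mulrBl.
- by apply: (bounded_measurable_integrable HOmega); exact: bounded_measurableM.
- by apply: (bounded_measurable_integrable HOmega); exact: bounded_measurableM.
Qed.

Lemma PihV_Rintegral (y : L1V M) (c : L0V M) :
  \int[leb]_(x in Omega) dotv (pw0V (PihV Omega y) x) (pw0V c x) =
  \int[leb]_(x in Omega) dotv (pw1V y x) (pw0V c x).
Proof.
have pwE (b : L0V M) i x : pw0V b x 0 i = pw0 (fun k => b k 0 i) x.
  by rewrite /pw0V (piecewise_map (fun y : 'rV[R]_n => y 0 i)) mxE.
have bV (b : L0V M) i := bounded_measurable_pw0V HM b i.
have bW i := bounded_measurable_pw1V HOmega HM y i.
rewrite !Rintegral_sum//.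
- apply: eq_bigr => i _; under eq_Rintegral do rewrite !pwE.
  under [RHS]eq_Rintegral do rewrite pwE.
  rewrite -(Pi0P (fun k => c k 0 i) (bW i)); apply: eq_Rintegral => x _; congr (pw0 _ x * _).
  by apply/funext => k; rewrite mxE.
- by move=> i; apply: (bounded_measurable_integrable HOmega); exact: bounded_measurableM.
- by move=> i; apply: (bounded_measurable_integrable HOmega); exact: bounded_measurableM.
Qed.

End projection.

(** * The divergence theorem on one element *)

Section green_smooth.
Context (R : realType) (d : nat).
Local Notation n := d.+1.
Local Notation leb := (lebesgueV R n).
Context (a : 'I_n.+1 -> 'rV[R]_n) (fa : affinely_independent a).
Local Notation U := (polytope (bgrad a) (bcst a)).
Local Notation chi := (bump (bgrad a) (bcst a)).

Lemma derive_bump_polytope m v x : ~ U x -> 'D_v (chi m) x = 0.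
Proof.
move=> /existsNP[j /negP]; rewrite -leNgt => xj.
rewrite derive_bump big1// => i _.
have fj k : flat k (m.+1%:R * (dotv (bgrad a j) x + bcst a j) - 1) = 0.
  by rewrite flat_npos// subr_le0 (@le_trans _ _ 0)// pmulr_rle0.
have [->|ij] := eqVneq i j; first by rewrite fj mulr0 mul0r.
by rewrite (bigD1 j) 1?eq_sym//= fj mul0r mulr0.
Qed.

Lemma polytope_norm_bound : exists r, forall x, r < `|x| -> ~ U x.
Proof.
have [r [_ rU]] := simplex_bounded a; exists (r + 1) => x rx Ux.
have := rU (r + 1); rewrite ltrDl => /(_ ltr01 _ (polytope_simplex fa Ux)).
by rewrite /= leNgt rx.
Qed.

Lemma Rintegral_polytope_support (f : 'rV[R]_n -> R) : (forall x, ~ U x -> f x = 0) ->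
  \int[leb]_(x in U) f x = \int[leb]_x f x.
Proof.
move=> f0; rewrite Rintegral_mkcond; congr Rintegral; apply/funext => x.
by rewrite patchE; case: ifPn => // /negP Ux; rewrite f0// => /mem_set.
Qed.

Lemma continuousM_rV (f g : 'rV[R]_n -> R) : continuous f -> continuous g -> continuous (fun x => f x * g x).
Proof. by move=> cf cg x; exact: (@cvgM _ _ (nbhs x) _ f g _ _ (cf x) (cg x)). Qed.

Lemma continuousD_rV (f g : 'rV[R]_n -> R) : continuous f -> continuous g -> continuous (fun x => f x + g x).
Proof. by move=> cf cg x; exact: (@cvgD _ _ _ (nbhs x) _ f g _ _ (cf x) (cg x)). Qed.

Lemma within_continuousM (A : set 'rV[R]_n) (F G : 'rV[R]_n -> R) :
  {within A, continuous F} -> {within A, continuous G} ->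
  {within A, continuous (fun x => F x * G x)}.
Proof.
move=> /subspace_continuousP cF /subspace_continuousP cG; apply/subspace_continuousP => x Ax.
exact: (@cvgM _ _ (within A (nbhs x)) _ F G _ _ (cF _ Ax) (cG _ Ax)).
Qed.

(** The product of F with a bump has compact support, so the integral of its derivative is zero.
    This is the integration by parts against bumps that [green_normal] asks for. *)
Lemma green_smooth (F : 'rV[R]_n -> R) (v : 'rV[R]_n) :
  (forall x, derivable F x v) -> continuous F -> continuous (fun x => 'D_v F x) ->
  \int[leb]_(x in U) 'D_v F x = \sum_i dotv (unit_normal a i) v * side_integral (opp_side a i) F.
Proof.
move=> dF cF cDF.
have bchi m := bump_in_algebra (bgrad a) (bcst a) m.
have dchi m x : derivable (chi m) x v by exact/diff_derivable/bump_differentiable.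
have cchi m : continuous (chi m) by move=> x; exact/differentiable_continuous/bump_differentiable.
have cDchi m : continuous (fun x => 'D_v (chi m) x).
  by move=> x; apply/differentiable_continuous/bump_differentiable; exact: bump_derive.
have ipol (g : 'rV[R]_n -> R) : continuous g -> leb.-integrable U (EFin \o g).
  by move=> cg; apply: integrable_polytope => //; exact: continuous_subspaceT.
apply: green_normal => //; first exact: continuous_subspaceT.
  exact: ipol.
move=> m; have [r rU] := polytope_norm_bound.
pose H x := F x * chi m x.
have DH x : 'D_v H x = F x * 'D_v (chi m) x + 'D_v F x * chi m x.
  have := @deriveM _ _ F (chi m) x v (dF x) (dchi m x).
  by rewrite /GRing.scale/= => ->; rewrite [chi m x * _]mulrC.
have ci1 : continuous (fun x => F x * 'D_v (chi m) x).
  exact: continuousM_rV.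
have ci2 : continuous (fun x => 'D_v F x * chi m x).
  exact: continuousM_rV.
have H0 : \int[leb]_x 'D_v H x = 0.
  apply: (@Rintegral_derive_eq0 _ _ H v r).
  - by move=> x; apply: derivableM.
  - exact: continuousM_rV.
  - under eq_fun do rewrite DH.
    exact: continuousD_rV.
  - by move=> x /rU Ux; rewrite /H bump_polytope// mulr0.
apply/eqP; rewrite -addr_eq0 -RintegralD//; last 3 first.
- exact: measurable_polytope.
- exact: ipol.
- exact: ipol.
rewrite -H0 -Rintegral_polytope_support.
  by apply/eqP; apply: eq_Rintegral => x _; rewrite DH.
move=> x Ux; rewrite DH derive_bump_polytope// bump_polytope// !mulr0 addr0//.
Qed.

Lemma sum_side_integral i (F : 'I_n -> 'rV[R]_n -> R) (c : 'I_n -> R) :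
  (forall j, {within simplex (opp_side a i), continuous (F j)}) ->
  \sum_j c j * side_integral (opp_side a i) (F j) =
  side_integral (opp_side a i) (fun x => \sum_j c j * F j x).
Proof.
move=> cF; rewrite /side_integral.
rewrite Rintegral_sum; last 2 first.
- exact: measurable_ref_simplex.
- move=> j; apply: integrable_realZ; first exact: measurable_ref_simplex.
  exact: integrable_param.
rewrite mulr_sumr; apply: eq_bigr => j _; rewrite mulrCA; congr (_ * _).
rewrite RintegralZl//; [exact: measurable_ref_simplex|exact: integrable_param].
Qed.

Lemma simplex_side i x : simplex (opp_side a i) x -> simplex a x.
Proof. by move=> /simplex_paramP[xi rxi ->]; exact: side_point_simplex. Qed.

(* The divergence theorem for w |-> F w, from its versions in coordinates. *)
Lemma green_vector (F : 'rV[R]_n -> R) (w : 'rV[R]_n -> 'rV[R]_n) (I : 'I_n -> R) :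
  {within simplex a, continuous F} -> (forall j, continuous (fun x => w x 0 j)) ->
  (forall j, I j = \sum_i dotv (unit_normal a i) (unit_vec R j) *
     side_integral (opp_side a i) (fun x => F x * w x 0 j)) ->
  \sum_j I j = \sum_i side_integral (opp_side a i) (fun x => F x * dotv (w x) (unit_normal a i)).
Proof.
move=> cF cw IE; rewrite (eq_bigr _ (fun j _ => IE j)) exchange_big; apply: eq_bigr => i _ /=.
rewrite sum_side_integral => [|j].
  congr side_integral; apply/funext => x; rewrite /dotv mulr_sumr; apply: eq_bigr => j _.
  by rewrite -[X in X * _]/(dotv (unit_normal a i) (unit_vec R j)) dotv_unit; ring.
apply: within_continuousM; first by apply: continuous_subspaceW cF; exact: simplex_side.
exact: continuous_subspaceT.
Qed.

End green_smooth.

Section discrete_green.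
Context (R : realType) (d : nat).
Local Notation n := d.+1.
Local Notation leb := (lebesgueV R n).
Context (kappa : R) (Omega GammaD GammaN : set 'rV[R]_n) (M : mesh R n).
Context (HOmega : polyhedral_lipschitz_domain Omega) (HM : triangulation kappa Omega M).
Context (HGamma : boundary_partition Omega GammaD GammaN).
Local Notation E := 'I_(ne M).
Implicit Types (k l : E) (i j : 'I_n.+1) (x : 'rV[R]_n).
Let fa k : affinely_independent (elt k). Proof. by have [] := HM. Qed.
Let mO : measurable Omega. Proof. exact: measurable_Omega HOmega. Qed.
Local Notation bm := (bounded_measurable Omega).
Local Notation nu k i := (unit_normal (elt k) i).

Definition unshared k i :=
  forall l j, k != l -> simplex (side k i) <> simplex (side l j).

Lemma unshared_boundary k i : unshared k i -> simplex (side k i) `<=` boundary Omega.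
Proof.
move=> u; have [//|[l [j [kl e]]]] := boundary_or_shared HOmega HM k i.
by have := u _ _ kl e.
Qed.

(** Pairs (element, index) are grouped by the side they describe. Distinct pairs of a class belong
    to distinct elements, and a class with a single member is an unshared side. *)
Lemma sum_sides_cancel (b : E -> 'I_n.+1 -> R) :
  (forall k l i j, k != l -> simplex (side k i) = simplex (side l j) ->
     b k i + b l j = 0) ->
  (forall k i, unshared k i -> b k i = 0) -> \sum_k \sum_i b k i = 0.
Proof.
move=> bN b0; rewrite pair_bigA /=.
pose e (q r : E * 'I_n.+1) := `[< simplex (side q.1 q.2) = simplex (side r.1 r.2) >].
apply: (@sum_pairwise_opposite _ _ e).
- by move=> q; apply/asboolP.
- by move=> q r; apply/asboolP/asboolP.
- by move=> q r s /asboolP h1 /asboolP h2; apply/asboolP; rewrite h1.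
- move=> [k i] [l j] /= kl /asboolP /= h; have [ekl|nkl] := eqVneq k l; last exact: bN.
  subst l; have ij := side_opposite_inj HM h; subst j.
  by rewrite eqxx in kl.
- move=> [k i] h /=; apply: b0 => l j kl eq.
  have : (l, j) = (k, i) by apply: h; apply/asboolP.
  by move=> [lk _]; rewrite lk eqxx in kl.
Qed.

Lemma side_free k i : row_free (edges (side k i)).
Proof. exact: opp_side_free. Qed.

Definition flux (z : L1V M) k i := dotv (restrV z k (side k i ord0)) (nu k i).

Section flux.
Context (z : L1V M) (zRT : RT Omega GammaN M z).

Lemma flux_const k i x : simplex (side k i) x -> dotv (restrV z k x) (nu k i) = flux z k i.
Proof.
move=> sx; have [h _ _] := zRT; have := h k i x (side k i ord0) sx (vertex_simplex _ _).
by rewrite outer_normalE.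
Qed.

Lemma flux_shared k l i j : k != l -> simplex (side k i) = simplex (side l j) ->
  flux z k i + flux z l j = 0.
Proof.
move=> kl e; have [_ h _] := zRT; have sx : simplex (side k i) (side k i ord0).
  exact: vertex_simplex.
have := h k l i j kl e _ sx; rewrite !outer_normalE// (flux_const sx) flux_const//.
by rewrite -e.
Qed.

(** The normal component is constant on the side, so one point of [GammaN] on it forces zero flux;
    otherwise the whole boundary side lies in [GammaD]. *)
Lemma flux_unshared k i : unshared k i -> flux z k i = 0 \/ simplex (side k i) `<=` GammaD.
Proof.
move=> /unshared_boundary sb; have [_ _ h] := zRT; have [bE _ _] := HGamma.
have [[x [sx Nx]]|nN] := pselect (exists x, simplex (side k i) x /\ GammaN x).
  by left; have := h k i sb x sx Nx; rewrite outer_normalE// flux_const.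
right=> x sx; have := sb x sx; rewrite bE => -[//|Nx].
by exfalso; apply: nN; exists x.
Qed.

End flux.

Lemma continuous_restr (v : L1 M) k : continuous (restr v k).
Proof. exact: continuous_affine. Qed.

Lemma continuous_restrV (z : L1V M) k (j : 'I_n) : continuous (fun x => restrV z k x 0 j).
Proof. by under eq_fun do rewrite restrV_coord; exact: continuous_affine. Qed.

Lemma green_affine (z : L1V M) (v : L1 M) k :
  \int[leb]_(x in cell k) (dotv (restrV z k x) (v k).1 + \tr (z k).1 * restr v k x) =
  \sum_i side_integral (side k i) (fun x => restr v k x * dotv (restrV z k x) (nu k i)).
Proof.
pose F (j : 'I_n) x := restr v k x * restrV z k x 0 j.
have FE (j : 'I_n) : F j = (fun x => dotv (v k).1 x + (v k).2) \*
    (fun x => dotv (\row_l (z k).1 l j) x + (z k).2 0 j).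
  by apply/funext => x; rewrite /F restrV_coord.
have bF (j : 'I_n) : bump_algebra (F j) by rewrite FE; apply: BumpMul; exact: BumpAff.
have DF (j : 'I_n) x : 'D_(unit_vec R j) (F j) x =
    restrV z k x 0 j * (v k).1 0 j + (z k).1 j j * restr v k x.
  rewrite FE deriveM; last 2 first.
  - by have := is_derive_dotv (v k).1 (v k).2 x (unit_vec R j); case.
  - by have := is_derive_dotv (\row_l (z k).1 l j) ((z k).2 0 j) x (unit_vec R j); case.
  rewrite !(@derive_val _ _ _ _ _ _ _ (is_derive_dotv _ _ _ _)) !dotv_unit mxE.
  by rewrite restrV_coord /restr /GRing.scale/=; ring.
have cDF (j : 'I_n) : continuous (fun x => 'D_(unit_vec R j) (F j) x).
  by move=> x; apply/differentiable_continuous/bump_differentiable; exact: bump_derive.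
rewrite -(@green_vector _ _ _ (fa k) (restr v k) (restrV z k)
   (fun j : 'I_n => \int[leb]_(x in cell k) 'D_(unit_vec R j) (F j) x)).
- rewrite -Rintegral_sum; last 2 first.
  + exact: measurable_cell.
  + by move=> j; apply: integrable_polytope => //; exact: continuous_subspaceT.
  apply: eq_Rintegral => x _; rewrite (eq_bigr _ (fun (j : 'I_n) _ => DF j x)) big_split/=.
  by rewrite mulr_suml.
- by apply: continuous_subspaceT; exact: continuous_restr.
- exact: continuous_restrV.
- move=> j; apply: green_smooth => //.
  + by move=> x; exact/diff_derivable/bump_differentiable.
  + by move=> x; apply/differentiable_continuous/bump_differentiable.
Qed.

Lemma side_integral_flux (z : L1V M) (h : 'rV[R]_n -> R) k i : RT Omega GammaN M z ->
  {within simplex (side k i), continuous h} ->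
  side_integral (side k i) (fun x => h x * dotv (restrV z k x) (nu k i)) =
  flux z k i * side_integral (side k i) h.
Proof.
move=> zRT ch; rewrite -side_integralZ//; apply: eq_side_integral => x sx.
by rewrite flux_const// mulrC.
Qed.

Lemma discrete_green_integrable (z : L1V M) (v : L1 M) :
  bm (fun x => dotv (pw1V z x) (pw0V (gradh v) x) + pw0 (divh z) x * pw1 v x).
Proof.
apply: bounded_measurableD; last apply: bounded_measurableM.
- apply: bounded_measurable_dotv => i; first exact: (bounded_measurable_pw1V HOmega HM).
  exact: (bounded_measurable_pw0V HM).
- exact: (bounded_measurable_pw0 HM).
- exact: (bounded_measurable_pw1 HOmega HM).
Qed.

(** Constant fluxes reduce each boundary term to the integral of v over the side. On shared sides
    these integrals agree, the jump having mean zero, and the fluxes are opposite. On a Dirichlet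
    side the integral vanishes with the value at the barycentre. *)
Lemma discrete_green (z : L1V M) (v : L1 M) : RT Omega GammaN M z -> CR GammaD M v ->
  \int[leb]_(x in Omega)
    (dotv (pw1V z x) (pw0V (gradh v) x) + pw0 (divh z) x * pw1 v x) = 0.
Proof.
move=> zRT [vS vD].
rewrite (Rintegral_cells HOmega HM); last first.
  by apply: (bounded_measurable_integrable HOmega); exact: discrete_green_integrable.
have cv k i : {within simplex (side k i), continuous (restr v k)}.
  by apply: continuous_subspaceT; exact: continuous_restr.
rewrite (eq_bigr (fun k => \sum_i flux z k i * side_integral (side k i) (restr v k))); last first.
  move=> k _; rewrite (eq_bigr _ (fun i _ => esym (side_integral_flux zRT (cv k i)))) -green_affine.
  apply: eq_Rintegral_cell => x kx.
  by rewrite /pw1V /pw0V /pw0 /pw1 !(piecewise_cell HM _ _ kx).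
apply: sum_sides_cancel => [k l i j kl e|k i u].
  have cl : {within simplex (side k i), continuous (restr v l)}.
    by apply: continuous_subspaceT; exact: continuous_restr.
  have := vS k l i j kl e.
  rewrite (surface_integralE (h := fun x => restr v k x - restr v l x)); last first.
    apply: continuous_subspaceT => x; apply: (@cvgB _ _ _ (nbhs x) _ (restr v k) (restr v l)).
      exact: continuous_restr.
    exact: continuous_restr.
  rewrite side_integralB// => -[/eqP]; rewrite subr_eq0 => /eqP ->.
  rewrite (side_integral_reparam (side_free k i) (side_free l j) e cl) -mulrDl.
  by rewrite flux_shared// mul0r.
have [->|sD] := flux_unshared zRT u; first by rewrite mul0r.
rewrite (side_integral_affine (side_free k i)) ?mulr0//.
exact: vD.
Qed.

End discrete_green.

(** * Continuous piecewise affine functions *)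

Section conforming_functions.
Context (R : realType) (d : nat).
Local Notation n := d.+1.
Local Notation leb := (lebesgueV R n).
Context (kappa : R) (Omega GammaD GammaN : set 'rV[R]_n) (M : mesh R n).
Context (HOmega : polyhedral_lipschitz_domain Omega) (HM : triangulation kappa Omega M).
Context (HGamma : boundary_partition Omega GammaD GammaN).
Local Notation E := 'I_(ne M).
Implicit Types (k l : E) (i j : 'I_n.+1) (x : 'rV[R]_n).
Let fa k : affinely_independent (elt k). Proof. by have [] := HM. Qed.
Let clO : closure Omega = \bigcup_(k in [set: E]) tri k. Proof. by have [] := HM. Qed.
Let mO : measurable Omega. Proof. exact: measurable_Omega HOmega. Qed.
Let oO : open Omega. Proof. by have [] := HOmega. Qed.
Local Notation bm := (bounded_measurable Omega).
Local Notation nu k i := (unit_normal (elt k) i).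

Lemma tri_closure k : tri k `<=` closure Omega.
Proof. by move=> x kx; rewrite clO; exists k. Qed.

Lemma closure_cell k x : tri k x -> closure (cell k) x.
Proof.
move=> kx B Bx; set c := barycenter (elt k).
have cE m : bary (elt k) c m = n.+1%:R^-1.
  rewrite /c /barycenter scaler_sumr (bary_unique (fa k))//.
  by rewrite sumr_const card_ord -[LHS]mulr_natl mulfV ?pnatr_eq0.
have near1 : \forall t \near (0 : R), t < 1.
  by apply: (@cvgr_lt _ _ (nbhs (0 : R)) _ id 0) => //; exact: cvg_id.
have nearB : \forall t \near (0 : R), B (x + t *: (c - x)).
  have ct : x + t *: (c - x) @[t --> (0 : R)] --> x.
    rewrite -[X in _ --> X]addr0 -(scale0r (c - x)).
    by apply: cvgD; [exact: cvg_cst|apply: cvgZr_tmp; exact: cvg_id].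
  exact: ct.
have [t t0 [t1 Bt]] := near0_gt0 (filterI near1 nearB).
exists (x + t *: (c - x)); split => // m.
rewrite -[_ + _]/(bary (elt k) (x + t *: (c - x)) m) baryD dotvZr dotv_bgradB cE.
have -> : bary (elt k) x m + t * (n.+1%:R^-1 - bary (elt k) x m) =
    (1 - t) * bary (elt k) x m + t * n.+1%:R^-1 by ring.
rewrite ltr_wpDl ?mulr_gt0 ?invr_gt0// mulr_ge0 ?subr_ge0 ?(ltW t1)//.
exact: (simplexP (fa k) x).1.
Qed.

Lemma side_boundary_test (w : 'rV[R]_n -> R) k i x : test_function Omega w ->
  simplex (side k i) `<=` boundary Omega -> simplex (side k i) x -> w x = 0.
Proof.
move=> [_ [K [_ KO w0]]] sb sx; apply: w0 => /KO Ox; have [_] := sb _ sx; apply.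
exact: open_nbhs_nbhs.
Qed.

Lemma bounded_measurable_continuous (g : 'rV[R]_n -> R) : continuous g -> bm g.
Proof.
move=> cg; split; first exact: continuous_measurable_rV.
have cO : compact (closure Omega).
  apply: bounded_closed_compact; last exact: closed_closure.
  have -> : closure Omega = \big[setU/set0]_(k : E) tri k.
    rewrite clO -bigcup_seq; apply: eq_bigcup => //.
    by split => k //= _; rewrite mem_index_enum.
  elim/big_ind: _ => [|A B bA bB|k _].
  - by exists 0; split; [exact: num_real|move=> ? ? ? []].
  - have [[rA [_ hA]] [rB [_ hB]]] := (bA, bB).
    exists (Num.max rA rB); split; first exact: num_real.
    by move=> r; rewrite gt_max => /andP[/hA Ar /hB Br] x [/Ar|/Br].
  - exact: simplex_bounded.
have [C _ gC] := compact_continuous_bounded cO (continuous_subspaceT cg).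
by exists C => x Ox; apply: gC; exact: subset_closure.
Qed.

Section conforming_function.
Context (v : L1 M) (vS : S1D Omega GammaD M v).

(** Where elements meet, [piecewise] selects only one of them; continuity on the closure of Omega
    and density of the open element carry the formula over. *)
Lemma S1D_restr k x : tri k x -> pw1 v x = restr v k x.
Proof.
move=> kx; apply/eqP; rewrite -subr_eq0; apply/negPn/negP => h0.
have [/subspace_continuousP cv _] := vS.
have cOx : closure Omega x by exact: tri_closure kx.
have ch : pw1 v y - restr v k y @[y --> within (closure Omega) (nbhs x)] --> pw1 v x - restr v k x.
  apply: cvgB; first exact: cv.
  apply: (@cvg_trans _ (restr v k y @[y --> nbhs x])); last exact: continuous_restr.
  by apply: cvg_app; exact: cvg_within.
have : \forall y \near within (closure Omega) (nbhs x), pw1 v y - restr v k y != 0.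
  exact: cvgr_neq0 ch h0.
move=> /= nh; have [y [ky /= hy]] := closure_cell kx nh.
have := hy (tri_closure (cell_tri HM ky)).
by rewrite /pw1 (piecewise_cell HM _ _ ky) subrr eqxx.
Qed.

Lemma S1D_CR : CR GammaD M v.
Proof.
have sk k i x : simplex (side k i) x -> pw1 v x = restr v k x.
  by move=> /(sideP HM)[kx _]; exact: S1D_restr.
split => [k l i j kl e|k i sD].
  rewrite (surface_integralE (h := fun x => restr v k x - restr v l x)); last first.
    apply: continuous_subspaceT => x; apply: (@cvgB _ _ _ (nbhs x) _ (restr v k) (restr v l)).
      exact: continuous_restr.
    exact: continuous_restr.
  rewrite (@eq_side_integral _ _ _ _ _ (cst 0)) => [|x sx].
    by rewrite /side_integral Rintegral_cst// ?mul0r ?mulr0//; exact: measurable_ref_simplex.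
  by rewrite -(sk _ _ _ sx) -(sk l j x) ?subrr// -e.
have [_ v0] := vS; have bs : simplex (side k i) (barycenter (side k i)).
  exists (fun=> n%:R^-1); split => //.
  - by move=> m /(_ I).
  - by rewrite sumr_const card_ord -[LHS]mulr_natl mulfV ?pnatr_eq0.
  - by rewrite /barycenter scaler_sumr.
by rewrite -(sk _ _ _ bs) v0//; exact: sD.
Qed.

(** On shared sides the contributions cancel because v is continuous and the normals are opposite;
    on boundary sides w vanishes. The elementwise gradient is therefore a weak gradient. *)
Lemma green_test_function (w : 'rV[R]_n -> R) (m : 'I_n) : test_function Omega w ->
  \int[leb]_(x in Omega) (pw1 v x * 'D_(unit_vec R m) w x) =
  - \int[leb]_(x in Omega) (pw0V (gradh v) x 0 m * w x).
Proof.
move=> tw; have [sw _] := tw.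
have cw : continuous w by have [] := sw [::].
have cDw : continuous (fun x => 'D_(unit_vec R m) w x) by have [] := sw [:: m].
have dw x : derivable w x (unit_vec R m) by have [_] := sw [::]; exact.
have b1 : bm (fun x => pw1 v x * 'D_(unit_vec R m) w x).
  by apply: bounded_measurableM; [exact: (bounded_measurable_pw1 HOmega HM)|exact: bounded_measurable_continuous].
have b2 : bm (fun x => pw0V (gradh v) x 0 m * w x).
  by apply: bounded_measurableM; [exact: (bounded_measurable_pw0V HM)|exact: bounded_measurable_continuous].
apply/eqP; rewrite -addr_eq0 -RintegralD//; last 2 first.
- exact: (bounded_measurable_integrable HOmega).
- exact: (bounded_measurable_integrable HOmega).
rewrite (Rintegral_cells HOmega HM); last first.
  by apply: (bounded_measurable_integrable HOmega); exact: bounded_measurableD.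
pose F k x := restr v k x * w x.
have cF k : continuous (F k) by apply: continuousM_rV => //; exact: continuous_restr.
have dr k x : derivable (restr v k) x (unit_vec R m).
  by have := is_derive_dotv (v k).1 (v k).2 x (unit_vec R m); case.
have DF k x : 'D_(unit_vec R m) (F k) x = restr v k x * 'D_(unit_vec R m) w x + (v k).1 0 m * w x.
  rewrite deriveM// (@derive_val _ _ _ _ _ _ _ (is_derive_dotv _ _ _ _)) dotv_unit.
  by rewrite /GRing.scale/= [w x * _]mulrC.
rewrite (eq_bigr (fun k => \sum_i dotv (nu k i) (unit_vec R m) * side_integral (side k i) (F k))); last first.
  move=> k _; rewrite -[RHS](green_smooth (fa k)) => [|x||].
  - apply: eq_Rintegral_cell => x kx.
    by rewrite DF /pw0V /pw1 !(piecewise_cell HM _ _ kx).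
  - exact: derivableM.
  - exact: cF.
  - under eq_fun do rewrite DF.
    apply: continuousD_rV; apply: continuousM_rV => //; first exact: continuous_restr.
    exact: (@cst_continuous 'rV[R]_n R).
apply/eqP; apply: (sum_sides_cancel HM) => [k l i j kl e|k i u].
  have cl : {within simplex (side k i), continuous (F l)} by exact: continuous_subspaceT.
  rewrite (side_integral_reparam (side_free HM k i) (side_free HM l j) e cl).
  rewrite (@eq_side_integral _ _ _ _ (F k) (F l)) => [|x sx].
    by rewrite (shared_normal HM kl e) -mulrDl !(dotvC _ (unit_vec R m)) dotvNr subrr mul0r.
  have /(sideP HM)[kx _] := sx; have := sx; rewrite e => /(sideP HM)[lx _].
  by rewrite /F -!S1D_restr.
rewrite (@eq_side_integral _ _ _ _ _ (cst 0)) => [|x sx].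
  by rewrite /side_integral Rintegral_cst// ?mul0r ?mulr0//; exact: measurable_ref_simplex.
by rewrite /F (side_boundary_test tw (unshared_boundary HOmega HM u) sx) mulr0.
Qed.

End conforming_function.
End conforming_functions.

(** * From L^p to L^1 convergence *)

Section Lp_to_L1.
Context (R : realType).

(** Up to e the first term suffices; beyond, y = y^(1-p) y^p with y^(1-p) <= e^(1-p). With e free,
    this bounds L^1 integrals by L^p integrals on sets of finite measure. *)
Lemma le_powR_shift (p e y : R) : 1 < p -> 0 < e -> 0 <= y ->
  y <= e + e `^ (1 - p) * y `^ p.
Proof.
move=> p1 e0 y0; have [ye|ey] := leP y e.
  by apply: le_trans ye _; rewrite lerDl mulr_ge0// powR_ge0.
have y0' : 0 < y by exact: lt_trans e0 ey.
apply: (@le_trans _ _ (e `^ (1 - p) * y `^ p)); last by rewrite lerDr ltW.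
have yE : y = y `^ (1 - p) * y `^ p.
  by rewrite -powRD ?(gt_eqF y0') ?implybT// subrK powRr1.
rewrite [leLHS]yE; apply: ler_wpM2r; first exact: powR_ge0.
rewrite -[1 - p]opprB !powRN lef_pV2 ?posrE ?powR_gt0//.
by apply: ge0_ler_powR; rewrite ?nnegrE ?subr_ge0 ?(ltW p1)// ltW.
Qed.

(** Convergence to 0 of nonnegative extended reals in a one-sided form, which passes at once to
    smaller sequences and tolerates infinite terms. *)
Definition evanescent (x : nat -> \bar R) :=
  forall e : R, 0 < e -> \forall j \near \oo, (x j < e%:E)%E.

Lemma cvg_evanescent x : x @ \oo --> 0%E -> evanescent x.
Proof.
move=> x0 e e0; apply: (x0 [set y | (y < e%:E)%E]).
by apply: open_nbhs_nbhs; split; [exact: open_ereal_lt_ereal|rewrite /= lte_fin].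
Qed.

Lemma evanescent_le x y : (forall j, (x j <= y j)%E) -> evanescent y -> evanescent x.
Proof. by move=> xy y0 e e0; apply: filterS (y0 e e0) => j; exact: le_lt_trans. Qed.

Lemma evanescentZ (c : R) x : 0 < c -> evanescent (fun j => c%:E * x j)%E -> evanescent x.
Proof.
move=> c0 cx e e0; apply: filterS (cx (c * e) (mulr_gt0 c0 e0)) => j.
by rewrite EFinM lte_pmul2l.
Qed.

Lemma evanescent_poweR (q : R) x : 0 < q -> (forall j, (0 <= x j)%E) ->
  evanescent (fun j => x j `^ q)%E -> evanescent x.
Proof.
move=> q0 x0 xq e e0; have eq0 : 0 < e `^ q by exact: powR_gt0.
apply: filterS (xq _ eq0) => j; rewrite -poweR_EFin; apply: contraTT.
by rewrite -!leNgt => ex; apply: gt0_ler_poweR; rewrite ?in_itv/= ?lee_fin ?(ltW e0) ?leey ?x0// ltW.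
Qed.

Lemma evanescent_cvg (a : nat -> R) : (forall j, 0 <= a j) ->
  evanescent (EFin \o a) -> a @ \oo --> 0.
Proof.
move=> a0 ae; apply/cvgrPdist_lt => e e0; apply: filterS (ae e e0) => j /=.
by rewrite lte_fin sub0r normrN ger0_norm.
Qed.

Context d (T : measurableType d) (mu : {measure set T -> \bar R}).
Context (A : set T) (mA : measurable A) (Afin : (mu A < +oo)%E) (p : R) (p1 : 1 < p).
Implicit Types h : T -> R.

Let measurable_powR_norm h : measurable_fun A h -> measurable_fun A (fun x => (`|h x| `^ p)%:E).
Proof.
move=> mh; apply/measurable_EFinP.
apply: (measurableT_comp (f := fun y => y `^ p)); first exact: measurable_powR.
exact: measurableT_comp.
Qed.

Lemma Lp_L1_bound h (e : R) : measurable_fun A h -> 0 < e ->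
  (\int[mu]_(x in A) (`|h x|)%:E <=
   e%:E * mu A + (e `^ (1 - p))%:E * \int[mu]_(x in A) (`|h x| `^ p)%:E)%E.
Proof.
move=> mh e0; have mp := measurable_powR_norm mh.
rewrite -integral_cst// -ge0_integralZl//; last by rewrite lee_fin powR_ge0.
rewrite -ge0_integralD//; last 3 first.
- by move=> x _; rewrite lee_fin ltW.
- by move=> x _; rewrite -EFinM lee_fin mulr_ge0// powR_ge0.
- by apply: emeasurable_funM => //; exact: measurable_cst.
apply: ge0_le_integral => //.
- by apply/measurable_EFinP; exact: measurableT_comp.
- by apply: emeasurable_funD => //; apply: emeasurable_funM.
- by move=> x _; rewrite -EFinM -EFinD lee_fin; exact: le_powR_shift.
Qed.

Lemma Lp_integrable h : measurable_fun A h ->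
  (\int[mu]_(x in A) (`|h x| `^ p)%:E < +oo)%E -> mu.-integrable A (EFin \o h).
Proof.
move=> mh hp; apply/integrableP; split; first exact/measurable_EFinP.
apply: le_lt_trans (Lp_L1_bound mh ltr01) _.
by rewrite mul1e powR1 mul1e; exact: lte_add_pinfty.
Qed.

Lemma evanescent_Lp_L1 (h : nat -> T -> R) : (forall j, measurable_fun A (h j)) ->
  evanescent (fun j => \int[mu]_(x in A) (`|h j x| `^ p)%:E)%E ->
  evanescent (fun j => \int[mu]_(x in A) (`|h j x|)%:E)%E.
Proof.
move=> mh hp e e0.
pose m := fine (mu A); have m0 : 0 <= m by rewrite fine_ge0.
have mE : mu A = m%:E by rewrite fineK// ge0_fin_numE.
(* This makes r m at most e/2; the added 1 covers a set of measure 0. *)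
pose r := e / (2 * (m + 1)); have r0 : 0 < r by rewrite divr_gt0// mulr_gt0// ltr_wpDl.
have c0 : 0 < r `^ (1 - p) by exact: powR_gt0.
have c1 : 0 < e / (2 * r `^ (1 - p)) by rewrite divr_gt0// mulr_gt0.
apply: filterS (hp _ c1) => j hj; apply: le_lt_trans (Lp_L1_bound (mh j) r0) _.
have -> : e%:E = ((e / 2)%:E + (e / 2)%:E)%E by rewrite -EFinD; congr _%:E; lra.
apply: lee_ltD => //.
- by rewrite mE.
- rewrite mE -EFinM lee_fin /r mulrAC ler_pdivrMr ?mulr_gt0 ?ltr_wpDl//.
  by lra.
have -> : (e / 2)%:E = ((r `^ (1 - p))%:E * (e / (2 * r `^ (1 - p)))%:E)%E.
  by rewrite -EFinM; congr _%:E; field; rewrite gt_eqF.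
by rewrite lte_pmul2l.
Qed.

End Lp_to_L1.

(** * Weak gradients *)

Section sobolev_functions.
Context (R : realType) (d : nat).
Local Notation n := d.+1.
Local Notation leb := (lebesgueV R n).
Context (p kappa : R) (Omega GammaD GammaN : set 'rV[R]_n) (M : mesh R n) (p1 : 1 < p).
Context (HOmega : polyhedral_lipschitz_domain Omega) (HM : triangulation kappa Omega M).
Local Notation E := 'I_(ne M).
Implicit Types (v w h : 'rV[R]_n -> R) (G H : 'rV[R]_n -> 'rV[R]_n).
Let mO : measurable Omega. Proof. exact: measurable_Omega HOmega. Qed.
Let oO : open Omega. Proof. by have [] := HOmega. Qed.
Let Ofin : (leb Omega < +oo)%E. Proof. exact: Omega_lty. Qed.
Local Notation bm := (bounded_measurable Omega).

Lemma bounded_in_Lp h : bm h -> in_Lp p Omega h.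
Proof.
move=> [mh [C hC]]; split; first exact: measurable_funS mh.
have C0 : 0 <= `|C| by [].
have bp : bm (fun x => `|h x| `^ p).
  split; first by apply: (measurableT_comp (measurable_powR p)); exact: measurableT_comp.
  exists (`|C| `^ p) => x Ox; rewrite ger0_norm ?powR_ge0//.
  by apply: ge0_ler_powR; rewrite ?nnegrE// ?(le_trans (hC x Ox) (ler_norm _))// ltW// (lt_trans _ p1).
rewrite (Rintegral_fineK HOmega); last exact: (bounded_measurable_integrable HOmega bp).
exact: ltry.
Qed.

Lemma in_Lp_integrable h : in_Lp p Omega h -> leb.-integrable Omega (EFin \o h).
Proof. by move=> [mh hp]; exact: Lp_integrable hp. Qed.

Lemma in_LpB v w : in_Lp p Omega v -> in_Lp p Omega w ->
  in_Lp p Omega (fun x => v x - w x).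
Proof.
move=> [mv vp] [mw wp]; split; first exact: measurable_funB.
have p0 : 0 <= p by rewrite ltW// (lt_trans _ p1).
have mp h : measurable_fun Omega h -> measurable_fun Omega (fun x => (`|h x| `^ p)%:E).
  move=> mh; apply/measurable_EFinP.
  by apply: (measurableT_comp (measurable_powR p)); exact: measurableT_comp.
apply: (@le_lt_trans _ _ (\int[leb]_(x in Omega) ((2 `^ p)%:E *
    ((`|v x| `^ p)%:E + (`|w x| `^ p)%:E)))%E).
  apply: ge0_le_integral => //.
  - by apply: (mp (fun x => v x - w x)); exact: measurable_funB.
  - by apply: emeasurable_funM; [exact: measurable_cst|apply: emeasurable_funD; exact: mp].
  - move=> x _; rewrite -EFinD -EFinM lee_fin.
    apply: (@le_trans _ _ ((2 * Num.max `|v x| `|w x|) `^ p)).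
      apply: ge0_ler_powR; rewrite ?nnegrE//.
      rewrite (le_trans (ler_normB _ _))// mulr_natl mulr2n.
      by apply: lerD; rewrite le_max lexx ?orbT.
    rewrite powRM//.
    rewrite ler_pM2l ?powR_gt0//.
    by rewrite /Num.max; case: ifP => _; rewrite ?lerDl ?lerDr powR_ge0.
rewrite ge0_integralZl//; last 2 first.
- by apply: emeasurable_funD; exact: mp.
- by move=> x _; rewrite -EFinD lee_fin addr_ge0// powR_ge0.
rewrite ge0_integralD//; [|exact: mp|exact: mp].
by rewrite lte_mul_pinfty ?lee_fin ?powR_ge0// (lte_add_pinfty vp wp).
Qed.

Lemma test_function_bounded w : test_function Omega w -> bm w.
Proof. by move=> [sw _]; apply: (bounded_measurable_continuous HM); have [] := sw [::]. Qed.

Lemma test_function_derive_bounded w (i : 'I_n) : test_function Omega w ->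
  bm (fun x => 'D_(unit_vec R i) w x).
Proof. by move=> [sw _]; apply: (bounded_measurable_continuous HM); have [] := sw [:: i]. Qed.

Lemma integrable_mulbm h w : leb.-integrable Omega (EFin \o h) -> bm w ->
  leb.-integrable Omega (EFin \o (fun x => h x * w x)).
Proof.
move=> ih [mw [C wC]]; apply: (integrable_mul_bounded mO ih (C := C)) => //.
exact: measurable_funS mw.
Qed.

Lemma weak_gradientP v G : in_Lp p Omega v -> (forall i, in_Lp p Omega (fun x => G x 0 i)) ->
  (weak_gradient p Omega v G <-> forall w i, test_function Omega w ->
    \int[leb]_(x in Omega) (v x * 'D_(unit_vec R i) w x) =
    - \int[leb]_(x in Omega) (G x 0 i * w x)).
Proof.
move=> vp Gp; have iv := in_Lp_integrable vp; have iG i := in_Lp_integrable (Gp i).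
have e1 w i : test_function Omega w -> leb.-integrable Omega (EFin \o (fun x => v x * 'D_(unit_vec R i) w x)).
  by move=> tw; apply: integrable_mulbm => //; exact: test_function_derive_bounded.
have e2 w i : test_function Omega w -> leb.-integrable Omega (EFin \o (fun x => G x 0 i * w x)).
  by move=> tw; apply: integrable_mulbm => //; exact: test_function_bounded.
split => [[_ h] w i tw|h].
  have := h w tw i; rewrite (Rintegral_fineK HOmega (e1 w i tw)) (Rintegral_fineK HOmega (e2 w i tw)).
  by rewrite -EFinN => -[].
split => // w tw i; rewrite (Rintegral_fineK HOmega (e1 w i tw)) (Rintegral_fineK HOmega (e2 w i tw)).
by rewrite h.
Qed.

Lemma wgradP v : W1p p Omega v -> weak_gradient p Omega v (wgrad p Omega v).
Proof. by move=> [_ vG]; exact: xgetPex. Qed.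

Lemma weak_gradientB v w G H : in_Lp p Omega v -> in_Lp p Omega w ->
  weak_gradient p Omega v G -> weak_gradient p Omega w H ->
  weak_gradient p Omega (fun x => v x - w x) (fun x => G x - H x).
Proof.
move=> vp wp vG wH; have [Gp _] := vG; have [Hp _] := wH.
have GHp i : in_Lp p Omega (fun x => (G x - H x) 0 i).
  have -> : (fun x => (G x - H x) 0 i) = (fun x => G x 0 i - H x 0 i).
    by apply/funext => x; rewrite !mxE.
  exact: (in_LpB (Gp i) (Hp i)).
apply/(weak_gradientP (in_LpB vp wp) GHp).
move=> t i tt; have vt := (weak_gradientP vp Gp).1 vG t i tt.
have wt := (weak_gradientP wp Hp).1 wH t i tt.
have bt := test_function_bounded tt; have bD := test_function_derive_bounded i tt.
under eq_Rintegral do rewrite mulrBl.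
under [in RHS]eq_Rintegral do rewrite !mxE mulrBl.
rewrite (RintegralB mO (integrable_mulbm (in_Lp_integrable vp) bD)
  (integrable_mulbm (in_Lp_integrable wp) bD)).
rewrite (RintegralB mO (integrable_mulbm (in_Lp_integrable (Gp i)) bt)
  (integrable_mulbm (in_Lp_integrable (Hp i)) bt)).
by rewrite vt wt opprK opprB addrC.
Qed.

(** [wgrad] selects an unspecified weak gradient, so identifying it with an elementwise gradient is
    possible only almost everywhere and rests on this uniqueness. *)
Lemma weak_gradient_unique v G H : in_Lp p Omega v ->
  weak_gradient p Omega v G -> weak_gradient p Omega v H ->
  {ae leb, forall x, Omega x -> G x = H x}.
Proof.
move=> vp vG vH; have [Gp _] := vG; have [Hp _] := vH.
have ae i : {ae leb, forall x, Omega x -> G x 0 i - H x 0 i = 0}.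
  apply: ae_eq0_of_test_functions => //.
    exact: (in_Lp_integrable (in_LpB (Gp i) (Hp i))).
  move=> w tw; under eq_Rintegral do rewrite mulrBl.
  have bt := test_function_bounded tw.
  rewrite (RintegralB mO (integrable_mulbm (in_Lp_integrable (Gp i)) bt)
    (integrable_mulbm (in_Lp_integrable (Hp i)) bt)).
  apply: oppr_inj; rewrite opprB oppr0 addrC -((weak_gradientP vp Gp).1 vG w i tw).
  by rewrite ((weak_gradientP vp Hp).1 vH w i tw) addNr.
have : {ae leb, forall x i, Omega x -> G x 0 i - H x 0 i = 0}.
  exact: (@filter_forall _ _ (fun (i : 'I_n) x => Omega x -> G x 0 i - H x 0 i = 0)).
apply: filterS => x h Ox; apply/rowP => i.
by apply/eqP; rewrite -subr_eq0; apply/eqP; exact: h.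
Qed.

Lemma measurable_weak_gradient v G : weak_gradient p Omega v G ->
  forall i, measurable_fun Omega (fun x => G x 0 i).
Proof. by move=> [Gp _] i; have [] := Gp i. Qed.

End sobolev_functions.

(** * Green's formula for Sobolev functions *)

Section discrete_sobolev.
Context (R : realType) (d : nat).
Local Notation n := d.+1.
Local Notation leb := (lebesgueV R n).
Context (p kappa : R) (Omega GammaD GammaN : set 'rV[R]_n) (M : mesh R n) (p1 : 1 < p).
Context (HOmega : polyhedral_lipschitz_domain Omega) (HM : triangulation kappa Omega M).
Local Notation E := 'I_(ne M).
Implicit Types (v w h : 'rV[R]_n -> R) (G H : 'rV[R]_n -> 'rV[R]_n).
Let mO : measurable Omega. Proof. exact: measurable_Omega HOmega. Qed.
Let p_neq0 : p != 0. Proof. by rewrite gt_eqF// (lt_trans _ p1). Qed.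

Lemma measurable_enorm_powR G : (forall i, measurable_fun Omega (fun x => G x 0 i)) ->
  measurable_fun Omega (fun x => (enorm (G x) `^ p)%:E).
Proof.
move=> mG; apply/measurable_EFinP; apply: (measurableT_comp (measurable_powR p)).
apply: (measurableT_comp (f := @Num.sqrt R)).
  by apply: continuous_measurable_fun; exact: sqrt_continuous.
rewrite /dotv; elim: (index_enum _) => [|i r IHr].
  by under eq_fun do rewrite big_nil; exact: measurable_cst.
under eq_fun do rewrite big_cons; apply: measurable_funD => //.
exact: measurable_funM.
Qed.

Lemma enorm0 : enorm (0 : 'rV[R]_n) = 0.
Proof. by apply/eqP; rewrite enorm_eq0. Qed.

(** Even for the zero function [wgrad] is a selected representative, known to vanish only almost
    everywhere. The result is used for constant approximating sequences. *)
Lemma W1p_norm0 : W1p_norm p Omega (fun=> 0) = 0%E.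
Proof.
have L0 : in_Lp p Omega (fun=> 0).
  exact: (bounded_in_Lp p1 HOmega (bounded_measurable_cst Omega 0)).
have w0 : weak_gradient p Omega (fun=> 0) (fun=> 0).
  apply/(weak_gradientP p1 HOmega HM L0) => [i|w i tw].
    have -> : (fun _ : 'rV[R]_n => (0 : 'rV[R]_n) 0 i) = (fun=> 0).
      by apply/funext => x; rewrite mxE.
    exact: L0.
  under eq_Rintegral do rewrite mul0r.
  under [in RHS]eq_Rintegral do rewrite mxE mul0r.
  by rewrite /Rintegral integral0 oppr0.
have W0 : W1p p Omega (fun=> 0) by split => //; exists (fun=> 0).
rewrite /W1p_norm.
rewrite (_ : (\int[leb]_(x in Omega) (`|0| `^ p)%:E = 0)%E); last first.
  by rewrite normr0 powR0// integral0.
rewrite add0e (_ : (\int[leb]_(x in Omega) _ = 0)%E).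
  by rewrite poweR0r// invr_eq0.
have wg := wgradP W0.
rewrite (@ae_eq_integral _ _ _ leb Omega (cst 0%E)) ?integral0//.
- by apply: measurable_enorm_powR; exact: measurable_weak_gradient wg.
- apply: filterS (weak_gradient_unique p1 HOmega HM L0 wg w0) => x h Ox.
  by rewrite h// enorm0 powR0.
Qed.

Section conforming_function.
Context (v : L1 M) (vS : S1D Omega GammaD M v).

Let bv := bounded_measurable_pw1 HOmega HM v.
Let vp : in_Lp p Omega (pw1 v). Proof. exact: (bounded_in_Lp p1 HOmega bv). Qed.

Lemma weak_gradient_S1D : weak_gradient p Omega (pw1 v) (pw0V (gradh v)).
Proof.
apply/(weak_gradientP p1 HOmega HM vp) => [i|w i tw].
  exact: (bounded_in_Lp p1 HOmega (bounded_measurable_pw0V HM _ i)).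
exact: (green_test_function HOmega HM vS).
Qed.

Lemma S1D_W1p : W1p p Omega (pw1 v).
Proof. by split=> //; exists (pw0V (gradh v)); exact: weak_gradient_S1D. Qed.

Lemma wgrad_S1D : {ae leb, forall x, Omega x -> wgrad p Omega (pw1 v) x = pw0V (gradh v) x}.
Proof. exact: (weak_gradient_unique p1 HOmega HM vp (wgradP S1D_W1p) weak_gradient_S1D). Qed.

Lemma S1D_W1pD : W1pD p Omega GammaD (pw1 v).
Proof.
split; first exact: S1D_W1p.
have [cv v0] := vS; exists (pw1 v); split => //; split; first by have [] := bv.
(* A conforming function is its own trace, witnessed by the constant sequence. *)
exists (fun=> pw1 v); split.
- by move=> j; split; [exact: S1D_W1p|].
- rewrite /W1p_cvg; under eq_fun do under eq_fun do rewrite subrr.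
  by under eq_fun do rewrite W1p_norm0; exact: cvg_cst.
- move=> a _; rewrite /surface_integral.
  under eq_fun do under eq_integral do rewrite subrr normr0 powR0//.
  by under eq_fun do rewrite integral0 mule0; exact: cvg_cst.
Qed.

End conforming_function.
End discrete_sobolev.

Section sobolev_green.
Context (R : realType) (d : nat).
Local Notation n := d.+1.
Local Notation leb := (lebesgueV R n).
Context (p kappa : R) (Omega GammaD GammaN : set 'rV[R]_n) (M : mesh R n) (p1 : 1 < p).
Context (HOmega : polyhedral_lipschitz_domain Omega) (HM : triangulation kappa Omega M).
Context (HGamma : boundary_partition Omega GammaD GammaN).
Local Notation E := 'I_(ne M).
Implicit Types (v w h : 'rV[R]_n -> R) (G H K : 'rV[R]_n -> 'rV[R]_n).
Let fa k : affinely_independent (@elt R n M k). Proof. by have [] := HM. Qed.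
Let mO : measurable Omega. Proof. exact: measurable_Omega HOmega. Qed.
Local Notation bm := (bounded_measurable Omega).
Local Notation nu k i := (unit_normal (elt k) i).

Lemma Rintegral_cell_support (k : E) h : (forall x, ~ cell k x -> h x = 0) ->
  \int[leb]_(x in Omega) h x = \int[leb]_(x in cell k) h x.
Proof.
move=> h0; rewrite Rintegral_mkcond [RHS]Rintegral_mkcond; congr Rintegral.
apply/funext => x; rewrite !patchE; have [kx|nkx] := pselect (cell k x).
  by rewrite !mem_set//; exact: (cell_sub HOmega HM kx).
by rewrite (h0 _ nkx); do 2?case: ifP.
Qed.

(** The j-th component of z times a bump is a test function inside the element. By the product rule,
    v z_j then has K_j z_j + v d_j z_j as derivative against the bumps. *)
Lemma sobolev_green_cell (z : L1V M) (k : E) v K :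
  {within tri k, continuous v} -> leb.-integrable Omega (EFin \o v) ->
  (forall j, leb.-integrable Omega (EFin \o (fun x => K x 0 j))) ->
  (forall w (j : 'I_n), test_function Omega w ->
    \int[leb]_(x in Omega) (v x * 'D_(unit_vec R j) w x) =
    - \int[leb]_(x in Omega) (K x 0 j * w x)) ->
  \int[leb]_(x in cell k) (dotv (restrV z k x) (K x) + \tr (z k).1 * v x) =
  \sum_i side_integral (side k i) (fun x => v x * dotv (restrV z k x) (nu k i)).
Proof.
move=> cv iv iK vK; pose zc (j : 'I_n) (x : 'rV[R]_n) : R := restrV z k x 0 j.
have mk : measurable (cell k) by exact: measurable_cell.
have kO : cell k `<=` Omega by move=> x kx; exact: (cell_sub HOmega HM kx).
have zE j : zc j = fun x => dotv (\row_l (z k).1 l j) x + (z k).2 0 j.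
  by apply/funext => x; rewrite /zc restrV_coord.
have bzc j : bump_algebra (zc j) by rewrite zE; exact: BumpAff.
have czc j : continuous (zc j) by move=> x; exact/differentiable_continuous/bump_differentiable.
have bmc g : continuous g -> bm g by exact: (bounded_measurable_continuous HM).
have ik h w : leb.-integrable Omega (EFin \o h) -> bm w ->
    leb.-integrable (cell k) (EFin \o (fun x => h x * w x)).
  by move=> ih bw; apply: (integrableS mO mk kO); exact: (integrable_mulbm HOmega).
rewrite -(@green_vector _ _ _ (fa k) v (restrV z k) (fun j : 'I_n =>
   \int[leb]_(x in cell k) (K x 0 j * zc j x + v x * (z k).1 j j))) //.
- rewrite -Rintegral_sum//; last first.
    move=> j; apply: integrable_realD => //; apply: ik => //.
      exact: bmc.
    exact: bounded_measurable_cst.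
  apply: eq_Rintegral => x _; rewrite big_split/= /dotv; congr (_ + _).
    by apply: eq_bigr => j _; rewrite mulrC.
  by rewrite mulrC mulr_sumr.
- move=> j; set chi := fun m => bump (bgrad (elt k)) (bcst (elt k)) m.
  apply: green_normal => //.
  + apply: (@within_continuousM _ _ _ v (zc j)) => //; apply: continuous_subspaceT; exact: czc.
  + apply: integrable_realD => //; apply: ik => //; first exact: bmc.
    exact: bounded_measurable_cst.
  move=> m; have bchi : bump_algebra (chi m) by exact: bump_in_algebra.
  have tt : test_function Omega (zc j \* chi m).
    apply: bump_test_function => //; apply: bounded_subset (simplex_bounded (elt k)).
    exact: polytope_simplex.
  have Dt x : 'D_(unit_vec R j) (zc j \* chi m) x =
      zc j x * 'D_(unit_vec R j) (chi m) x + (z k).1 j j * chi m x.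
    rewrite deriveM; last 2 first.
    - exact/diff_derivable/bump_differentiable.
    - exact/diff_derivable/bump_differentiable.
    rewrite {2}zE (@derive_val _ _ _ _ _ _ _ (is_derive_dotv _ _ _ _)) dotv_unit mxE.
    by rewrite /GRing.scale/= [chi m x * _]mulrC.
  have out x : ~ cell k x -> chi m x = 0 by exact: bump_polytope.
  have Dout x : ~ cell k x -> 'D_(unit_vec R j) (chi m) x = 0 by exact: derive_bump_polytope.
  have := vK _ j tt; rewrite (@Rintegral_cell_support k) => [|x kx]; last first.
    by rewrite Dt (out _ kx) (Dout _ kx) !mulr0 addr0 mulr0.
  rewrite (@Rintegral_cell_support k) => [|x kx]; last by rewrite /= (out _ kx) !mulr0.
  have bchi' : bm (chi m) by apply: bmc => x; exact/differentiable_continuous/bump_differentiable.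
  have bD : bm (fun x => 'D_(unit_vec R j) (chi m) x).
    by apply: bmc => x; apply/differentiable_continuous/bump_differentiable; exact: bump_derive.
  have i1 : leb.-integrable (cell k) (EFin \o (fun x => v x * (zc j x * 'D_(unit_vec R j) (chi m) x))).
    by apply: ik => //; apply: bounded_measurableM => //; exact: bmc.
  have i2 : leb.-integrable (cell k) (EFin \o (fun x => v x * ((z k).1 j j * chi m x))).
    by apply: ik => //; apply: bounded_measurableM => //; exact: bounded_measurable_cst.
  have i3 : leb.-integrable (cell k) (EFin \o (fun x => K x 0 j * (zc j x * chi m x))).
    by apply: (ik (fun x => K x 0 j)) => //; apply: bounded_measurableM => //; exact: bmc.
  under eq_Rintegral do rewrite Dt mulrDr.
  rewrite (RintegralD mk i1 i2) /= => e.
  transitivity (\int[leb]_(x in cell k) (v x * (zc j x * 'D_(unit_vec R j) (chi m) x))).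
    by apply: eq_Rintegral => x _; rewrite mulrA.
  transitivity (- (\int[leb]_(x in cell k) (K x 0 j * (zc j x * chi m x)) +
     \int[leb]_(x in cell k) (v x * ((z k).1 j j * chi m x)))).
    by move: e; lra.
  rewrite -(RintegralD mk i3 i2); congr (- _); apply: eq_Rintegral => x _.
  by rewrite mulrDl !mulrA.
Qed.

Lemma cvg_Rintegral_mulbm (h : nat -> 'rV[R]_n -> R) (c : 'rV[R]_n -> R) :
  (forall j, leb.-integrable Omega (EFin \o h j)) -> bm c ->
  evanescent (fun j => \int[leb]_(x in Omega) (`|h j x|)%:E)%E ->
  \int[leb]_(x in Omega) (h j x * c x) @[j --> \oo] --> 0.
Proof.
move=> ih bc h0; have [mc [C cC]] := bc.
have an j : 0 <= \int[leb]_(x in Omega) `|h j x| by apply: Rintegral_ge0.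
have inh j : leb.-integrable Omega (EFin \o (fun x => `|h j x|)).
  by have := integrable_norm (ih j).
have a0 : \int[leb]_(x in Omega) `|h j x| @[j --> \oo] --> 0.
  apply: evanescent_cvg => //; apply: evanescent_le h0 => j /=.
  by rewrite (Rintegral_fineK HOmega (inh j)).
apply: norm_cvg0; apply: (@squeeze_cvgr _ _ _ _ (cst 0) (fun j => `|C| * \int[leb]_(x in Omega) `|h j x|)).
- apply: nearW => j /=; rewrite normr_ge0/=.
  have ihc := integrable_mulbm HOmega (ih j) bc.
  apply: le_trans (le_normr_Rintegral mO ihc) _.
  rewrite -RintegralZl//; apply: le_Rintegral => //.
  + by have := integrable_norm ihc.
  + exact: integrable_realZ.
  + by move=> x Ox; rewrite normrM mulrC ler_wpM2r// (le_trans (cC x Ox))// ler_norm.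
- exact: cvg_cst.
- by rewrite -[X in _ --> X](mulr0 `|C|); apply: cvgM => //; exact: cvg_cst.
Qed.

End sobolev_green.

Section sobolev_green_RT.
Context (R : realType) (d : nat).
Local Notation n := d.+1.
Local Notation leb := (lebesgueV R n).
Context (p kappa : R) (Omega GammaD GammaN : set 'rV[R]_n) (M : mesh R n) (p1 : 1 < p).
Context (HOmega : polyhedral_lipschitz_domain Omega) (HM : triangulation kappa Omega M).
Context (HGamma : boundary_partition Omega GammaD GammaN).
Local Notation E := 'I_(ne M).
Implicit Types (k l : E) (v w h : 'rV[R]_n -> R) (G H K : 'rV[R]_n -> 'rV[R]_n).
Let fa k : affinely_independent (elt k). Proof. by have [] := HM. Qed.
Let mO : measurable Omega. Proof. exact: measurable_Omega HOmega. Qed.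
Local Notation bm := (bounded_measurable Omega).

Lemma gram_gt0 k i : 0 < Num.sqrt (\det (edges (side k i) *m (edges (side k i))^T)).
Proof.
rewrite [X in 0 < X](sqrt_gram (fa k) i) mulr_gt0//.
  by rewrite normr_gt0 -unitfE -unitmxE side_frame_unit.
by rewrite lt_neqAle eq_sym enorm_eq0 bgrad_neq0// enorm_ge0.
Qed.

Lemma coord_le_enorm (x : 'rV[R]_n) i : `|x 0 i| <= enorm x.
Proof.
rewrite -sqrtr_sqr; apply: ler_wsqrtr; rewrite /dotv (bigD1 i)//= expr2 lerDl.
by apply: sumr_ge0 => j _; rewrite -expr2 sqr_ge0.
Qed.

(** The norm dominates the function and each gradient component separately, and L^1 convergence is
    what pairing with the bounded fields z and div z requires. *)
Lemma W1p_cvg_evanescent (vs : nat -> 'rV[R]_n -> R) u : W1p_cvg p Omega vs u ->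
  (forall j, W1p p Omega (vs j)) -> W1p p Omega u ->
  evanescent (fun j => \int[leb]_(x in Omega) (`|vs j x - u x|)%:E)%E /\
  forall i, evanescent (fun j =>
    \int[leb]_(x in Omega) (`|wgrad p Omega (fun x => vs j x - u x) x 0 i|)%:E)%E.
Proof.
move=> vsu Wvs Wu; have p0 : 0 < p by exact: lt_trans p1.
have Ofin := Omega_lty HOmega.
have Wd j : W1p p Omega (fun x => vs j x - u x).
  have [Lv [G vG]] := Wvs j; have [Lu [H uH]] := Wu.
  split; first exact: (in_LpB p1 HOmega Lv Lu).
  by exists (fun x => G x - H x); exact: (weak_gradientB p1 HOmega HM Lv Lu vG uH).
pose g j := wgrad p Omega (fun x => vs j x - u x).
have wg j := wgradP (Wd j).
have mg j i : measurable_fun Omega (fun x => g j x 0 i) by exact: measurable_weak_gradient (wg j) i.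
pose a j := (\int[leb]_(x in Omega) (`|vs j x - u x| `^ p)%:E)%E.
pose b j := (\int[leb]_(x in Omega) (enorm (g j x) `^ p)%:E)%E.
have a0 j : (0 <= a j)%E by apply: integral_ge0 => x _; rewrite lee_fin powR_ge0.
have b0 j : (0 <= b j)%E by apply: integral_ge0 => x _; rewrite lee_fin powR_ge0.
have ab : evanescent (fun j => a j + b j)%E.
  apply: (@evanescent_poweR _ p^-1); rewrite ?invr_gt0//.
    by move=> j; exact: (adde_ge0 (a0 j) (b0 j)).
  exact: cvg_evanescent vsu.
split => [|i].
  apply: (evanescent_Lp_L1 mO Ofin p1) => [j|]; first by have [[]] := Wd j.
  by apply: evanescent_le ab => j; rewrite leeDl.
apply: (evanescent_Lp_L1 mO Ofin p1 (h := fun j x => g j x 0 i)) => [j|]; first exact: mg.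
apply: evanescent_le ab => j; apply: (@le_trans _ _ (b j)); last by rewrite leeDr.
apply: ge0_le_integral => //.
- apply/measurable_EFinP; apply: (measurableT_comp (measurable_powR p)).
  by apply: measurableT_comp => //; exact: mg.
- by apply: measurable_enorm_powR => i'; exact: mg.
- move=> x _; rewrite lee_fin; apply: ge0_ler_powR; rewrite ?nnegrE ?enorm_ge0//.
    exact: ltW.
  exact: coord_le_enorm.
Qed.

(** The trace g vanishes on the side, so convergence to g in L^p there means convergence of the
    approximants to 0, once the positive Gram factor is divided out. *)
Lemma trace_cvg (vs : nat -> 'rV[R]_n -> R) (g : 'rV[R]_n -> R) k i :
  (forall j, {within closure Omega, continuous (vs j)}) ->
  (forall a : 'I_n -> 'rV[R]_n, simplex a `<=` boundary Omega ->
     (fun j => surface_integral a (fun x => (`|vs j x - g x| `^ p)%:E)) @ \oo --> 0%E) ->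
  (forall x, GammaD x -> g x = 0) -> simplex (side k i) `<=` GammaD ->
  side_integral (side k i) (vs j) @[j --> \oo] --> 0.
Proof.
move=> cvs tr g0 sD; have p0 : 0 < p by exact: lt_trans p1.
have [bE _ _] := HGamma; have sb : simplex (side k i) `<=` boundary Omega.
  by move=> x /sD Dx; rewrite bE; left.
have cs j : {within simplex (side k i), continuous (vs j)}.
  apply: continuous_subspaceW (cvs j) => x sx; exact: (sb _ sx).1.
have mr := @measurable_ref_simplex R d.
have ms j := measurable_param (cs j).
have ivs j := integrable_param (cs j).
have e0 : evanescent (fun j => \int[lebesgueV R d]_(xi in ref_simplex d)
    (`|vs j (param (side k i) xi)| `^ p)%:E)%E.
  apply: evanescentZ (gram_gt0 k i) _.
  have := cvg_evanescent (tr _ sb); apply: evanescent_le => j.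
  rewrite /surface_integral lee_pmul2l ?lte_fin ?gram_gt0//.
  rewrite le_eqVlt; apply/orP; left; apply/eqP; apply: eq_integral => xi /set_mem rxi.
  rewrite g0 ?subr0//; apply: sD; apply/simplex_paramP; by exists xi.
have e1 := evanescent_Lp_L1 mr (ref_simplex_lty R d) p1 ms e0.
have an j : 0 <= \int[lebesgueV R d]_(xi in ref_simplex d) `|vs j (param (side k i) xi)|.
  by apply: Rintegral_ge0.
have a0 : \int[lebesgueV R d]_(xi in ref_simplex d) `|vs j (param (side k i) xi)| @[j --> \oo] --> 0.
  apply: evanescent_cvg => //; apply: evanescent_le e1 => j /=.
  rewrite /Rintegral fineK//; apply: integrable_fin_num => //.
  exact: (integrable_norm (ivs j)).
rewrite /side_integral -[X in _ --> X](mulr0 (Num.sqrt (\det (edges (side k i) *m (edges (side k i))^T)))).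
apply: cvgM; first exact: cvg_cst.
apply: norm_cvg0; apply: (@squeeze_cvgr _ _ _ _ (cst 0) _ _ _ _ _ a0); last exact: cvg_cst.
apply: nearW => j /=; rewrite normr_ge0/=; exact: (le_normr_Rintegral mr (ivs j)).
Qed.

Lemma cvg_sum0 (I : finType) (F : I -> nat -> R) : (forall i, F i @ \oo --> 0) ->
  \sum_i F i j @[j --> \oo] --> 0.
Proof.
move=> F0; have := @cvg_bigsum _ _ \oo eventually_filter _ (index_enum I) F (fun=> 0) F0.
by rewrite big1.
Qed.

(** The identity is proved for the continuous approximants up to terms on unshared sides, where
    either the flux is zero or the side integrals tend to 0. The volume terms pass to the limit by
    L^1 convergence. *)
Lemma sobolev_green (u : 'rV[R]_n -> R) (z : L1V M) :
  W1pD p Omega GammaD u -> RT Omega GammaN M z ->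
  \int[leb]_(x in Omega) (dotv (pw1V z x) (wgrad p Omega u x) + pw0 (divh z) x * u x) = 0.
Proof.
move=> [Wu [g [[_ [vs [Wvs vsu tr]]] g0]]] zRT.
have [h1 h2] := W1p_cvg_evanescent vsu (fun j => (Wvs j).1) Wu.
pose G := wgrad p Omega u; pose H j := wgrad p Omega (fun x => vs j x - u x).
have Lu : in_Lp p Omega u by have [] := Wu.
have Lvs j : in_Lp p Omega (vs j) by have [[]] := Wvs j.
have Ld j := in_LpB p1 HOmega (Lvs j) Lu.
have uG : weak_gradient p Omega u G by exact: wgradP.
have dH j : weak_gradient p Omega (fun x => vs j x - u x) (H j).
  apply: wgradP; split; first exact: Ld.
  have [[_ [G' vG']] _] := Wvs j; exists (fun x => G' x - G x).
  exact: (weak_gradientB p1 HOmega HM (Lvs j) Lu vG' uG).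
have iL h : in_Lp p Omega h -> leb.-integrable Omega (EFin \o h).
  exact: (in_Lp_integrable p1 HOmega).
have iG i : leb.-integrable Omega (EFin \o (fun x => G x 0 i)) by exact: (iL _ (uG.1 i)).
have iH j i : leb.-integrable Omega (EFin \o (fun x => H j x 0 i)) by exact: (iL _ ((dH j).1 i)).
(* A weak gradient of [vs j] built by addition; with it, rather than with [wgrad] of [vs j], the
   splitting [XD] is exact. *)
pose K j x := G x + H j x.
have KE j (i : 'I_n) : (fun x => K j x 0 i) = (fun x => G x 0 i + H j x 0 i).
  by apply/funext => x; rewrite mxE.
have iK j i : leb.-integrable Omega (EFin \o (fun x => K j x 0 i)).
  by rewrite KE; exact: (integrable_realD mO (iG i) (iH j i)).
have vK j w (i : 'I_n) : test_function Omega w ->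
    \int[leb]_(x in Omega) (vs j x * 'D_(unit_vec R i) w x) =
    - \int[leb]_(x in Omega) (K j x 0 i * w x).
  move=> tw; have bw := test_function_bounded HM tw.
  have bD := test_function_derive_bounded HM i tw.
  have e1 := (weak_gradientP p1 HOmega HM Lu uG.1).1 uG w i tw.
  have e2 := (weak_gradientP p1 HOmega HM (Ld j) (dH j).1).1 (dH j) w i tw.
  transitivity (\int[leb]_(x in Omega) (u x * 'D_(unit_vec R i) w x) +
      \int[leb]_(x in Omega) ((vs j x - u x) * 'D_(unit_vec R i) w x)).
    rewrite -(RintegralD mO (integrable_mulbm HOmega (iL _ Lu) bD)
      (integrable_mulbm HOmega (iL _ (Ld j)) bD)).
    by apply: eq_Rintegral => x _; ring.
  rewrite e1 e2 -opprD -(RintegralD mO (integrable_mulbm HOmega (iG i) bw)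
      (integrable_mulbm HOmega (iH j i) bw)).
  by congr (- _); apply: eq_Rintegral => x _; rewrite mxE; ring.
have bz i : bm (fun x => pw1V z x 0 i) by exact: (bounded_measurable_pw1V HOmega HM).
have bdiv : bm (pw0 (divh z)) by exact: (bounded_measurable_pw0 HM).
have clS k : tri k `<=` closure Omega by exact: (tri_closure HM).
have cside j k i : {within simplex (side k i), continuous (vs j)}.
  by apply: continuous_subspaceW (Wvs j).2 => x /(sideP HM)[/clS].
have ipair (w : 'rV[R]_n -> R) (W : 'rV[R]_n -> 'rV[R]_n) : leb.-integrable Omega (EFin \o w) ->
    (forall i, leb.-integrable Omega (EFin \o (fun x => W x 0 i))) ->
    leb.-integrable Omega (EFin \o (fun x => dotv (pw1V z x) (W x))) /\
    leb.-integrable Omega (EFin \o (fun x => pw0 (divh z) x * w x)).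
  move=> iw iW; split; last first.
    under eq_fun do rewrite mulrC.
    exact: (integrable_mulbm HOmega iw bdiv).
  apply: integrable_real_sum => // i; under eq_fun do rewrite mulrC.
  exact: (integrable_mulbm HOmega (iW i) (bz i)).
pose X (w : 'rV[R]_n -> R) (W : 'rV[R]_n -> 'rV[R]_n) := \int[leb]_(x in Omega) (dotv (pw1V z x) (W x) + pw0 (divh z) x * w x).
have XE (w : 'rV[R]_n -> R) (W : 'rV[R]_n -> 'rV[R]_n) : leb.-integrable Omega (EFin \o w) ->
    (forall i, leb.-integrable Omega (EFin \o (fun x => W x 0 i))) ->
    X w W = \sum_i \int[leb]_(x in Omega) (W x 0 i * pw1V z x 0 i) +
            \int[leb]_(x in Omega) (w x * pw0 (divh z) x).
  move=> iw iW; have [i1 i2] := ipair _ _ iw iW.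
  rewrite /X (RintegralD mO i1 i2); congr (_ + _).
    rewrite -Rintegral_sum//; last by move=> i; exact: (integrable_mulbm HOmega (iW i) (bz i)).
    by apply: eq_Rintegral => x _; apply: eq_bigr => i _; rewrite mulrC.
  by apply: eq_Rintegral => x _; rewrite mulrC.
have XD j : X (vs j) (K j) = X u G + X (fun x => vs j x - u x) (H j).
  have [a1 a2] := ipair _ _ (iL _ Lu) iG.
  have [b1 b2] := ipair _ _ (iL _ (Ld j)) (iH j).
  rewrite /X -(RintegralD mO (integrable_realD mO a1 a2) (integrable_realD mO b1 b2)).
  by apply: eq_Rintegral => x _; rewrite /K dotvDr; ring.
pose b j k i := flux z k i * side_integral (side k i) (vs j).
have Xb j : X (vs j) (K j) = \sum_k \sum_i b j k i.
  have [i1 i2] := ipair _ _ (iL _ (Lvs j)) (iK j).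
  rewrite /X (Rintegral_cells HOmega HM (integrable_realD mO i1 i2)); apply: eq_bigr => k _.
  rewrite (eq_bigr _ (fun i _ => esym (side_integral_flux HM zRT (cside j k i)))).
  rewrite -(sobolev_green_cell HOmega HM z (K := K j))//.
  - by apply: eq_Rintegral_cell => x kx; rewrite /pw1V /pw0 !(piecewise_cell HM _ _ kx).
  - apply: continuous_subspaceW (Wvs j).2; exact: clS.
  - exact: (iL _ (Lvs j)).
  - exact: vK.
(* The shared sides cancel for each j, by continuity of [vs j]; only the unshared part [b'']
   requires a limit. *)
pose b' j k i := if `[< unshared k i >] then 0 else b j k i.
pose b'' j k i := if `[< unshared k i >] then b j k i else 0.
have sb' j : \sum_k \sum_i b' j k i = 0.
  apply: (sum_sides_cancel HM) => [k l i m kl e|k i /asboolP]; last by rewrite /b' => ->.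
  rewrite /b'; case: asboolP => [/(_ l m kl)//|_]; case: asboolP => [/(_ k i)|_].
    by rewrite eq_sym => /(_ kl); rewrite e.
  rewrite /b (side_integral_reparam (side_free HM k i) (side_free HM l m) e (cside j k i)).
  by rewrite -mulrDl (flux_shared HM zRT kl e) mul0r.
have bb j : \sum_k \sum_i b j k i = \sum_k \sum_i b'' j k i.
  transitivity (\sum_k (\sum_i b' j k i + \sum_i b'' j k i)).
    apply: eq_bigr => k _; rewrite -big_split; apply: eq_bigr => i _ /=; rewrite /b' /b''.
    by case: ifP; rewrite ?add0r ?addr0.
  by rewrite big_split /= sb' add0r.
have b0 : \sum_k \sum_i b'' j k i @[j --> \oo] --> 0.
  apply: (@cvg_sum0 _ (fun k j => \sum_i b'' j k i)) => k.
  apply: (@cvg_sum0 _ (fun i j => b'' j k i)) => i.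
  rewrite /b''; case: asboolP => [us|_]; last exact: cvg_cst.
  have [z0|sD] := flux_unshared HOmega HM HGamma zRT us.
    by rewrite /b z0; under eq_fun do rewrite mul0r; exact: cvg_cst.
  rewrite -[X in _ --> X](mulr0 (flux z k i)); apply: cvgM; first exact: cvg_cst.
  exact: (trace_cvg (fun j => (Wvs j).2) tr g0 sD).
have Y0 : X (fun x => vs j x - u x) (H j) @[j --> \oo] --> 0.
  have -> : (fun j => X (fun x => vs j x - u x) (H j)) =
      (fun j => \sum_i \int[leb]_(x in Omega) (H j x 0 i * pw1V z x 0 i) +
        \int[leb]_(x in Omega) ((vs j x - u x) * pw0 (divh z) x)).
    by apply/funext => j; exact: (XE _ _ (iL _ (Ld j)) (iH j)).
  rewrite -[X in _ --> X]addr0; apply: cvgD.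
    apply: (@cvg_sum0 _ (fun i j => \int[leb]_(x in Omega) (H j x 0 i * pw1V z x 0 i))) => i.
    exact: (cvg_Rintegral_mulbm HOmega (fun j => iH j i) (bz i) (h2 i)).
  exact: (cvg_Rintegral_mulbm HOmega (fun j => iL _ (Ld j)) bdiv h1).
have : X u G @[j --> \oo] --> 0.
  rewrite -[X in _ --> X]subr0; have -> : (fun=> X u G) =
      (fun j => \sum_k \sum_i b'' j k i - X (fun x => vs j x - u x) (H j)).
    by apply/funext => j; rewrite -bb -Xb XD addrK.
  exact: cvgB.
by move=> h; have /(_ _) := cvg_lim (@Rhausdorff R) h; rewrite lim_cst//; apply.
Qed.

End sobolev_green_RT.

(** * The error estimate *)

Section minorized_integrals.
Context dd (T : measurableType dd) (R : realType) (mu : {measure set T -> \bar R}).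
Context (D : set T) (mD : measurable D).
Implicit Types (A B : T -> \bar R) (m : T -> R).
Local Open Scope ereal_scope.

(** An integrable minorant keeps the integral away from -oo, so that sums of such integrals are
    never of the form oo - oo, even when some of them diverge. *)
Definition minorized A := measurable_fun D A /\
  exists2 m : T -> R, mu.-integrable D (EFin \o m) & forall x, D x -> (m x)%:E <= A x.

Lemma minorized_integrable A : minorized A ->
  mu.-integrable D A \/ \int[mu]_(x in D) A x = +oo.
Proof.
move=> [mA [m im mA0]].
have neg : \int[mu]_(x in D) A^\- x < +oo.
  have /integrableP[_] := im; apply: le_lt_trans; apply: ge0_le_integral => //.
  - exact: measurable_funeneg.
  - by apply: measurableT_comp => //; exact: measurable_int im.
  - move=> x Dx; rewrite funenegE ge_max abse_ge0 andbT.
    apply: (@le_trans _ _ (- (m x)%:E)); first by rewrite leeN2; exact: mA0.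
    by rewrite -EFinN lee_fin ler_normr lexx orbT.
have negfin : \int[mu]_(x in D) A^\- x \is a fin_num.
  by rewrite ge0_fin_numE//; apply: integral_ge0.
have [pos|pos] := ltP (\int[mu]_(x in D) A^\+ x) +oo.
  left; apply/integrableP; split => //.
  rewrite (_ : (fun x => `|A x|) = A^\+ \+ A^\-); last by rewrite -fune_abse.
  rewrite ge0_integralD//; last 2 first.
  - exact: measurable_funepos.
  - exact: measurable_funeneg.
  exact: lte_add_pinfty.
right; rewrite integralE; move: pos; rewrite leye_eq => /eqP ->.
by rewrite -(fineK negfin).
Qed.

Lemma minorized_neq_ninfty A : minorized A -> \int[mu]_(x in D) A x != -oo.
Proof.
move=> /minorized_integrable[iA|->//].
by have := integrable_fin_num mD iA; rewrite fin_numE => /andP[].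
Qed.

Lemma minorizedD A B : minorized A -> minorized B -> minorized (fun x => A x + B x).
Proof.
move=> [mA [m im mA0]] [mB [m' im' mB0]]; split; first exact: emeasurable_funD.
exists (fun x => (m x + m' x)%R); first exact: integrable_realD.
by move=> x Dx; rewrite EFinD leeD// ?mA0 ?mB0.
Qed.

Lemma minorized_EFin m : mu.-integrable D (EFin \o m) -> minorized (EFin \o m).
Proof. by move=> im; split; [exact: measurable_int im|exists m]. Qed.

Lemma integrable_minorizedD A B : minorized A -> minorized B ->
  mu.-integrable D (fun x => A x + B x) -> mu.-integrable D A.
Proof.
move=> [mA [m im mA0]] [mB [m' im' mB0]] iAB.
have i1 := integrable_abse iAB; have i2 := integrable_abse im; have i3 := integrable_abse im'.
apply: (le_integrable mD mA _ (integrableD mD i1 (integrableD mD i2 i3))).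
move=> x Dx /=; have := mA0 x Dx; have := mB0 x Dx.
case: (A x) => [a| |]; case: (B x) => [b| |]; rewrite ?leey//= ?leeNy_eq// !lee_fin => h1 h2.
rewrite [leRHS]ger0_norm ?addr_ge0//.
have := ler_norm (m x); have := ler_norm (m' x); have := ler_norm (- m x); have := ler_norm (- m' x).
have := ler_norm (a + b)%R; have := ler_norm (- (a + b))%R; rewrite !normrN => *.
by rewrite ler_norml; apply/andP; split; lra.
Qed.

Lemma integralD_minorized A B : minorized A -> minorized B ->
  \int[mu]_(x in D) (A x + B x) = \int[mu]_(x in D) A x + \int[mu]_(x in D) B x.
Proof.
move=> hA hB; have [iAB|AB] := minorized_integrable (minorizedD hA hB).
  have iA := integrable_minorizedD hA hB iAB.
  have iB : mu.-integrable D B.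
    apply: (integrable_minorizedD hB hA).
    by rewrite (_ : (fun x => B x + A x) = (fun x => A x + B x))//; apply/funext => x; rewrite addeC.
  exact: integralD.
rewrite AB; have nA := minorized_neq_ninfty hA; have nB := minorized_neq_ninfty hB.
have [iA|->] := minorized_integrable hA; last by rewrite addye.
have [iB|->] := minorized_integrable hB; last by rewrite addey.
(* Finite integrals of A and B would contradict the infinite integral of the sum. *)
have := integralD mD iA iB; rewrite AB => e.
have := fin_numD (\int[mu]_(x in D) A x) (\int[mu]_(x in D) B x).
by rewrite -e !integrable_fin_num.
Qed.

Lemma le_integral_minorized A m : minorized A -> mu.-integrable D (EFin \o m) ->
  (forall x, D x -> (m x)%:E <= A x) ->
  (\int[mu]_(x in D) m x)%R%:E <= \int[mu]_(x in D) A x.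
Proof.
move=> hA im mA; rewrite /Rintegral fineK; last exact: integrable_fin_num.
have [iA|->] := minorized_integrable hA; last by rewrite leey.
by apply: le_integral => // x /set_mem Dx; exact: mA.
Qed.

Lemma eq_minorized A B : (forall x, D x -> A x = B x) -> minorized A -> minorized B.
Proof.
move=> AB [mA [m im mA0]]; split.
  by apply: eq_measurable_fun mA => x /set_mem Dx; rewrite AB.
by exists m => // x Dx; rewrite -AB//; exact: mA0.
Qed.

End minorized_integrals.

(** * Fenchel conjugates *)

Section fenchel_conjugate.
Context (R : realType) (n : nat) (phi : 'rV[R]_n -> \bar R).
Context (phi_proper : proper_fun phi).
Local Open Scope ereal_scope.

Lemma fenchel_ge s x : (dotv s x)%:E - phi x <= fenchel phi s.
Proof. by apply: ereal_sup_ubound; exists x. Qed.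

Lemma proper_point : exists x0 (r0 : R), phi x0 = r0%:E.
Proof.
have [n0 [x0 x0y]] := phi_proper; exists x0, (fine (phi x0)).
by rewrite fineK// fin_numElt x0y ltNye n0.
Qed.

Lemma fenchel_neq_ninfty s : fenchel phi s != -oo.
Proof.
have [x0 [r0 e]] := proper_point; have := fenchel_ge s x0; rewrite e.
by case: (fenchel phi s).
Qed.

Lemma fenchel_young s x : (dotv s x)%:E <= phi x + fenchel phi s.
Proof.
have := fenchel_ge s x; have := fenchel_neq_ninfty s.
have [n0 _] := phi_proper; have := n0 x.
case: (phi x) => [a| |]; case: (fenchel phi s) => [b| |]//= _ _; rewrite ?leey//.
by rewrite -EFinB -EFinD !lee_fin; lra.
Qed.

(** A supremum of affine functions, where the points with [phi] equal to +oo contribute only -oo. It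
    provides measurability of the conjugate along a vector field. *)
Lemma fenchel_lsc : lower_semicontinuous (fenchel phi).
Proof.
move=> s a; rewrite /fenchel => /ereal_sup_gt[_ [x _ <-]].
have [n0 _] := phi_proper; have := n0 x; have := fenchel_ge ^~ x.
case: (phi x) => [r| |]//= fg _.
rewrite -EFinB lte_fin => h.
have : \forall t \near s, (a < dotv t x - r)%R.
  have c : (fun t => dotv t x - r)%R @ s --> (dotv s x - r)%R.
    under eq_fun do rewrite dotvC.
    by rewrite dotvC; exact: continuous_affine.
  exact: (@cvgr_gt _ _ (nbhs s) _ _ _ c).
move=> nt; exists [set t | (a < dotv t x - r)%R] => // t /= at_.
by apply: lt_le_trans (fg t); rewrite -EFinB lte_fin.
Qed.

End fenchel_conjugate.

Lemma measurable_comp_rV (R : realType) n (D : set 'rV[R]_n) (F : 'rV[R]_n -> \bar R)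
    (G : 'rV[R]_n -> 'rV[R]_n) : measurable D -> measurable_fun setT F ->
  (forall i, measurable_fun D (fun x => G x 0 i)) -> measurable_fun D (F \o G).
Proof.
(* G is extended by 0 outside D, coordinate by coordinate, to become measurable on the whole
   space. *)
move=> mD mF mG; pose H x : 'rV[R]_n := \row_i ((fun y => G y 0 i) \_ D) x.
have mH : measurable_fun setT H.
  apply: measurable_fun_rV => i; under eq_fun do rewrite mxE.
  exact: (measurable_restrictT _ mD).1.
apply: (@eq_measurable_fun _ _ _ _ D (F \o H)).
  move=> x Dx /=; congr F; apply/rowP => i.
  by rewrite mxE patchE Dx.
apply: measurable_funS (measurableT_comp mF mH) => //.
Qed.

Section piecewise_integrands.
Context (R : realType) (d : nat).
Local Notation n := d.+1.
Local Notation leb := (lebesgueV R n).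
Context (kappa : R) (Omega : set 'rV[R]_n) (M : mesh R n).
Context (HOmega : polyhedral_lipschitz_domain Omega) (HM : triangulation kappa Omega M).
Local Notation E := 'I_(ne M).
Let mO : measurable Omega. Proof. exact: measurable_Omega HOmega. Qed.
Local Notation bm := (bounded_measurable Omega).
Local Open Scope ereal_scope.

Lemma piecewise_Omega x : Omega x ->
  exists k, forall (A : Type) (a0 : A) (F : E -> 'rV[R]_n -> A), piecewise a0 F x = F k x.
Proof.
move=> Ox; have [k kx _] := sub_cells HM Ox; rewrite /piecewise.
by case: pickP => [l _|/(_ k)/asboolP//]; exists l.
Qed.

Lemma element_exists : exists k : E, True.
Proof.
have [_ [x Ox] _ _ _] := HOmega.
by have [k _ _] := sub_cells HM Ox; exists k.
Qed.

Lemma minorized_piecewise (a0 : \bar R) (F : E -> \bar R) :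
  a0 != -oo -> (forall k, F k != -oo) ->
  minorized leb Omega (piecewise a0 (fun k _ => F k)).
Proof.
move=> h0 hF; have fineP (y : \bar R) : y != -oo -> (fine y)%:E <= y.
  by case: y => [r| |]// _; rewrite leey.
split.
  apply: (@measurable_funS _ _ _ _ setT) => //.
  by apply: (measurable_piecewise HM) => k; exact: measurable_cst.
(* [fine] maps +oo to 0, so the finitely many real values obtained form a bounded minorant. *)
exists (piecewise (fine a0) (fun k _ => fine (F k))).
  apply: (bounded_measurable_integrable HOmega).
  by apply: (bounded_measurable_piecewise HM) => k; exact: bounded_measurable_cst.
move=> x _; rewrite /piecewise; case: pickP => [k _|_]; exact: fineP.
Qed.

(** Each open element has positive measure, so a single infinite value would make the integral
    infinite. *)
Lemma piecewise_finite (a0 : \bar R) (F : E -> \bar R) :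
  a0 != -oo -> (forall k, F k != -oo) ->
  \int[leb]_(x in Omega) piecewise a0 (fun k _ => F k) x \is a fin_num ->
  forall k, F k \is a fin_num.
Proof.
move=> h0 hF fin k; have [iF|h] := minorized_integrable mO (minorized_piecewise h0 hF).
  have [N [mN N0 NF]] := integrable_ae mO iF.
  rewrite fin_numE hF/=; apply/negP => /eqP Fy.
  have kN : cell k `<=` N.
    move=> x kx; apply: NF => /= /(_ (cell_sub HOmega HM kx)).
    by rewrite (piecewise_cell HM _ _ kx) Fy.
  have : leb (cell k) <= leb N by apply: le_measure; rewrite ?inE//; exact: measurable_cell.
  by rewrite N0 leNgt (cell_gt0 HM).
by rewrite h in fin.
Qed.

Lemma linear_conjugate (c s : R) :
  ereal_sup [set (s * t)%:E - (- c * t)%:E | t in [set: R]] =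
  if s == (- c)%R then 0 else +oo.
Proof.
have [->|sc] := eqVneq s (- c)%R.
  rewrite (_ : [set _ | _ in _] = [set 0]) ?ereal_sup1//.
  apply/seteqP; split => [_ [t _ <-]|_ ->] /=; last by exists 0%R; rewrite // !mulr0 sube0.
  by rewrite -EFinB subrr.
have sc0 : (s + c != 0)%R by rewrite addr_eq0.
(* The slope s + c is nonzero, so this t gives the objective the prescribed value r. *)
apply/eqyP => r r0; apply: ereal_sup_ubound; exists (r / (s + c))%R => //.
by rewrite -EFinB; congr _%:E; field.
Qed.

Lemma psi_conjE (f : L0 M) (z : L1V M) x : psi_conj f x (pw0 (divh z) x) =
  piecewise 0 (fun k _ => if divh z k == (- f k)%R then 0 else +oo) x.
Proof.
rewrite /psi_conj /psi /pw0 /piecewise linear_conjugate.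
(* Off the elements f and div z both take the default 0, where the conjugate is 0. *)
by case: pickP => [k _//|_]; rewrite oppr0 eqxx.
Qed.

End piecewise_integrands.

(** * Consequences of strong duality *)

Section duality.
Context (R : realType) (d : nat).
Local Notation n := d.+1.
Local Notation leb := (lebesgueV R n).
Context (p kappa : R) (Omega GammaD GammaN : set 'rV[R]_n) (M : mesh R n) (p1 : (1 < p)%R).
Context (HOmega : polyhedral_lipschitz_domain Omega) (HM : triangulation kappa Omega M).
Context (HGamma : boundary_partition Omega GammaD GammaN).
Context (phi : 'rV[R]_n -> \bar R) (f : L0 M) (phi_proper : proper_fun phi).
Context (phi_lsc : lower_semicontinuous phi).
Local Notation E := 'I_(ne M).
Let mO : measurable Omega. Proof. exact: measurable_Omega HOmega. Qed.
Local Notation bm := (bounded_measurable Omega).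
Local Open Scope ereal_scope.

Let phiNy x : phi x != -oo. Proof. by have [] := phi_proper. Qed.
Let fphiNy s : fenchel phi s != -oo. Proof. exact: fenchel_neq_ninfty. Qed.

Lemma minorized_phi_pw0V (c : L0V M) : minorized leb Omega (fun x => phi (pw0V c x)).
Proof.
apply: eq_minorized (minorized_piecewise HOmega HM (phiNy 0) (fun k => phiNy (c k))) => x _.
by rewrite /pw0V (piecewise_map phi).
Qed.

Lemma phi_pw0V_finite (c : L0V M) : \int[leb]_(x in Omega) phi (pw0V c x) \is a fin_num ->
  forall k, phi (c k) \is a fin_num.
Proof.
move=> fin; apply: (piecewise_finite HOmega HM (phiNy 0) (fun k => phiNy (c k))).
by under eq_integral do rewrite -[phi 0]/(phi 0) -(piecewise_map phi).
Qed.

Lemma minorized_fenchel_pw0V (c : L0V M) : minorized leb Omega (fun x => fenchel phi (pw0V c x)).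
Proof.
apply: eq_minorized (minorized_piecewise HOmega HM (fphiNy 0) (fun k => fphiNy (c k))) => x _.
by rewrite /pw0V (piecewise_map (fenchel phi)).
Qed.

Lemma fenchel_pw0V_finite (c : L0V M) :
  \int[leb]_(x in Omega) fenchel phi (pw0V c x) \is a fin_num ->
  forall k, fenchel phi (c k) \is a fin_num.
Proof.
move=> fin; apply: (piecewise_finite HOmega HM (fphiNy 0) (fun k => fphiNy (c k))).
by under eq_integral do rewrite -(piecewise_map (fenchel phi)).
Qed.

Lemma Rintegral_Pih (v : L1 M) :
  \int[leb]_(x in Omega) (pw0 f x * pw0 (Pih Omega v) x)%:E =
  (\int[leb]_(x in Omega) (pw0 f x * pw1 v x))%R%:E.
Proof.
have bf := bounded_measurable_pw0 HM f.
rewrite (Rintegral_fineK HOmega); last first.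
  apply: (bounded_measurable_integrable HOmega); apply: bounded_measurableM => //.
  exact: (bounded_measurable_pw0 HM).
congr _%:E; transitivity (\int[leb]_(x in Omega) (pw0 (Pih Omega v) x * pw0 f x))%R.
  by apply: eq_Rintegral => x _; rewrite mulrC.
rewrite (Pi0P HOmega HM f (bounded_measurable_pw1 HOmega HM v)).
by apply: eq_Rintegral => x _; rewrite mulrC.
Qed.

(** The primal side is never -oo and the dual side never +oo, so their equality makes all three
    integrals finite. As the integrands are piecewise constant, they are finite on every element,
    which for [psi_conj] means div z = - f. *)
Lemma strong_duality_finite (v : L1 M) (z : L1V M) :
  primal_cr Omega phi f v = dual_rt Omega phi f z ->
  [/\ forall k, divh z k = (- f k)%R, forall k, phi (gradh v k) \is a fin_num,
      forall k, fenchel phi (PihV Omega z k) \is a fin_num &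
      \int[leb]_(x in Omega) phi (pw0V (gradh v) x) +
      \int[leb]_(x in Omega) fenchel phi (pw0V (PihV Omega z) x) =
      (\int[leb]_(x in Omega) (pw0 f x * pw1 v x))%R%:E].
Proof.
rewrite /primal_cr /dual_rt Rintegral_Pih.
pose F k : \bar R := if divh z k == (- f k)%R then 0 else +oo.
have FNy k : F k != -oo by rewrite /F; case: ifP.
have psiE : \int[leb]_(x in Omega) psi_conj f x (pw0 (divh z) x) =
    \int[leb]_(x in Omega) piecewise 0 (fun k _ => F k) x.
  by apply: eq_integral => x _; rewrite psi_conjE.
rewrite psiE => sd.
have nA := minorized_neq_ninfty mO (minorized_phi_pw0V (gradh v)).
have nB := minorized_neq_ninfty mO (minorized_fenchel_pw0V (PihV Omega z)).
have nC := minorized_neq_ninfty mO (minorized_piecewise HOmega HM (erefl : 0 != -oo :> \bar R) FNy).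
have F0 : \int[leb]_(x in Omega) piecewise 0 (fun k _ => F k) x \is a fin_num -> forall k, F k = 0.
  move=> /(piecewise_finite HOmega HM (erefl : 0 != -oo :> \bar R) FNy) h k.
  by have := h k; rewrite /F; case: ifP.
have A0 := @phi_pw0V_finite (gradh v); have B0 := @fenchel_pw0V_finite (PihV Omega z).
set A := \int[leb]_(x in Omega) phi _ in sd nA A0 *.
set B := \int[leb]_(x in Omega) fenchel phi _ in sd nB B0 *.
set C := \int[leb]_(x in Omega) piecewise _ _ _ in sd nC F0 *.
have [fA fB fC] : [/\ A \is a fin_num, B \is a fin_num & C \is a fin_num].
  move: A B C sd nA nB nC {A0 B0 F0} => A B C.
  by case: A => [a| |]//; case: B => [b| |]//; case: C => [c| |].
have C0 : C = 0.
  transitivity (\int[leb]_(x in Omega) (0 : \bar R)); last exact: integral0.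
  apply: eq_integral => x _; rewrite /piecewise.
  by case: pickP => // k _; exact: F0.
split.
- by move=> k; have := F0 fC k; rewrite /F; case: eqP.
- exact: A0.
- exact: B0.
by move: sd; rewrite C0 sube0 -(fineK fA) -(fineK fB) -EFinB -EFinN -EFinD => -[sd]; congr _%:E; lra.
Qed.

End duality.

(** * Energies and the estimator for an equilibrated flux *)

Section error_estimate.
Context (R : realType) (d : nat).
Local Notation n := d.+1.
Local Notation leb := (lebesgueV R n).
Context (p kappa : R) (Omega GammaD GammaN : set 'rV[R]_n) (M : mesh R n) (p1 : (1 < p)%R).
Context (HOmega : polyhedral_lipschitz_domain Omega) (HM : triangulation kappa Omega M).
Context (HGamma : boundary_partition Omega GammaD GammaN).
Context (phi : 'rV[R]_n -> \bar R) (f : L0 M) (phi_proper : proper_fun phi).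
Context (phi_lsc : lower_semicontinuous phi).
Local Notation E := 'I_(ne M).
Let mO : measurable Omega. Proof. exact: measurable_Omega HOmega. Qed.
Local Notation bm := (bounded_measurable Omega).
Local Open Scope ereal_scope.

Let mphi : measurable_fun setT phi. Proof. exact: lower_semicontinuous_measurable_rV. Qed.
Let ibm h : bm h -> leb.-integrable Omega (EFin \o h).
Proof. exact: (bounded_measurable_integrable HOmega). Qed.

Lemma minorized_fenchel_pw1V (z : L1V M) :
  minorized leb Omega (fun x => fenchel phi (pw1V z x)).
Proof.
split.
  apply: (measurable_comp_rV (F := fenchel phi)) => // [|i].
    by apply: lower_semicontinuous_measurable_rV; exact: fenchel_lsc.
  have [mz _] := bounded_measurable_pw1V HOmega HM z i.
  exact: measurable_funS mz.
have [x0 [r0 e]] := proper_point phi_proper.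
exists (fun x => dotv (pw1V z x) x0 - r0)%R.
  apply: ibm; apply: bounded_measurableD; last exact: (bounded_measurable_cst Omega (- r0)%R).
  apply: bounded_measurable_dotv => i; first exact: (bounded_measurable_pw1V HOmega HM).
  exact: bounded_measurable_cst.
by move=> x _; apply: le_trans (fenchel_ge phi (pw1V z x) x0); rewrite e EFinB.
Qed.

Lemma integrable_wgrad u i : W1p p Omega u ->
  leb.-integrable Omega (EFin \o (fun x => wgrad p Omega u x 0%R i)).
Proof. by move=> /wgradP[Gp _]; exact: (in_Lp_integrable p1 HOmega (Gp i)). Qed.

Lemma measurable_phi_wgrad u : W1p p Omega u ->
  measurable_fun Omega (fun x => phi (wgrad p Omega u x)).
Proof.
move=> Wu; apply: (measurable_comp_rV (F := phi)) => // i.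
exact: measurable_weak_gradient (wgradP Wu) i.
Qed.

(** A slope s with finite conjugate gives the affine minorant s . y - phi^*(s) of [phi], which is
    integrable along a weak gradient. *)
Lemma minorized_phi_wgrad u s : W1p p Omega u -> fenchel phi s \is a fin_num ->
  minorized leb Omega (fun x => phi (wgrad p Omega u x)).
Proof.
move=> Wu fs; split; first exact: measurable_phi_wgrad.
exists (fun x => \sum_i s 0 i * wgrad p Omega u x 0 i - fine (fenchel phi s))%R.
  apply: integrable_realB => //; last exact: (ibm (bounded_measurable_cst _ _)).
  apply: integrable_real_sum => // i; apply: integrable_realZ => //.
  exact: integrable_wgrad.
move=> x _; have := fenchel_young phi_proper s (wgrad p Omega u x).
rewrite -(fineK fs); case: (phi _) => [r| |]//=; rewrite ?leey//.
by rewrite -EFinD !lee_fin /dotv => h; lra.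
Qed.

Lemma dotv_pw_bounded (z : L1V M) (c : L0V M) : bm (fun x => dotv (pw1V z x) (pw0V c x)).
Proof.
apply: bounded_measurable_dotv => i; first exact: (bounded_measurable_pw1V HOmega HM).
exact: (bounded_measurable_pw0V HM).
Qed.

Lemma load_bounded (v : L1 M) : bm (fun x => pw0 f x * pw1 v x)%R.
Proof.
apply: bounded_measurableM; first exact: (bounded_measurable_pw0 HM).
exact: (bounded_measurable_pw1 HOmega HM).
Qed.

Section equilibrated.
Context (z : L1V M) (zRT : RT Omega GammaN M z) (zf : forall k, divh z k = (- f k)%R).

Lemma pw0_div x : (pw0 (divh z) x = - pw0 f x)%R.
Proof. by rewrite /pw0 /piecewise; case: pickP => [k _|_]; rewrite ?zf ?oppr0. Qed.

Lemma load_CR (v : L1 M) : CR GammaD M v ->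
  (\int[leb]_(x in Omega) (pw0 f x * pw1 v x) =
   \int[leb]_(x in Omega) dotv (pw1V z x) (pw0V (gradh v) x))%R.
Proof.
move=> vCR; have := discrete_green HOmega HM HGamma zRT vCR.
under eq_Rintegral do rewrite pw0_div mulNr.
rewrite RintegralB//; last 2 first.
- exact: (ibm (dotv_pw_bounded z (gradh v))).
- exact: (ibm (load_bounded v)).
by move/eqP; rewrite subr_eq0 => /eqP ->.
Qed.

Lemma primal_S1D (v : L1 M) : S1D Omega GammaD M v ->
  primal Omega phi f p (pw1 v) =
  \int[leb]_(x in Omega) phi (pw0V (gradh v) x) -
  (\int[leb]_(x in Omega) dotv (pw1V z x) (pw0V (gradh v) x))%R%:E.
Proof.
move=> vS; rewrite /primal; congr (_ - _).
  apply: ae_eq_integral => //.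
  - exact: (measurable_phi_wgrad (S1D_W1p p1 HOmega HM vS)).
  - exact: (minorized_phi_pw0V HOmega HM phi_proper (gradh v)).1.
  - by apply: filterS (wgrad_S1D p1 HOmega HM vS) => x h Ox; rewrite h.
rewrite (Rintegral_fineK HOmega (ibm (load_bounded v))) load_CR//.
exact: (S1D_CR HM vS).
Qed.

Lemma estimatorE (v : L1 M) : estimator Omega phi f v z =
  \int[leb]_(x in Omega) phi (pw0V (gradh v) x) -
  (\int[leb]_(x in Omega) dotv (pw1V z x) (pw0V (gradh v) x))%R%:E +
  \int[leb]_(x in Omega) fenchel phi (pw1V z x).
Proof.
have id := ibm (dotv_pw_bounded z (gradh v)).
(* In equilibrium the second integrand of the estimator is identically zero. *)
rewrite /estimator [X in _ + X](_ : _ = 0) ?adde0; last first.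
  apply: integral0_eq => x _; rewrite psi_conjE /psi pw0_div.
  rewrite (_ : piecewise _ _ _ = 0); last first.
    by rewrite /piecewise; case: pickP => [k _|//]; rewrite zf eqxx.
  by rewrite adde0 -EFinB subrr.
have m1 := minorized_phi_pw0V HOmega HM phi_proper (gradh v).
have m2 := minorized_EFin (integrable_realN id).
rewrite (integralD_minorized mO (minorizedD mO m1 m2) (minorized_fenchel_pw1V z)).
rewrite (integralD_minorized mO m1 m2); congr (_ + _ + _).
rewrite /= (Rintegral_fineK HOmega (integrable_realN id)).
rewrite -mulN1r -(RintegralZl _ mO id); congr _%:E.
by apply: eq_Rintegral => x _; rewrite mulN1r.
Qed.

(** The bound is kept as a real t below a sum because both integrals may be +oo, and moving one of
    them across could produce oo - oo. *)
Lemma primal_lower_bound u s : W1pD p Omega GammaD u -> fenchel phi s \is a fin_num ->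
  exists2 t : R, primal Omega phi f p u =
      \int[leb]_(x in Omega) phi (wgrad p Omega u x) - t%:E &
    t%:E <= \int[leb]_(x in Omega) phi (wgrad p Omega u x) +
            \int[leb]_(x in Omega) fenchel phi (pw1V z x).
Proof.
move=> uD fs; have [Wu _] := uD; have iu := in_Lp_integrable p1 HOmega Wu.1.
have ifu : leb.-integrable Omega (EFin \o (fun x => pw0 f x * u x)%R).
  under eq_fun do rewrite mulrC.
  exact: (integrable_mulbm HOmega iu (bounded_measurable_pw0 HM f)).
have izu : leb.-integrable Omega (EFin \o (fun x => dotv (pw1V z x) (wgrad p Omega u x))).
  apply: integrable_real_sum => // i; under eq_fun do rewrite mulrC.
  exact: (integrable_mulbm HOmega (integrable_wgrad i Wu) (bounded_measurable_pw1V HOmega HM z i)).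
exists (\int[leb]_(x in Omega) (pw0 f x * u x))%R.
  by rewrite /primal (Rintegral_fineK HOmega ifu).
have := sobolev_green p1 HOmega HM HGamma uD zRT.
under eq_Rintegral do rewrite pw0_div mulNr.
rewrite RintegralB// => /eqP; rewrite subr_eq0 => /eqP <-.
have mu' := minorized_phi_wgrad Wu fs; have mz := minorized_fenchel_pw1V z.
rewrite -(integralD_minorized mO mu' mz).
apply: (le_integral_minorized mO (minorizedD mO mu' mz) izu) => x _.
exact: fenchel_young.
Qed.

End equilibrated.
End error_estimate.

Lemma finite_pw0V (R : realType) d (kappa : R) (Omega : set 'rV[R]_d.+1) (M : mesh R d.+1)
    (G : 'rV[R]_d.+1 -> \bar R) (c : L0V M) :
  polyhedral_lipschitz_domain Omega -> triangulation kappa Omega M ->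
  (forall k, G (c k) \is a fin_num) ->
  exists g : 'rV[R]_d.+1 -> R, [/\ bounded_measurable Omega g,
    forall x, Omega x -> G (pw0V c x) = (g x)%:E &
    (\int[lebesgueV R d.+1]_(x in Omega) G (pw0V c x))%E =
    (\int[lebesgueV R d.+1]_(x in Omega) g x)%:E].
Proof.
move=> HOmega HM fin; exists (fun x => fine (G (pw0V c x))).
have bg : bounded_measurable Omega (fun x => fine (G (pw0V c x))).
  under eq_fun do rewrite /pw0V (piecewise_map (fun s => fine (G s))).
  by apply: (bounded_measurable_piecewise HM) => k; exact: bounded_measurable_cst.
have GE x : Omega x -> G (pw0V c x) = (fine (G (pw0V c x)))%:E.
  move=> Ox; have [k pwE] := piecewise_Omega HM Ox.
  by rewrite fineK// /pw0V pwE.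
split => //; rewrite -(Rintegral_fineK HOmega (bounded_measurable_integrable HOmega bg)).
by apply: eq_integral => x /set_mem; exact: GE.
Qed.

Local Open Scope ereal_scope.

Theorem proposition5p1 (R : realType) (d : nat) (p kappa : R)
  (Omega GammaD GammaN : set 'rV[R]_d.+1) (M : mesh R d.+1)
  (phi : 'rV[R]_d.+1 -> \bar R) (f : L0 M)
  (u : 'rV[R]_d.+1 -> R)
  (rho : ('rV[R]_d.+1 -> R) -> ('rV[R]_d.+1 -> R) -> R)
  (ucr : L1 M) (zrt : L1V M)
  (Hp : (1 < p)%R)
  (HOmega : polyhedral_lipschitz_domain Omega)
  (HGamma : boundary_partition Omega GammaD GammaN)
  (HM : triangulation kappa Omega M)
  (Hsides : sides_compatible Omega GammaD GammaN M)
  (phi_proper : proper_fun phi)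
  (phi_convex : convex_efun phi)
  (phi_lsc : lower_semicontinuous phi)
  (I_proper : proper_on (W1pD p Omega GammaD) (primal Omega phi f p))
  (I_convex : convex_on (W1pD p Omega GammaD) (primal Omega phi f p))
  (I_coercive : weakly_coercive_on (W1pD p Omega GammaD) (W1p_norm p Omega)
    (primal Omega phi f p))
  (I_lsc : lsc_on (W1pD p Omega GammaD) (W1p_norm p Omega)
    (primal Omega phi f p))
  (Hu : minimizer (W1pD p Omega GammaD) (primal Omega phi f p) u)
  (Icr_min : exists v, minimizer (CR GammaD M) (primal_cr Omega phi f) v)
  (rho_ge0 : forall v w, W1pD p Omega GammaD v -> W1pD p Omega GammaD w ->
    (0 <= rho v w)%R)
  (rho_coco : forall v, W1pD p Omega GammaD v ->
    (rho v u)%:E <= primal Omega phi f p v - primal Omega phi f p u)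
  (Hucr : CR GammaD M ucr)
  (Hzrt : RT Omega GammaN M zrt)
  (strong_duality : primal_cr Omega phi f ucr = dual_rt Omega phi f zrt)
  (Hphi : \int[lebesgueV R d.+1]_(x in Omega) phi (pw0V (gradh ucr) x) =
    ereal_sup [set
      \int[lebesgueV R d.+1]_(x in Omega)
        (dotv (pw0V (gradh ucr) x) (pw0V (PihV Omega y) x))%:E -
      \int[lebesgueV R d.+1]_(x in Omega)
        fenchel phi (pw0V (PihV Omega y) x)
      | y in RT Omega GammaN M])
  (Hpsi : \int[lebesgueV R d.+1]_(x in Omega) psi_conj f x (pw0 (divh zrt) x) =
    ereal_sup [set
      \int[lebesgueV R d.+1]_(x in Omega)
        (pw0 (divh zrt) x * pw0 (Pih Omega v) x)%:E -
      \int[lebesgueV R d.+1]_(x in Omega) psi f x (pw0 (Pih Omega v) x)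
      | v in CR GammaD M]) :
  forall ut : L1 M, S1D Omega GammaD M ut ->
    (rho (pw1 ut) u)%:E <= estimator Omega phi f ut zrt /\
    estimator Omega phi f ut zrt =
      \int[lebesgueV R d.+1]_(x in Omega)
        (phi (pw0V (gradh ut) x) -
         (dotv (pw0V (PihV Omega zrt) x)
            (pw0V (gradh ut) x - pw0V (gradh ucr) x)%R)%:E -
         phi (pw0V (gradh ucr) x)) +
      \int[lebesgueV R d.+1]_(x in Omega)
        (fenchel phi (pw1V zrt x) - fenchel phi (pw0V (PihV Omega zrt) x)).
Proof.
move=> ut utS.
have [zf phif fphif sd] := strong_duality_finite HOmega HM phi_proper strong_duality.
have mO := measurable_Omega HOmega; have ibm := bounded_measurable_integrable HOmega.
have ucrE := load_CR HOmega HM HGamma Hzrt zf Hucr.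
have utW := S1D_W1pD Hp HOmega HM utS.
have estE := estimatorE HOmega HM phi_proper zf ut.
(* Any element supplies, through its value of Pi_h z, a slope at which the conjugate is finite. *)
have [k0 _] := element_exists HOmega HM.
have [uD _] := Hu.
have [t uE tle] := primal_lower_bound Hp HOmega HM HGamma phi_proper phi_lsc Hzrt zf uD (fphif k0).
have m1 := minorized_phi_pw0V HOmega HM phi_proper (gradh ut).
have m2 := minorized_fenchel_pw1V HOmega HM phi_proper zrt.
have nA := minorized_neq_ninfty mO m1; have nB := minorized_neq_ninfty mO m2.
have [P [bP PE iP]] := finite_pw0V HOmega HM phif.
have [Q [bQ QE iQ]] := finite_pw0V HOmega HM fphif.
split.
  have := rho_coco _ utW; move/le_trans; apply.
  rewrite uE (primal_S1D Hp HOmega HM HGamma phi_proper phi_lsc Hzrt zf utS) estE.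
  move: nA nB tle.
  set A := \int[_]_(x in Omega) phi (pw0V _ x).
  set B := \int[_]_(x in Omega) fenchel _ _.
  set C := \int[_]_(x in Omega) phi (wgrad _ _ _ _).
  set z := Rintegral _ _ _.
  (* A and B are not -oo, and [tle] excludes C = -oo when B is real. The infinite cases follow from
     the order alone; the real one reduces to t <= c + b. *)
  case: A => [a| |]//; case: B => [b| |]//; case: C => [c| |]// _ _; rewrite ?leey ?leNye//.
  by rewrite -!EFinD !lee_fin => h; lra.
pose zg (v : L1 M) := (\int[lebesgueV R d.+1]_(x in Omega) dotv (pw1V zrt x) (pw0V (gradh v) x))%R.
have bzg (v : L1 M) : bounded_measurable Omega
    (fun x => dotv (pw0V (PihV Omega zrt) x) (pw0V (gradh v) x)).
  by apply: bounded_measurable_dotv => i; exact: (bounded_measurable_pw0V HM).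
(* Everything in the first integrand except the term in [gradh ut] under [phi] is real and bounded,
   so that term alone calls for extended-real additivity. *)
pose r1 x := (- dotv (pw0V (PihV Omega zrt) x) (pw0V (gradh ut) x) +
  dotv (pw0V (PihV Omega zrt) x) (pw0V (gradh ucr) x) - P x)%R.
have br1 : bounded_measurable Omega r1.
  apply: bounded_measurableD; last exact: bounded_measurableN.
  by apply: bounded_measurableD => //; exact: bounded_measurableN.
have e1 : \int[lebesgueV R d.+1]_(x in Omega)
    (phi (pw0V (gradh ut) x) -
     (dotv (pw0V (PihV Omega zrt) x) (pw0V (gradh ut) x - pw0V (gradh ucr) x)%R)%:E -
     phi (pw0V (gradh ucr) x)) =
    \int[lebesgueV R d.+1]_(x in Omega) phi (pw0V (gradh ut) x) +
    (\int[lebesgueV R d.+1]_(x in Omega) r1 x)%R%:E.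
  rewrite -(Rintegral_fineK HOmega (ibm _ br1)).
  rewrite -(integralD_minorized mO m1 (minorized_EFin (ibm _ br1))).
  apply: eq_integral => x /set_mem Ox; rewrite (PE _ Ox) -addeA -EFinN -EFinN -EFinD.
  by congr (_ + _%:E); rewrite /r1 dotvBr; lra.
have bNQ := bounded_measurableN bQ.
have e2 : \int[lebesgueV R d.+1]_(x in Omega)
    (fenchel phi (pw1V zrt x) - fenchel phi (pw0V (PihV Omega zrt) x)) =
    \int[lebesgueV R d.+1]_(x in Omega) fenchel phi (pw1V zrt x) +
    (\int[lebesgueV R d.+1]_(x in Omega) - Q x)%R%:E.
  rewrite -(Rintegral_fineK HOmega (ibm _ bNQ)).
  rewrite -(integralD_minorized mO m2 (minorized_EFin (ibm _ bNQ))).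
  by apply: eq_integral => x /set_mem Ox; rewrite (QE _ Ox).
have r1E : (\int[lebesgueV R d.+1]_(x in Omega) r1 x = - zg ut + zg ucr -
    \int[lebesgueV R d.+1]_(x in Omega) P x)%R.
  rewrite /zg -!(PihV_Rintegral HOmega HM) /r1.
  rewrite RintegralB//; last 2 first.
  - by apply: ibm; apply: bounded_measurableD => //; exact: bounded_measurableN.
  - exact: ibm.
  rewrite RintegralD//; last 2 first.
  - by apply: ibm; exact: bounded_measurableN.
  - exact: ibm.
  congr (_ + _ - _)%R; rewrite -[RHS]mulN1r -RintegralZl//; last exact: ibm.
  by apply: eq_Rintegral => x _; rewrite mulN1r.
have NQE : (\int[lebesgueV R d.+1]_(x in Omega) - Q x =
    - \int[lebesgueV R d.+1]_(x in Omega) Q x)%R.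
  rewrite -[RHS]mulN1r -RintegralZl//; last exact: ibm.
  by apply: eq_Rintegral => x _; rewrite mulN1r.
rewrite estE e1 e2 r1E NQE.
(* Through [ucrE] strong duality reads: the integrals of P and Q add up to [zg ucr]. These are
   exactly the terms by which the two sides differ. *)
move: sd; rewrite iP iQ -EFinD ucrE => -[]; rewrite -/(zg ucr) -/(zg ut) => sd.
move: nA nB.
set A := \int[_]_(x in Omega) phi _; set B := \int[_]_(x in Omega) fenchel _ _.
case: A => [a| |]//; case: B => [b| |]// _ _.
by rewrite -!EFinD; congr _%:E; lra.
Qed.
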